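(* Let $f$ and $g$ be nonconstant meromorphic functions without common poles on a compact Riemann surface $M$. Then the elimination function $\mathcal{E}_{f,g}(z,w)=\mathcal{R}(f-z,g-w)$ is well defined for all $(z,w)\in\mathbb{C}^2$ except for finitely many pairs $(z,w)$, and it is a rational function of the form $$\mathcal{E}_{f,g}(z,w)=\frac{Q(z,w)}{P(z)R(w)},$$ where $Q,P,R$ are polynomials and $$P(z)=\prod_{d\in g^{-1}(\infty)}(z-f(d)),\qquad R(w)=\prod_{b\in f^{-1}(\infty)}(w-g(b)),$$ the products being taken over poles counted with multiplicities.
   Context: For a meromorphic function $f\not\equiv0,\infty$ on the compact Riemann surface $M$, $\operatorname{ord}_a(f)$ denotes the order of $f$ at $a$ (positive at zeros, negative at poles). A pair $f,g$ is admissible if the function $a\mapsto\operatorname{ord}_a(f)\operatorname{ord}_a(g)$ is either $\ge0$ on all of $M$ or $\le0$ on all of $M$. For an admissible pair, the meromorphic resultant $$\mathcal{R}(f,g)=g((f))=\prod_{a\in M}g(a)^{\operatorname{ord}_a(f)}$$ is well defined as an element of $\mathbb{C}\cup\{\infty\}$ (factors with $\operatorname{ord}_a(f)=0$ are $1$; $0^k=0$, $\infty^k=\infty$ for $k>0$, and $0^k=\infty$, $\infty^k=0$ for $k<0$). The elimination function is said to be well defined at $(z,w)$ if the pair $f-z$, $g-w$ is admissible. *)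

(* Defs.v *)
From HB Require Import structures.
From mathcomp Require Import all_boot all_order all_algebra.
From mathcomp Require Import all_classical all_reals all_analysis.
From mathcomp Require Import complex.
Set Implicit Arguments.
Unset Strict Implicit.
Unset Printing Implicit Defensive.
Import Order.TTheory GRing.Theory Num.Theory.
Import numFieldNormedType.Exports.
Local Open Scope classical_set_scope.
Local Open Scope ring_scope.
Local Open Scope complex_scope.

(* R[i] carries its topology and its normed-module structure over itself only
   under the alias R[i]^o; [derivable h z 1] is then complex
   differentiability of h at z. *)

Definition holomorphic_near (R : realType) (h : R[i]^o -> R[i]^o) (z : R[i]^o) :
  Prop := \forall u \near z, derivable h u 1.

(* [chart_map] is a homeomorphism from the open set [chart_dom] onto an open
   subset of the complex plane, with inverse [chart_inv]; the values of the two
   functions outside these sets are irrelevant. *)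
Record chart (R : realType) (M : topologicalType) := Chart {
  chart_dom : set M;
  chart_map :> M -> R[i]^o;
  chart_inv : R[i]^o -> M;
  chart_dom_open : open chart_dom;
  chart_cod_open : open (chart_map @` chart_dom);
  chart_mapK : forall x, chart_dom x -> chart_inv (chart_map x) = x;
  chart_map_continuous : {within chart_dom, continuous chart_map};
  chart_inv_continuous :
    {within chart_map @` chart_dom, continuous chart_inv}
}.

Record riemannSurface (R : realType) := RiemannSurface {
  rs_carrier :> topologicalType;
  rs_hausdorff : hausdorff_space rs_carrier;
  rs_connected : connected [set: rs_carrier];
  rs_atlas : set (chart R rs_carrier);
  rs_cover : forall x, exists2 c, rs_atlas c & chart_dom c x;
  rs_transition : forall c1 c2, rs_atlas c1 -> rs_atlas c2 ->
    forall x, chart_dom c1 x -> chart_dom c2 x ->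
    holomorphic_near (c2 \o chart_inv c1) (c1 x)
}.

(* The Riemann sphere: [None] is the point at infinity. *)
Definition sphere (R : realType) : Type := option R[i].

Section SphereOperations.
Variable R : realType.
Implicit Types x y : sphere R.

Definition sphere_sub x (z : R[i]) : sphere R := omap (fun u => u - z) x.

Definition sphere_inv x : sphere R :=
  match x with
  | Some u => if u == 0 then None else Some u^-1
  | None => Some 0
  end.

(* The product of 0 and infinity, which never arises in the resultant of an
   admissible pair, is set to 0; this keeps the operation associative. *)
Definition sphere_mul x y : sphere R :=
  match x, y with
  | Some u, Some v => Some (u * v)
  | Some u, None | None, Some u => if u == 0 then Some 0 else None
  | None, None => None
  end.

Definition sphere_exp x (k : int) : sphere R :=
  match x with
  | Some u => if (u == 0) && (k < 0) then None else Some (u ^ k)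
  | None => if k == 0 then Some 1 else if k < 0 then Some 0 else None
  end.

(* q / p as a point of the sphere: it is infinity iff p = 0 and q != 0. *)
Definition sphere_quot (q p : R[i]) : sphere R :=
  sphere_mul (Some q) (sphere_inv (Some p)).

Lemma sphere_mulC : commutative sphere_mul.
Proof. by move=> [u|] [v|] //=; rewrite mulrC. Qed.

Lemma sphere_mul1 : left_id (Some 1) sphere_mul.
Proof. by move=> [u|] /=; rewrite ?mul1r ?oner_eq0. Qed.

Lemma sphere_mulA : associative sphere_mul.
Proof.
move=> [u|] [v|] [w|] //=; rewrite ?mulrA ?mulf_eq0 //.
- by case: (v == 0); rewrite ?orbT ?orbF ?mulr0.
- by case: eqVneq => [->|/negPf nw]; case: (u == 0);
    rewrite /= ?nw ?eqxx ?mulr0 ?mul0r.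
- by case: (u == 0) => //=; rewrite eqxx.
- by case: (v == 0) => //=; rewrite mul0r.
- by case: (w == 0); rewrite ?eqxx.
Qed.

End SphereOperations.

HB.instance Definition _ (R : realType) :=
  Monoid.isComLaw.Build (sphere R) (Some 1) (@sphere_mul R)
    (@sphere_mulA R) (@sphere_mulC R) (@sphere_mul1 R).

Section MeromorphicFunctions.
Variables (R : realType) (M : riemannSurface R).
Implicit Types (f g : M -> sphere R) (a : M).

Definition holomorphic_at (h : M -> R[i]^o) a : Prop :=
  forall c, rs_atlas c -> chart_dom c a ->
  holomorphic_near (h \o chart_inv c) (c a).

(* Holomorphy at a as a map to the sphere, in the coordinate u near finite
   points and 1/u near infinity. *)
Definition sphere_holomorphic_at f a : Prop :=
  if f a is Some _ then
    (\forall x \near a, f x <> None) /\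
    holomorphic_at (fun x => odflt 0 (f x)) a
  else
    (\forall x \near a, f x <> Some 0) /\
    holomorphic_at (fun x => odflt 0 (sphere_inv (f x))) a.

Definition meromorphic f : Prop :=
  (forall a, sphere_holomorphic_at f a) /\ exists a, f a <> None.

Definition nonconstant f : Prop := exists a b, f a <> f b.

Definition has_ord f a (n : int) : Prop :=
  exists c, [/\ rs_atlas c, chart_dom c a &
    exists h : R[i]^o -> R[i]^o,
      [/\ holomorphic_near h (c a), h (c a) <> 0 &
        \forall x \near a^', f x = Some ((c x - c a : R[i]) ^ n * h (c x))]].

(* Meaningful for meromorphic f not identically 0. *)
Definition mero_ord f a : int := xget 0 [set n | has_ord f a n].

Definition admissible f g : Prop :=
  (forall a, 0 <= mero_ord f a * mero_ord g a) \/
  (forall a, mero_ord f a * mero_ord g a <= 0).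

Definition mero_resultant f g : sphere R :=
  \big[@sphere_mul R/Some 1]_(a \in [set: M]) sphere_exp (g a) (mero_ord f a).

Definition mero_sub f (z : R[i]) : M -> sphere R := fun a => sphere_sub (f a) z.

Definition elimination_defined f g (z w : R[i]) : Prop :=
  admissible (mero_sub f z) (mero_sub g w).

Definition elimination f g (z w : R[i]) : sphere R :=
  mero_resultant (mero_sub f z) (mero_sub g w).

Definition poles f : set M := [set a | f a = None].

(* The product of X - f(d) over the poles d of g, with multiplicities; f is
   assumed to be finite at these points. *)
Definition pole_poly f g : {poly R[i]} :=
  \big[*%R/1]_(d \in poles g) ('X - (odflt 0 (f d))%:P) ^+ `|mero_ord g d|%N.

End MeromorphicFunctions.

(* Main.v *)
Require Import Defs.
From HB Require Import structures.
From mathcomp Require Import all_boot all_order all_algebra.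
From mathcomp Require Import all_classical all_reals all_analysis.
From mathcomp Require Import complex.
From mathcomp Require Import separable cyclotomic ring lra.
Set Implicit Arguments.
Unset Strict Implicit.
Unset Printing Implicit Defensive.
Import Order.TTheory GRing.Theory Num.Theory.
Import numFieldNormedType.Exports.
Local Open Scope classical_set_scope.
Local Open Scope ring_scope.
Local Open Scope complex_scope.

(** Let T(z, w) be the product of g(a) - w over the points a with f(a) = z,
    counted with multiplicities ([fiber_prod]). The poles of f contribute
    1 / R(w) to the resultant, up to a sign, so the elimination function is
    T(z, w) / R(w) up to that sign as long as neither P(z) nor R(w) vanishes
    ([elimination_regular]). For fixed z, T is a polynomial in w. The core of
    the proof is that for fixed w the product T(z, w) P(z) is a polynomial in
    z, of degree bounded independently of w ([numerator_poly]). A function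
    that is polynomial in each variable, with bounded degree in one of them,
    is a polynomial in both, by interpolation ([bivariate_numerator]).

    To see the polynomial in z, consider the fibre of f near a value z0.
    Around each point over z0 there is a coordinate u with f = z0 + u ^ m
    ([normal_coord]); by compactness, the fibre over a nearby z consists of
    the points with u ^ m = z - z0 in these coordinates, and they are simple
    ([fiber_local_structure]). So T is locally a finite product of functions
    of the form y |-> product of K(u) over u ^ m = y, where K is g - w in the
    coordinate u and y = z - z0. Such a function is holomorphic for y nonzero,
    because the root has holomorphic branches, and if K(u) u ^ e has a limit
    at 0 then the function times y ^ e has one too ([cvg_root_prod]). The
    exponents e are the orders of the poles of g, and P supplies exactly the
    powers (z - z0) ^ e. Hence T P has a finite limit at every z0, and this
    limit is not 0 if f - z0 and g - w have no common zero. The same local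
    analysis for 1 / f shows that T is bounded near infinity
    ([fiber_prod_inv]), and Liouville's theorem makes T P a polynomial.

    When P(z) R(w) = 0 and the pair is admissible, there is no common zero
    ([no_common_zero]). Then the elimination function is infinite
    ([elimination_infinite]) and so is the quotient, its numerator being
    nonzero by the remark on the limit.

    Only pointwise complex differentiability is given, so the complex analysis
    starts from Goursat's bisection. It is run on Riemann sums instead of
    integrals ([goursat]) and, in the coordinate log z, yields Cauchy's
    estimate for the first derivative ([cauchy_estimate]). Together with the
    mean value inequality this estimate suffices for the differentiability of
    derivatives ([hol_derive_derivable]), the orders of zeros ([hol_order]),
    local inverses ([local_inverse]) and Liouville's theorem
    ([meromorphic_growth_poly]), without power series. *)

(** * The real-valued modulus and complex derivatives *)

Section Modulus.
Variable R : realType.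
Local Notation C := (R[i]^o).

(** The modulus with values in [R] instead of [R[i]], so that estimates become
    inequalities in an ordered field. *)
Definition cabs (z : C) : R := complex.Re `|z|.

Lemma cabsE (z : C) : `|z| = (cabs z)%:C :> R[i].
Proof. by rewrite /cabs normc_def. Qed.

Lemma cabs_ge0 (z : C) : 0 <= cabs z.
Proof. by rewrite -ler0c -cabsE. Qed.

Lemma cabs0 : cabs 0 = 0.
Proof. by apply: complexI; rewrite -cabsE normr0. Qed.

Lemma cabs1 : cabs 1 = 1.
Proof. by apply: complexI; rewrite -cabsE normr1. Qed.

Lemma cabsM (x y : C) : cabs (x * y) = cabs x * cabs y.
Proof. by apply: complexI; rewrite -cabsE normrM !cabsE rmorphM. Qed.

Lemma cabsX (x : C) n : cabs (x ^+ n) = cabs x ^+ n.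
Proof. by elim: n => [|n IH]; rewrite ?expr0 ?cabs1 // !exprS cabsM IH. Qed.

Lemma cabsV (x : C) : cabs x^-1 = (cabs x)^-1.
Proof. by apply: complexI; rewrite -cabsE normfV cabsE fmorphV. Qed.

Lemma cabsN (x : C) : cabs (- x) = cabs x.
Proof. by rewrite /cabs normrN. Qed.

Lemma cabsB (x y : C) : cabs (x - y) = cabs (y - x).
Proof. by rewrite -cabsN opprB. Qed.

Lemma cabsD (x y : C) : cabs (x + y) <= cabs x + cabs y.
Proof. by rewrite -lecR rmorphD /= -!cabsE; exact: ler_normD. Qed.

Lemma cabs_le_sub (x y : C) : cabs x <= cabs (x - y) + cabs y.
Proof. by rewrite -{1}(subrK y x) cabsD. Qed.

Lemma cabs_eq0 (x : C) : (cabs x == 0) = (x == 0).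
Proof. by rewrite -[RHS]normr_eq0 -(inj_eq (@complexI R)) -cabsE. Qed.

Lemma cabs_gt0 (x : C) : (0 < cabs x) = (x != 0).
Proof. by rewrite lt_def cabs_eq0 cabs_ge0 andbT. Qed.

Lemma cabs_real (x : R) : cabs (x%:C : C) = `|x|.
Proof. by rewrite /cabs normc_def /= expr0n addr0 sqrtr_sqr. Qed.

Lemma cabs_Re (z : C) : `|complex.Re z| <= cabs z.
Proof. by rewrite -lecR -cabsE; exact: normc_ge_Re. Qed.

Lemma cabs_i : cabs ('i : R[i]) = 1.
Proof. by rewrite /cabs normc_def /= expr0n expr1n add0r sqrtr1. Qed.

Lemma cabs_Im (z : C) : `|complex.Im z| <= cabs z.
Proof.
have := cabs_Re (z * ('i : R[i]) : C); rewrite cabsM cabs_i mulr1.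
by rewrite (@ReiNIm R) normrN.
Qed.

Lemma cabs_ReIm (z : C) : cabs z <= `|complex.Re z| + `|complex.Im z|.
Proof.
rewrite {1}(complexE z) (le_trans (cabsD _ _))// cabsM cabs_i mul1r.
by rewrite !cabs_real.
Qed.

Lemma cabs_nat n : cabs (n%:R) = n%:R.
Proof. by rewrite -(rmorph_nat (real_complex R)) cabs_real normr_nat. Qed.

Lemma cabs_sum (I : Type) (r : seq I) (P : pred I) (F : I -> C) :
  cabs (\sum_(i <- r | P i) F i) <= \sum_(i <- r | P i) cabs (F i).
Proof.
elim/big_rec2: _ => [|i y1 y2 _ h]; first by rewrite cabs0.
by rewrite (le_trans (cabsD _ _))// lerD2l.
Qed.

Lemma gt0C (e : R[i]) : 0 < e -> exists2 d : R, 0 < d & e = d%:C.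
Proof.
move=> e0; exists (complex.Re e).
  by move: e0; rewrite ltcE /= => /andP[].
by rewrite RRe_real// gtr0_real.
Qed.

Lemma nbhsCP (z : C) (P : set C) :
  nbhs z P <-> exists2 e : R, 0 < e & forall x : C, cabs (x - z) < e -> P x.
Proof.
split.
  move=> /nbhs_ballP[e /= /gt0C[d d0 ->] h]; exists d => // x xz; apply: h.
  by rewrite -ball_normE /= distrC cabsE ltcR.
move=> [e e0 h]; apply/nbhs_ballP; exists e%:C => /=; first by rewrite ltcR.
by move=> x; rewrite -ball_normE /= distrC cabsE ltcR => /h.
Qed.

Lemma dnbhsCP (z : C) (P : set C) :
  (\forall x \near z^', P x) <->
  exists2 e : R, 0 < e & forall x : C, x != z -> cabs (x - z) < e -> P x.
Proof.
rewrite near_withinE; split=> [/nbhsCP[e e0 h]|[e e0 h]].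
  by exists e => // x xz xe; exact: h.
by apply/nbhsCP; exists e => // x xe xz; exact: h.
Qed.

Lemma cvgCP (T : Type) (F : set_system T) (FF : Filter F) (f : T -> C) (l : C) :
  f @ F --> l <-> forall e : R, 0 < e -> \forall x \near F, cabs (f x - l) < e.
Proof.
split=> [/(cvgrPdist_lt f l).1 h e e0|h].
  by near=> x; rewrite cabsB -ltcR -cabsE; near: x; apply: h; rewrite ltcR.
apply/(cvgrPdist_lt f l) => _ /gt0C[e e0 ->]; near=> x.
by rewrite cabsE ltcR cabsB; near: x; exact: h.
Unshelve. all: by end_near. Qed.

Lemma is_deriveCP (h : C -> C) (u d : C) :
  is_derive u 1 h d <->
  forall e : R, 0 < e -> exists2 r : R, 0 < r & forall z : C,
    cabs (z - u) < r ->
    cabs (h z - h u - d * (z - u)) <= e * cabs (z - u).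
Proof.
have key : (fun k : C => k^-1 *: (h (k *: (1 : C) + u) - h u)) @ 0^' --> d <->
  forall e : R, 0 < e -> exists2 r : R, 0 < r & forall z : C,
    cabs (z - u) < r ->
    cabs (h z - h u - d * (z - u)) <= e * cabs (z - u).
  split.
    move=> /cvgCP cv e e0; have /dnbhsCP[r r0 hr] := cv e e0.
    exists r => // z zu; have [->|zu0] := eqVneq z u.
      by rewrite !subrr mulr0 subr0 cabs0 mulr0.
    have zu1 : z - u != 0 by rewrite subr_eq0.
    have := hr (z - u) zu1; rewrite subr0 => /(_ zu) /ltW.
    rewrite [_ *: (1 : C)]mulr1 subrK => le1.
    have -> : h z - h u - d * (z - u) =
        ((z - u)^-1 *: (h z - h u) - d) * (z - u).
      by rewrite /GRing.scale /=; field.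
    by rewrite cabsM ler_wpM2r// cabs_ge0.
  move=> H; apply/cvgCP => e e0;
    have [r r0 hr] := H (e / 2) (divr_gt0 e0 (ltr0Sn _ _)).
  apply/dnbhsCP; exists r => // z z0; rewrite subr0 => zr.
  have := hr (z + u); rewrite addrK => /(_ zr).
  rewrite [_ *: (1 : C)]mulr1.
  have -> : h (z + u) - h u - d * z = (z^-1 *: (h (z + u) - h u) - d) * z.
    by rewrite /GRing.scale /=; field.
  rewrite cabsM ler_pM2r ?cabs_gt0// => /le_lt_trans; apply; lra.
split.
  by move=> [dh dE]; apply/key; rewrite -dE; exact: dh.
move=> /key cv; split; first by apply/cvg_ex; exists d.
exact: cvg_lim.
Qed.

Lemma derivableCP (h : C -> C) (u : C) :
  derivable h u 1 ->
  forall e : R, 0 < e -> exists2 r : R, 0 < r & forall z : C,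
    cabs (z - u) < r ->
    cabs (h z - h u - 'D_1 h u * (z - u)) <= e * cabs (z - u).
Proof. by move=> dh; apply/is_deriveCP; exact: (DeriveDef dh). Qed.

End Modulus.

Section Derivatives.
Variable R : realType.
Local Notation C := (R[i]^o).
Implicit Types (f g h : C -> C) (u z : C).

Lemma der_comp f g u d e : is_derive u 1 g d -> is_derive (g u) 1 f e ->
  is_derive u 1 (fun z => f (g z) : C) (e * d).
Proof.
move=> /is_deriveCP dg /is_deriveCP df; apply/is_deriveCP => eps eps0.
set A := cabs d + 1; set B := cabs e + 1.
have A0 : 0 < A by rewrite ltr_wpDl ?cabs_ge0.
have B0 : 0 < B by rewrite ltr_wpDl ?cabs_ge0.
have ef0 : 0 < eps / 2 / A by rewrite !divr_gt0.
have eg0 : 0 < eps / 2 / B by rewrite !divr_gt0.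
have [rf rf0 hf] := df _ ef0; have [rg rg0 hg] := dg _ eg0.
have [r1 r10 h1] := dg 1 ltr01.
exists (Num.min (Num.min rg r1) (rf / A)) => [|z].
  by rewrite !lt_min rg0 r10 divr_gt0.
rewrite !lt_min => /andP[/andP[zg z1] zA].
have gA : cabs (g z - g u) <= A * cabs (z - u).
  rewrite (le_trans (cabs_le_sub _ (d * (z - u))))// (le_trans (lerD (h1 z z1)
    (lexx _)))//.
  by rewrite cabsM /A mulrDl addrC.
have gf : cabs (g z - g u) < rf.
  by rewrite (le_lt_trans gA)// mulrC -ltr_pdivlMr.
have -> : f (g z) - f (g u) - e * d * (z - u) =
  (f (g z) - f (g u) - e * (g z - g u)) + e * (g z - g u - d * (z - u)) by ring.
rewrite (le_trans (cabsD _ _))// cabsM.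
have le1 : cabs (f (g z) - f (g u) - e * (g z - g u)) <= eps / 2 * cabs (z - u).
  rewrite (le_trans (hf _ gf))// (le_trans (ler_wpM2l (ltW ef0) gA))//.
  by rewrite mulrA divfK ?gt_eqF.
have le2 : cabs e * cabs (g z - g u - d * (z - u)) <= eps / 2 * cabs (z - u).
  rewrite (le_trans (ler_wpM2l (cabs_ge0 _) (hg z zg)))//.
  rewrite mulrA ler_wpM2r ?cabs_ge0// mulrC mulrAC -mulrA ler_piMr ?divr_ge0
    ?ltW//.
  by rewrite ltr_pdivrMr// mul1r ltrDl.
by rewrite (le_trans (lerD le1 le2))// -mulrDl -splitr.
Qed.

Lemma der_cst (c : C) u : is_derive u 1 (fun=> c) 0.
Proof. exact: is_derive_cst. Qed.

Lemma der_id u : is_derive u 1 (fun z : C => z) 1.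
Proof. exact: is_derive_id. Qed.

Lemma derD f g u d e : is_derive u 1 f d -> is_derive u 1 g e ->
  is_derive u 1 (fun z => f z + g z : C) (d + e).
Proof. by move=> df dg; exact: is_deriveD. Qed.

Lemma derB f g u d e : is_derive u 1 f d -> is_derive u 1 g e ->
  is_derive u 1 (fun z => f z - g z : C) (d - e).
Proof. by move=> df dg; exact: is_deriveB. Qed.

Lemma derM f g u d e : is_derive u 1 f d -> is_derive u 1 g e ->
  is_derive u 1 (fun z => f z * g z : C) (f u * e + g u * d).
Proof. by move=> df dg; exact: is_deriveM. Qed.

Lemma derV f u d : f u != 0 -> is_derive u 1 f d ->
  is_derive u 1 (fun z => (f z)^-1 : C) (- (f u) ^- 2 * d).
Proof.
move=> fu [df <-]; split; first exact: derivableV.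
by rewrite deriveV.
Qed.

Lemma derX f u d n : is_derive u 1 f d ->
  is_derive u 1 (fun z => f z ^+ n : C) (n%:R * f u ^+ n.-1 * d).
Proof.
move=> df; have := @is_deriveX _ _ f n u 1 d df.
by congr is_derive; apply/funext => z; elim: n => [//|n IH];
  rewrite !exprS /= -IH.
Qed.

Lemma der_near_eq f g u d : (\forall z \near u, f z = g z) ->
  is_derive u 1 f d -> is_derive u 1 g d.
Proof. exact: near_eq_is_derive. Qed.

Lemma der_derive f u : derivable f u 1 -> is_derive u 1 f ('D_1 f u).
Proof. by move=> df; split. Qed.

Lemma der_val f u d : is_derive u 1 f d -> 'D_1 f u = d.
Proof. by case. Qed.

Lemma der_uniq f u d e : is_derive u 1 f d -> is_derive u 1 f e -> d = e.
Proof. by move=> [_ <-] [_ <-]. Qed.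

Lemma der_derivable f u d : is_derive u 1 f d -> derivable f u 1.
Proof. by case. Qed.

Lemma derivable_cvg f u : derivable f u 1 -> f z @[z --> u] --> f u.
Proof. by move=> /derivable1_diffP/differentiable_continuous. Qed.

Lemma der_quot f u d : is_derive u 1 f d <->
  (f z - f u) / (z - u) @[z --> u^'] --> d.
Proof.
rewrite is_deriveCP cvgCP; split=> H e e0.
  have [r r0 hr] := H (e / 2) (divr_gt0 e0 (ltr0Sn _ _)).
  apply/dnbhsCP; exists r => // z zu zr;
    have zu1 : z - u != 0 by rewrite subr_eq0.
  have := hr z zr.
  have -> : f z - f u - d * (z - u) = ((f z - f u) / (z - u) - d) * (z - u).
    by field.
  rewrite cabsM ler_pM2r ?cabs_gt0// => /le_lt_trans; apply; lra.
have /dnbhsCP[r r0 hr] := H e e0.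
exists r => // z zr; have [->|zu] := eqVneq z u.
  by rewrite !subrr mulr0 subr0 cabs0 mulr0.
have zu1 : z - u != 0 by rewrite subr_eq0.
have -> : f z - f u - d * (z - u) = ((f z - f u) / (z - u) - d) * (z - u).
  by field.
by rewrite cabsM ler_wpM2r ?cabs_ge0// ltW// hr.
Qed.

End Derivatives.

(** * Goursat's lemma for Riemann sums *)

Section Goursat.
Variable R : realType.
Local Notation C := (R[i]^o).

Lemma nested_interval (s h : nat -> R) : (forall k, 0 <= h k) ->
  (forall k, s k <= s k.+1) -> (forall k, s k.+1 + h k.+1 <= s k + h k) ->
  exists x, forall k, s k <= x <= s k + h k.
Proof.
move=> h0 si sd.
have si' : {homo s : i j / (i <= j)%N >-> i <= j}.
  by apply: homo_leq => // y x z; exact: le_trans.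
have sd' : {homo (fun k => s k + h k) : i j / (i <= j)%N >-> j <= i}.
  by apply: homo_leq => // y x z xy yz; exact: le_trans yz xy.
have ub k j : s j <= s k + h k.
  case: (leqP j k) => jk; first by rewrite (le_trans (si' _ _ jk))// lerDl.
  by rewrite (le_trans _ (sd' _ _ (ltnW jk)))// lerDl.
have hs : has_sup (range s).
  by split; [exists (s 0%N), 0%N|exists (s 0%N + h 0%N) => _ [j _ <-]].
exists (sup (range s)) => k; apply/andP; split.
  by apply: ub_le_sup; [exact: hs.2|exists k].
by apply: ge_sup => [|_ [j _ <-]//]; exact: hs.1.
Qed.

(** Bolzano's bisection in the unit square: a property of dyadic squares (level
    [k], lower left corner [(s, t)]) that always passes to one of the four
    quarters holds at every level for some square around one and the same
    point. *)
Lemma bisection (Bad : nat -> R -> R -> Prop) : Bad 0%N 0 0 ->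
  (forall k s t, Bad k s t -> exists b c : bool,
     Bad k.+1 (s + b%:R / 2 ^+ k.+1) (t + c%:R / 2 ^+ k.+1)) ->
  exists s t, [/\ 0 <= s <= 1, 0 <= t <= 1 & forall k, exists s' t',
    [/\ Bad k s' t', s' <= s <= s' + 2 ^- k & t' <= t <= t' + 2 ^- k]].
Proof.
move=> bad0 badS.
have [nx hnx] : {nx : nat * R * R -> bool * bool & forall x,
    Bad x.1.1 x.1.2 x.2 ->
    Bad x.1.1.+1 (x.1.2 + (nx x).1%:R / 2 ^+ x.1.1.+1)
      (x.2 + (nx x).2%:R / 2 ^+ x.1.1.+1)}.
  apply: (@choice _ _ (fun (x : nat * R * R) (y : bool * bool) =>
    Bad x.1.1 x.1.2 x.2 -> Bad x.1.1.+1 (x.1.2 + y.1%:R / 2 ^+ x.1.1.+1)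
      (x.2 + y.2%:R / 2 ^+ x.1.1.+1))) => -[[k s] t];
        have [/badS[b [c H]]|nb] := pselect (Bad k s t).
    by exists (b, c).
  by exists (true, true).
pose q := fix q k : R * R := if k is k'.+1 then
  let b := nx (k', (q k').1, (q k').2) in
  ((q k').1 + b.1%:R / 2 ^+ k, (q k').2 + b.2%:R / 2 ^+ k) else (0, 0).
have badq k : Bad k (q k).1 (q k).2.
  by elim: k => [//|k IH]; exact: (hnx (k, (q k).1, (q k).2) IH).
have h0 k : 0 <= (2 : R) ^- k by rewrite invr_ge0 exprn_ge0.
have stepi (b : bool) (x : R) k : x <= x + b%:R / 2 ^+ k.+1.
  by rewrite lerDl mulr_ge0.
have stepd (b : bool) (x : R) k :
    x + b%:R / 2 ^+ k.+1 + 2 ^- k.+1 <= x + 2 ^- k.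
  have -> : (2 : R) ^- k = 2 ^- k.+1 + 2 ^- k.+1.
    by rewrite exprS; field; rewrite expf_neq0.
  by rewrite -addrA lerD2l lerD2r; case: b; rewrite ?mul1r// mul0r.
have [s hs] := @nested_interval (fun k => (q k).1) (fun k => 2 ^- k) h0
  (fun k => stepi _ _ k) (fun k => stepd _ _ k).
have [t ht] := @nested_interval (fun k => (q k).2) (fun k => 2 ^- k) h0
  (fun k => stepi _ _ k) (fun k => stepd _ _ k).
exists s, t; split.
- by have := hs 0%N; rewrite /= add0r expr0 invr1.
- by have := ht 0%N; rewrite /= add0r expr0 invr1.
- by move=> k; exists (q k).1, (q k).2.
Qed.

Lemma exp_half_small (L r : R) : 0 < r -> exists k, L / 2 ^+ k < r.
Proof.
move=> r0; have [k hk] : exists k : nat, L / r < k%:R.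
  by exists (Num.bound `|L / r|);
    rewrite (le_lt_trans (ler_norm _))// archi_boundP.
exists k; rewrite ltr_pdivrMr ?exprn_gt0// mulrC -ltr_pdivrMr//.
by rewrite (lt_trans hk)// -natrX ltr_nat ltn_expl.
Qed.

(** The midpoint Riemann sum of F dz along the segment from [p] to [p + v], cut
    into [2 ^ n] pieces. It replaces the integral: splitting at the midpoint
    holds by definition, and the sum is exact for affine functions
    ([dsum_affine]), which is all that Goursat's argument asks for. *)
Fixpoint dsum n (F : C -> C) (p v : C) : C :=
  if n is n'.+1 then dsum n' F p (v / 2) + dsum n' F (p + v / 2) (v / 2)
  else F (p + v / 2) * v.

Lemma dsum_affine n a b p v :
  dsum n (fun z => a + b * z) p v = a * v + b * (p * v + v ^+ 2 / 2).
Proof. by elim: n p v => [|n IH] p v /=; rewrite ?IH; field. Qed.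

Lemma dsumB n F G p v :
  dsum n (fun z => F z - G z) p v = dsum n F p v - dsum n G p v.
Proof. by elim: n p v => [|n IH] p v /=; rewrite ?IH; ring. Qed.

Lemma dsumZ n F c p v : dsum n (fun z => c * F z) p v = c * dsum n F p v.
Proof. by elim: n p v => [|n IH] p v /=; rewrite ?IH; ring. Qed.

Lemma dsum_shift n F c p v : dsum n F (p + c) v = dsum n (fun z =>
  F (z + c)) p v.
Proof. by elim: n p v => [|n IH] p v /=; rewrite -?IH addrAC// addrAC. Qed.

Lemma cabs2 : cabs (2 : C) = 2.
Proof. exact: cabs_nat. Qed.

Lemma dsum_bound n F p v (K : R) :
  (forall x : R, 0 <= x <= 1 -> cabs (F (p + x%:C * v)) <= K) ->
  cabs (dsum n F p v) <= K * cabs v.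
Proof.
elim: n p v => [|n IH] p v H /=.
  rewrite cabsM ler_wpM2r ?cabs_ge0//.
  have -> : v / 2 = (2^-1 : R)%:C * v.
    by rewrite fmorphV rmorph_nat mulrC.
  by apply: H; lra.
rewrite (le_trans (cabsD _ _))//.
have -> : K * cabs v = K * cabs (v / 2) + K * cabs (v / 2).
  by rewrite cabsM cabsV cabs2; field.
have vE (y : R) : y%:C * (v / 2) = (y / 2)%:C * v :> C.
  by rewrite rmorphM fmorphV rmorph_nat; ring.
apply: lerD; apply: IH => x /andP[x0 x1].
  by rewrite vE; apply: H; lra.
have -> : p + v / 2 + x%:C * (v / 2) = p + ((1 + x) / 2)%:C * v :> C.
  by rewrite -vE rmorphD rmorph1; ring.
by apply: H; lra.
Qed.

(** The Riemann sum along the boundary of the parallelogram with corner [p] and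
    sides [v] and [w]. *)
Definition bsum n F p v w : C :=
  dsum n F p v + dsum n F (p + v) w - dsum n F (p + w) v - dsum n F p w.

(** The four inner segments are each run through in both directions. *)
Lemma bsumS n F p v w : bsum n.+1 F p v w =
  bsum n F p (v / 2) (w / 2) + bsum n F (p + v / 2) (v / 2) (w / 2) +
  bsum n F (p + w / 2) (v / 2) (w / 2) +
  bsum n F (p + v / 2 + w / 2) (v / 2) (w / 2).
Proof.
have E1 : p + v / 2 + v / 2 = p + v by field.
have E2 : p + w / 2 + w / 2 = p + w by field.
have E3 : p + w / 2 + v / 2 = p + v / 2 + w / 2 by ring.
have E4 : p + v / 2 + w / 2 + v / 2 = p + v + w / 2 by field.
have E5 : p + v / 2 + w / 2 + w / 2 = p + w + v / 2 by field.
rewrite /bsum /= E4 E5 E1 E2 E3; ring.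
Qed.

Lemma bsum_bound n F p v w (K : R) :
  (forall x y : R, 0 <= x <= 1 -> 0 <= y <= 1 ->
     cabs (F (p + x%:C * v + y%:C * w)) <= K) ->
  cabs (bsum n F p v w) <= 2 * K * (cabs v + cabs w).
Proof.
move=> H; have H0 x := H x 0; have H1 x := H x 1; have H2 := H 0;
  have H3 := H 1.
have -> : 2 * K * (cabs v + cabs w) = K * cabs v + K * cabs w + K * cabs v + K
  * cabs w.
  ring.
have i01 : (0 : R) <= (0 : R) <= (1 : R) by rewrite lexx ler01.
have i11 : (0 : R) <= (1 : R) <= (1 : R) by rewrite lexx ler01.
rewrite (le_trans (cabsD _ _))// cabsN lerD//; last first.
  apply: dsum_bound => x x01.
  by have := H2 x i01 x01; rewrite rmorph0 mul0r addr0.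
rewrite (le_trans (cabsD _ _))// cabsN lerD//; last first.
  apply: dsum_bound => x x01.
  by have := H1 x x01 i11; rewrite rmorph1 mul1r addrAC.
rewrite (le_trans (cabsD _ _))// lerD//.
  apply: dsum_bound => x x01.
  by have := H0 x x01 i01; rewrite rmorph0 mul0r addr0.
apply: dsum_bound => x x01.
by have := H3 x i11 x01; rewrite rmorph1 mul1r.
Qed.

(** If the boundary sums did not become small, bisection would lead to a point
    around which arbitrarily small parallelograms have boundary sums at least
    of the order of their area. But the affine part of [F] at that point
    contributes nothing to these sums, and the remainder is of smaller order. *)
Theorem goursat F p v w :
  (forall x y : R, 0 <= x <= 1 -> 0 <= y <= 1 ->
     derivable F (p + x%:C * v + y%:C * w : C) 1) ->
  forall e : R, 0 < e -> exists N, forall n, (N <= n)%N ->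
    cabs (bsum n F p v w) <= e.
Proof.
move=> dF e e0; apply: contrapT => nN.
pose co (s t : R) : C := p + s%:C * v + t%:C * w.
pose Bad k (s t : R) := forall N, exists2 n, (N <= n)%N &
  e / 4 ^+ k < cabs (bsum n F (co s t) (v / 2 ^+ k) (w / 2 ^+ k)).
have bad0 : Bad 0%N 0 0.
  move=> N; apply: contrapT => H; apply: nN; exists N => n Nn.
  rewrite leNgt; apply/negP => en; apply: H; exists n => //.
  by rewrite /co !rmorph0 !mul0r !addr0 !expr0 !divr1.
have badS k s t : Bad k s t -> exists b c : bool,
    Bad k.+1 (s + b%:R / 2 ^+ k.+1) (t + c%:R / 2 ^+ k.+1).
  move=> bad; apply: contrapT => H.
  have good b c : exists N, forall n, (N <= n)%N ->
     cabs (bsum n F (co (s + (b : bool)%:R / 2 ^+ k.+1)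
                     (t + (c : bool)%:R / 2 ^+ k.+1))
         (v / 2 ^+ k.+1) (w / 2 ^+ k.+1)) <= e / 4 ^+ k.+1.
    apply: contrapT => H'; apply: H; exists b, c => N.
    apply: contrapT => H; apply: H'; exists N => n Nn.
    by rewrite leNgt; apply/negP => en; apply: H; exists n.
  have [N1 H1] := good false false; have [N2 H2] := good false true.
  have [N3 H3] := good true false; have [N4 H4] := good true true.
  have [[//|n]] := bad (maxn (maxn N1 N2) (maxn N3 N4)).+1.
  rewrite ltnS !geq_max => /andP[/andP[n1 n2] /andP[n3 n4]].
  apply/negP; rewrite -leNgt bsumS.
  have half (u : C) : u / 2 ^+ k / 2 = u / 2 ^+ k.+1.
    by rewrite exprS; field; rewrite expf_neq0.
  have cob (b c : bool) : co (s + b%:R / 2 ^+ k.+1) (t + c%:R / 2 ^+ k.+1) =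
      co s t + b%:R * (v / 2 ^+ k.+1) + c%:R * (w / 2 ^+ k.+1).
    rewrite /co !rmorphD !rmorphM !fmorphV !rmorphXn !rmorph_nat; ring.
  have -> : e / 4 ^+ k = e / 4 ^+ k.+1 + e / 4 ^+ k.+1 + e / 4 ^+ k.+1
       + e / 4 ^+ k.+1 :> R.
    by rewrite exprS; field; rewrite expf_neq0.
  rewrite !half; move: (H1 n n1) (H2 n n2) (H3 n n3) (H4 n n4).
  rewrite !cob !mul0r !addr0 !mul1r => h1 h2 h3 h4.
  rewrite (le_trans (cabsD _ _))// lerD//.
  rewrite (le_trans (cabsD _ _))// lerD//.
  by rewrite (le_trans (cabsD _ _))// lerD.
have [s [t [s01 t01 H]]] := bisection bad0 badS.
set L := cabs v + cabs w; have L0 : 0 <= L by rewrite addr_ge0 ?cabs_ge0.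
(* Chosen so that the bound 2 eta L ^ 2 / 4 ^ k for the remainder at level k is
   below e / 4 ^ k. *)
pose eta := e / (2 * L ^+ 2 + 1).
have L1 : 0 < 2 * L ^+ 2 + 1 by rewrite ltr_wpDl// mulr_ge0// exprn_ge0.
have eta0 : 0 < eta by rewrite divr_gt0.
have [r r0 hr] := derivableCP (dF s t s01 t01) eta0.
have [k hk] := exp_half_small L r0.
have [s' [t' [/(_ 0%N)[n _] + /andP[s1 s2] /andP[t1 t2]]]] := H k.
have k0 : 0 < (2 : R) ^- k by rewrite invr_gt0 exprn_gt0.
have E4 : (4 : R) ^+ k = 2 ^+ k * 2 ^+ k.
  by rewrite -exprMn; congr (_ ^+ _); ring.
apply/negP; rewrite -leNgt.
set z0 := p + s%:C * v + t%:C * w; set d := 'D_1 F z0.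
have -> : bsum n F (co s' t') (v / 2 ^+ k) (w / 2 ^+ k) =
  bsum n (fun z => F z - (F z0 - d * z0 + d * z)) (co s' t')
    (v / 2 ^+ k) (w / 2 ^+ k).
  by rewrite /bsum !dsumB !dsum_affine; field; rewrite expf_neq0.
apply: (@le_trans _ _ (2 * (eta * (L / 2 ^+ k)) *
    (cabs (v / 2 ^+ k) + cabs (w / 2 ^+ k)))); last first.
  rewrite !cabsM !cabsV !cabsX cabs2 -mulrDl -/L.
  have -> : 2 * (eta * (L / 2 ^+ k)) * (L / 2 ^+ k) = eta * (2 * L ^+ 2) / 4
    ^+ k.
    by rewrite E4; field; rewrite expf_neq0.
  rewrite ler_pM2r ?invr_gt0 ?exprn_gt0//.
  by rewrite /eta mulrAC ler_pdivrMr// ler_pM2l// lerDl.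
apply: bsum_bound => x y /andP[x0 x1] /andP[y0 y1].
set z := co s' t' + _ + _.
have zE : z - z0 = (s' + x / 2 ^+ k - s)%:C * v + (t' + y / 2 ^+ k - t)%:C * w.
  rewrite /z /z0 /co !rmorphB !rmorphD !rmorphM !fmorphV !rmorphXn !rmorph_nat.
  ring.
have zs : cabs (z - z0) <= L / 2 ^+ k.
  rewrite zE (le_trans (cabsD _ _))// !cabsM !cabs_real /L mulrDl.
  have xk : x / 2 ^+ k <= 2 ^- k by rewrite ler_piMl// ltW.
  have yk : y / 2 ^+ k <= 2 ^- k by rewrite ler_piMl// ltW.
  have xk0 : 0 <= x / 2 ^+ k by rewrite mulr_ge0// ltW.
  have yk0 : 0 <= y / 2 ^+ k by rewrite mulr_ge0// ltW.
  by apply: lerD; rewrite mulrC ler_wpM2l ?cabs_ge0// ler_norml; lra.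
have -> : F z - (F z0 - d * z0 + d * z) = F z - F z0 - d * (z - z0) by ring.
rewrite (le_trans (hr z _))//; first exact: le_lt_trans zs hk.
by rewrite ler_pM2l.
Qed.

End Goursat.

(** * Cauchy's estimate *)

Section CircleMean.
Variable R : realType.
Local Notation C := (R[i]^o).

Lemma is_deriveRP (h : R -> R) (u d : R) : is_derive u 1 h d ->
  forall e : R, 0 < e -> exists2 r : R, 0 < r & forall z, `|z - u| < r ->
    `|h z - h u - d * (z - u)| <= e * `|z - u|.
Proof.
move=> [dh dE] e e0; have : (fun k : R =>
  k^-1 *: (h (k *: (1 : R) + u) - h u)) @ 0^' --> d.
  by rewrite -dE; exact: dh.
move=> /(cvgrPdist_lt _ d).1/(_ e e0);
  rewrite near_withinE => /nbhs_ballP[r /= r0 hr].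
exists r => // z zu; have [->|zu0] := eqVneq z u.
  by rewrite !subrr mulr0 subr0 normr0 mulr0.
have zu1 : z - u != 0 by rewrite subr_eq0.
have := hr (z - u); rewrite -ball_normE /= sub0r normrN => /(_ zu zu1) /ltW.
rewrite [_ *: (1 : R)]mulr1 subrK => le1.
have -> : h z - h u - d * (z - u) =
    - (d - (z - u)^-1 *: (h z - h u)) * (z - u).
  by rewrite /GRing.scale /=; field.
by rewrite normrM normrN ler_wpM2r.
Qed.

(** The complex exponential, which maps a rectangle of height 2 pi to a ring. *)
Definition cexp (z : C) : C :=
  (expR (complex.Re z))%:C * (cos (complex.Im z) +i* sin (complex.Im z)).

Lemma cexpD z w : cexp (z + w) = cexp z * cexp w.
Proof.
case: z w => [a b] [c d]; rewrite /cexp /= expRD cosD sinD.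
by apply/eqP; rewrite eq_complex /=; apply/andP; split; apply/eqP; ring.
Qed.

Lemma cexp0 : cexp 0 = 1.
Proof. by rewrite /cexp /= expR0 cos0 sin0 mul1r. Qed.

Lemma cabs_cexp z : cabs (cexp z) = expR (complex.Re z).
Proof.
rewrite cabsM cabs_real ger0_norm ?expR_ge0// /cabs normc_def /=.
by rewrite cos2Dsin2 sqrtr1 mulr1.
Qed.

Lemma cexp_neq0 z : cexp z != 0.
Proof. by rewrite -cabs_gt0 cabs_cexp expR_gt0. Qed.

Lemma cexp_is_derive0 : is_derive (0 : C) 1 cexp 1.
Proof.
apply/is_deriveCP => e e0; pose e' := Num.min e 1 / 9.
(* The error terms below add up to less than 9 e' |z|. *)
have m0 : 0 < Num.min e 1 by rewrite lt_min e0 ltr01.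
have [me m1] : Num.min e 1 <= e /\ Num.min e 1 <= 1 by rewrite !ge_min !lexx
  orbT.
have e'0 : 0 < e' by rewrite /e'; lra.
have [r1 r10 h1] := is_deriveRP (is_derive_expR (0 : R)) e'0.
have [r2 r20 h2] := is_deriveRP (is_derive_cos (0 : R)) e'0.
have [r3 r30 h3] := is_deriveRP (is_derive_sin (0 : R)) e'0.
exists (Num.min (Num.min r1 e') (Num.min r2 r3));
  first by rewrite !lt_min r10 e'0 r20.
move=> z; rewrite !subr0 !lt_min => /andP[/andP[z1 ze] /andP[z2 z3]].
have zr := cabs_Re z; have zi := cabs_Im z.
have {h1} := h1 (complex.Re z); have {h2} := h2 (complex.Im z).
have {h3} := h3 (complex.Im z).
rewrite !subr0 expR0 cos0 sin0 oppr0 !mul1r !mul0r !subr0 ?addr0.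
move=> /(_ (le_lt_trans zi z3)) h3 /(_ (le_lt_trans zi z2)) h2.
move=> /(_ (le_lt_trans zr z1)) h1.
rewrite cexp0 (le_trans (cabs_ReIm _))//.
case: z zr zi ze z1 z2 z3 h1 h2 h3 => s t; rewrite /cexp /=.
set n := cabs _; set E := expR s; set c := cos t; set q := sin t.
move=> zr zi ze _ _ _ h1 h2 h3.
rewrite !mul0r addr0 subr0 oppr0 addr0.
have -> : E * c - 1 - s = (E - 1 - s) + E * (c - 1) by ring.
have -> : E * q - t = (E - 1) * q + (q - t) by ring.
have n0 : 0 <= n := cabs_ge0 _.
have E1 : `|E - 1| <= 2 * e'.
  have -> : E - 1 = (E - 1 - s) + s by ring.
  rewrite (le_trans (ler_normD _ _))//.
  rewrite (le_trans (lerD h1 (lexx _)))//.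
  have : `|s| <= e' by lra.
  by rewrite /e' => ?; nra.
have E2 : `|E| <= 2.
  have -> : E = (E - 1) + 1 by ring.
  by rewrite (le_trans (ler_normD _ _))// normr1; move: E1; rewrite /e'; lra.
have q2 : `|q| <= 2 * n.
  have -> : q = (q - t) + t by ring.
  rewrite (le_trans (ler_normD _ _))// (le_trans (lerD h3 zi))//.
  by rewrite /e'; nra.
have le_en : 9 * (e' * n) <= e * n.
  by rewrite mulrA ler_wpM2r// /e'; lra.
have a1 : `|E * (c - 1)| <= 2 * (e' * n).
  rewrite normrM ler_pM// (le_trans h2)// ler_wpM2l// ltW//.
have a2 : `|(E - 1) * q| <= 4 * (e' * n).
  have -> : 4 * (e' * n) = (2 * e') * (2 * n) by ring.
  by rewrite normrM ler_pM.
have a3 : e' * `|s| <= e' * n by rewrite ler_wpM2l// ltW.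
have a4 : e' * `|t| <= e' * n by rewrite ler_wpM2l// ltW.
have a5 : 0 <= e' * n by rewrite mulr_ge0// ltW.
have := ler_normD (E - 1 - s) (E * (c - 1)).
have := ler_normD ((E - 1) * q) (q - t).
lra.
Qed.

Lemma cexp_is_derive (z : C) : is_derive z 1 cexp (cexp z).
Proof.
have d0 := derB (der_id z) (der_cst z z); rewrite subr0 in d0.
have z0 : is_derive (z - z) 1 cexp 1 by rewrite subrr; exact: cexp_is_derive0.
have := derM (der_cst (cexp z) z) (der_comp d0 z0).
rewrite mulr0 addr0 !mulr1; congr is_derive.
by apply/funext => w; rewrite -cexpD addrC subrK.
Qed.

Lemma cexpDpi z : cexp (z + 0 +i* pi) = - cexp z.
Proof.
rewrite cexpD {2}/cexp /= expR0 mul1r cospi sinpi.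
by rewrite -[RHS]mulrN1; congr (_ * _); apply/eqP;
  rewrite eq_complex /= oppr0 !eqxx.
Qed.

Definition ipi : C := 0 +i* pi.

Lemma cabs_ipi : cabs ipi = pi.
Proof.
by rewrite /cabs normc_def /= expr0n add0r sqrtr_sqr ger0_norm// pi_ge0.
Qed.

Lemma ipi_neq0 : ipi != 0.
Proof. by rewrite -cabs_gt0 cabs_ipi pi_gt0. Qed.

Lemma two_ipi_neq0 : 2 * ipi != 0.
Proof. by rewrite mulf_neq0 ?ipi_neq0// pnatr_eq0. Qed.

Lemma cexpD2pi z : cexp (z + 2 * ipi) = cexp z.
Proof.
have -> : z + 2 * ipi = z + ipi + ipi by ring.
by rewrite !cexpDpi opprK.
Qed.

(** The mean over the circle of radius [r]: a Riemann sum of k(z) dz / (2 pi i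
    z), taken in the coordinate log z. *)
Definition cmean n (k : C -> C) (r : R) : C :=
  dsum n (fun z => k (cexp z)) (ln r)%:C (2 * ipi) / (2 * ipi).

Lemma cmeanB n k l r :
  cmean n (fun z => k z - l z) r = cmean n k r - cmean n l r.
Proof. by rewrite /cmean dsumB mulrBl. Qed.

Lemma cmean_cst n (c : C) r : cmean n (fun=> c) r = c.
Proof.
rewrite /cmean; have -> : (fun z : C => c) = (fun z => c + 0 * z).
  by apply/funext => z; rewrite mul0r addr0.
by rewrite dsum_affine mul0r addr0 mulfK// two_ipi_neq0.
Qed.

Lemma cabs_circle (r t : R) : 0 < r ->
  cabs (cexp ((ln r)%:C + t%:C * (2 * ipi))) = r.
Proof.
move=> r0; rewrite cabs_cexp.
have -> : complex.Re ((ln r)%:C + t%:C * (2 * ipi)) = ln r.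
  rewrite /ipi /=; ring.
by rewrite lnK.
Qed.

Lemma cmean_bound n k (r K : R) : 0 < r ->
  (forall z, cabs z = r -> cabs (k z) <= K) -> cabs (cmean n k r) <= K.
Proof.
move=> r0 H; rewrite cabsM cabsV ler_pdivrMr ?cabs_gt0 ?two_ipi_neq0//.
by apply: dsum_bound => x _; apply: H; exact: cabs_circle.
Qed.

(** The function is odd, so the two half circles, which [n.+1] separates,
    cancel. *)
Lemma cmean_inv n (c : C) r : cmean n.+1 (fun z => c / z) r = 0.
Proof.
rewrite /cmean /=; have -> : 2 * ipi / 2 = ipi by field.
rewrite dsum_shift.
have -> : (fun z : C => c / cexp (z + ipi)) = (fun z => (-1) * (c / cexp z)).
  by apply/funext => z; rewrite cexpDpi; field; rewrite ?oppr_eq0 cexp_neq0.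
by rewrite !dsumZ mulN1r subrr mul0r.
Qed.

(** [goursat] on the rectangle over [ln r, ln rho] of height 2 pi, whose two
    horizontal sides cancel by periodicity of the exponential. *)
Lemma cmean_indep (k : C -> C) (r rho : R) : 0 < r -> r < rho ->
  (forall z : C, 0 < cabs z <= rho -> derivable k z 1) ->
  forall e, 0 < e -> exists N, forall n, (N <= n)%N ->
    cabs (cmean n k rho - cmean n k r) <= e.
Proof.
move=> r0 rrho dk e e0.
have rho0 : 0 < rho by exact: lt_trans rrho.
pose F z := k (cexp z).
have lnr : ln r < ln rho by rewrite ltr_ln.
pose v : C := (ln rho - ln r)%:C.
have nw0 : 0 < cabs (2 * ipi) by rewrite cabs_gt0 two_ipi_neq0.
have [N HN] : exists N, forall n, (N <= n)%N ->
    cabs (bsum n F (ln r)%:C v (2 * ipi)) <= e * cabs (2 * ipi).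
  apply: goursat; last by rewrite mulr_gt0.
  move=> x y /andP[x0 x1] _.
  apply: der_derivable; apply: (der_comp (cexp_is_derive _)); apply: der_derive.
  apply: dk; rewrite cabs_cexp expR_gt0 /= -[leRHS]lnK//.
  rewrite ler_expR.
  rewrite [leLHS](_ : _ = ln r + x * (ln rho - ln r)); first by nra.
  rewrite /v /ipi /=; ring.
exists N => n Nn; rewrite /cmean -mulrBl cabsM cabsV ler_pdivrMr//.
apply: le_trans (HN n Nn).
rewrite /bsum [dsum n F (_ + 2 * ipi) _]dsum_shift.
have -> : (fun z => F (z + 2 * ipi)) = F.
  by apply/funext => z; rewrite /F cexpD2pi.
have -> : (ln r)%:C + v = (ln rho)%:C :> C by rewrite /v rmorphB; ring.
by rewrite [X in _ <= cabs (X - _)]addrAC subrr add0r.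
Qed.

(** Pass to a small radius: there c / z has mean 0 and what remains of k is
    close to l. *)
Lemma cmean_lim (k : C -> C) (c l : C) (rho : R) : 0 < rho ->
  (forall z : C, 0 < cabs z <= rho -> derivable k z 1) ->
  k z - c / z @[z --> 0^'] --> l ->
  forall e, 0 < e -> exists N, forall n, (N <= n)%N ->
    cabs (cmean n k rho - l) <= e.
Proof.
move=> rho0 dk /cvgCP kl e e0; have e20 : 0 < e / 2 by lra.
have /dnbhsCP[r r0 hr] := kl _ e20.
pose r' := Num.min r rho / 2.
have m0 : 0 < Num.min r rho by rewrite lt_min r0.
have [mr mrho] : Num.min r rho <= r /\ Num.min r rho <= rho.
  by rewrite !ge_min !lexx orbT.
have r'0 : 0 < r' by rewrite /r'; lra.
have r'rho : r' < rho by rewrite /r'; lra.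
have [N HN] := cmean_indep r'0 r'rho dk e20.
exists N.+1 => -[//|n] Nn.
have -> : cmean n.+1 k rho - l = (cmean n.+1 k rho - cmean n.+1 k r') +
    cmean n.+1 (fun z => k z - c / z - l) r'.
  by rewrite !cmeanB cmean_inv cmean_cst; ring.
rewrite (le_trans (cabsD _ _))// [leRHS]splitr lerD//; first by apply: HN;
  exact: ltnW.
apply: cmean_bound => // z zr'; apply/ltW/hr; first by rewrite -cabs_gt0 zr'.
by rewrite subr0 zr' /r'; lra.
Qed.

(** The means of h(a + z) / z tend to h'(a), by [cmean_lim], and none exceeds K
    / rho. *)
Theorem cauchy_estimate (h : C -> C) (a : C) (rho K : R) : 0 < rho ->
  (forall z, cabs (z - a) <= rho -> derivable h z 1) ->
  (forall z, cabs (z - a) = rho -> cabs (h z) <= K) ->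
  cabs ('D_1 h a) <= K / rho.
Proof.
move=> rho0 dh hK; apply/ler_addgt0Pr => e e0.
have sh (z : C) : is_derive z 1 (fun z : C => a + z) 1.
  by have := derD (der_cst a z) (der_id z); rewrite add0r.
have aK (z : C) : a + z - a = z by ring.
have dk (z : C) : 0 < cabs z <= rho ->
  derivable (fun z : C => h (a + z) / z : C) z 1.
  move=> /andP[z0 z1]; rewrite cabs_gt0 in z0.
  apply: der_derivable; apply: derM; last exact: derV (der_id z).
  apply: (der_comp (sh z)); apply: der_derive; apply: dh.
  by rewrite /= aK.
have lk : (fun z => h (a + z) / z - h a / z) @ (0 : C)^' --> 'D_1 h a.
  have /der_quot/cvgCP H : is_derive a 1 h ('D_1 h a).
    by apply/der_derive/dh; rewrite subrr cabs0 ltW.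
  apply/cvgCP => d d0; have /dnbhsCP[r r0 hr] := H d d0.
  apply/dnbhsCP; exists r => // z z0; rewrite subr0 => zr.
  have := hr (a + z); rewrite aK -mulrBl; apply => //.
  by rewrite -subr_eq0 aK.
have [N /(_ N (leqnn _)) HN] := cmean_lim rho0 dk lk e0.
rewrite (le_trans (cabs_le_sub _ (cmean N (fun z => h (a + z) / z) rho)))//.
rewrite addrC lerD//; last by rewrite cabsB.
apply: cmean_bound => // z zr; rewrite cabsM cabsV zr ler_pM2r ?invr_gt0//.
by apply: hK; rewrite aK.
Qed.

(** This is [cauchy_estimate] for (z - a) h(z), whose derivative at a is h(a).
 *)
Theorem mean_estimate (h : C -> C) (a : C) (rho K : R) : 0 < rho ->
  (forall z, cabs (z - a) <= rho -> derivable h z 1) ->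
  (forall z, cabs (z - a) = rho -> cabs (h z) <= K) ->
  cabs (h a) <= K.
Proof.
move=> rho0 dh hK.
have dk z : cabs (z - a) <= rho ->
  is_derive z 1 (fun z : C => (z - a) * h z : C)
    ((z - a) * 'D_1 h z + h z).
  move=> za; have := derM (derB (der_id z) (der_cst a z)) (der_derive (dh z
    za)).
  by rewrite subr0 mulr1.
have dka : 'D_1 (fun z : C => (z - a) * h z : C) a = h a.
  rewrite (der_val (dk a _)); last by rewrite subrr cabs0 ltW.
  by rewrite subrr mul0r add0r.
have dd z : cabs (z - a) <= rho ->
  derivable (fun z : C => (z - a) * h z : C) z 1.
  by move=> za; exact: der_derivable (dk z za).
have bd z : cabs (z - a) = rho -> cabs ((z - a) * h z) <= rho * K.
  by move=> za; rewrite cabsM za ler_pM2l// hK.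
rewrite -dka -[leRHS](mulKf (lt0r_neq0 rho0)) [leRHS]mulrC.
exact: cauchy_estimate rho0 dd bd.
Qed.

End CircleMean.

(** * Derivatives of holomorphic functions *)

Section LocalTheory.
Variable R : realType.
Local Notation C := (R[i]^o).
Implicit Types (h : C -> C) (a z : C).

(** If the increment exceeded L |v|, bisection of the segment would lead to a
    point near which difference quotients stay above L. *)
Lemma mean_value_ineq h (p v : C) (L : R) :
  (forall x : R, 0 <= x <= 1 -> derivable h (p + x%:C * v : C) 1) ->
  (forall x : R, 0 <= x <= 1 -> cabs ('D_1 h (p + x%:C * v : C)) <= L) ->
  cabs (h (p + v) - h p) <= L * cabs v.
Proof.
move=> dh hL; rewrite leNgt; apply/negP => lt1.
have v0 : 0 < cabs v.
  rewrite cabs_gt0; apply/negP => /eqP v0; move: lt1.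
  by rewrite v0 addr0 subrr cabs0 mulr0 ltxx.
(* A third of the excess of the slope over L: the remainder of h at the limit
   point costs 2 e, which leaves a contradiction. *)
pose e := (cabs (h (p + v) - h p) - L * cabs v) / (3 * cabs v).
have e0 : 0 < e by rewrite divr_gt0 ?mulr_gt0 ?subr_gt0.
have eE : 3 * (e * cabs v) = cabs (h (p + v) - h p) - L * cabs v.
  by rewrite /e; field; rewrite gt_eqF.
have ev0 : 0 < e * cabs v by rewrite mulr_gt0.
pose co (s : R) : C := p + s%:C * v.
pose Bad k (s t : R) :=
  (L + 2 * e) * cabs v / 2 ^+ k < cabs (h (co (s + 2 ^- k)) - h (co s)).
have bad0 : Bad 0%N 0 0.
  rewrite /Bad /co expr0 invr1 add0r rmorph0 rmorph1 mul0r mul1r addr0 mulr1.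
  by rewrite mulrDl -mulrA; lra.
have badS k s t : Bad k s t -> exists b c : bool,
    Bad k.+1 (s + b%:R / 2 ^+ k.+1) (t + c%:R / 2 ^+ k.+1).
  move=> bad; apply: contrapT => H.
  have good (b : bool) : cabs (h (co (s + b%:R / 2 ^+ k.+1 + 2 ^- k.+1)) -
      h (co (s + b%:R / 2 ^+ k.+1))) <= (L + 2 * e) * cabs v / 2 ^+ k.+1.
    by rewrite leNgt; apply/negP => bd; apply: H; exists b, b.
  move: bad; apply/negP; rewrite -leNgt.
  have := good true; have := good false; rewrite mul0r addr0 mul1r => g0 g1.
  have -> : h (co (s + 2 ^- k)) - h (co s) =
    (h (co (s + 2 ^- k.+1 + 2 ^- k.+1)) - h (co (s + 2 ^- k.+1))) +
    (h (co (s + 2 ^- k.+1)) - h (co s)).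
    have -> : s + 2 ^- k.+1 + 2 ^- k.+1 = s + 2 ^- k.
      by rewrite exprS; field; rewrite expf_neq0.
    ring.
  have -> : (L + 2 * e) * cabs v / 2 ^+ k = (L + 2 * e) * cabs v / 2 ^+ k.+1
     + (L + 2 * e) * cabs v / 2 ^+ k.+1.
    by rewrite exprS; field; rewrite expf_neq0.
  by rewrite (le_trans (cabsD _ _))// lerD.
have [s [t [s01 _ H]]] := bisection bad0 badS.
have [r r0 hr] := derivableCP (dh s s01) e0.
have [k hk] := exp_half_small (cabs v) r0.
have [s' [t' [bad /andP[s1 s2] _]]] := H k; move: bad.
apply/negP; rewrite -leNgt.
have k0 : 0 < (2 : R) ^- k by rewrite invr_gt0 exprn_gt0.
set z0 := p + s%:C * v; set d := 'D_1 h z0.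
have key (x : R) : 0 <= x <= (1 : R) ->
    cabs (h (co (s' + x / 2 ^+ k)) - h z0 - d * (co (s' + x / 2 ^+ k) - z0)) <=
    e * (cabs v / 2 ^+ k).
  move=> /andP[x0 x1]; set z := co _.
  have zE : z - z0 = (s' + x / 2 ^+ k - s)%:C * v.
    by rewrite /z /z0 /co rmorphB; ring.
  have zs : cabs (z - z0) <= cabs v / 2 ^+ k.
    rewrite zE cabsM cabs_real mulrC ler_wpM2l ?cabs_ge0// ler_norml.
    have xk : x / 2 ^+ k <= 2 ^- k by rewrite ler_piMl// ltW.
    have xk0 : 0 <= x / 2 ^+ k by rewrite mulr_ge0// ltW.
    by lra.
  rewrite (le_trans (hr z _))//; first exact: le_lt_trans zs hk.
  by rewrite ler_pM2l.
have i01 : (0 : R) <= (0 : R) <= (1 : R) by rewrite lexx ler01.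
have i11 : (0 : R) <= (1 : R) <= (1 : R) by rewrite lexx ler01.
have /= := key 0 i01; have /= := key 1 i11; rewrite mul1r mul0r addr0.
set z2 := co (s' + _); set z1 := co s' => k2 k1.
have -> : h z2 - h z1 = (h z2 - h z0 - d * (z2 - z0)) -
   (h z1 - h z0 - d * (z1 - z0)) + d * (z2 - z1) by ring.
have zz : cabs (z2 - z1) = cabs v / 2 ^+ k.
  have -> : z2 - z1 = (2 ^- k : R)%:C * v by rewrite /z1 /z2 /co rmorphD; ring.
  by rewrite cabsM cabs_real ger0_norm ?ltW// mulrC.
rewrite (le_trans (cabsD _ _))//.
have -> : (L + 2 * e) * cabs v / 2 ^+ k = (e * (cabs v / 2 ^+ k) +
   e * (cabs v / 2 ^+ k)) + L * (cabs v / 2 ^+ k) by ring.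
apply: lerD; first by rewrite (le_trans (cabsD _ _))// cabsN lerD.
by rewrite cabsM zz ler_wpM2r ?hL// divr_ge0 ?exprn_ge0// ltW.
Qed.

Lemma mean_value_disc h a (r L : R) :
  (forall z, cabs (z - a) <= r -> derivable h z 1) ->
  (forall z, cabs (z - a) <= r -> cabs ('D_1 h z) <= L) ->
  forall x y : C, cabs (x - a) <= r -> cabs (y - a) <= r ->
  cabs (h x - h y) <= L * cabs (x - y).
Proof.
move=> dh hL x y xr yr.
have seg (t : R) : 0 <= t <= 1 -> cabs (y + t%:C * (x - y) - a) <= r.
  move=> /andP[t0 t1].
  have -> : y + t%:C * (x - y) - a = t%:C * (x - a) + (1 - t)%:C * (y - a).
    by rewrite rmorphB rmorph1; ring.
  have t1' : 0 <= 1 - t by rewrite subr_ge0.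
  rewrite (le_trans (cabsD _ _))// !cabsM !cabs_real !ger0_norm//.
  by rewrite (le_trans (lerD (ler_wpM2l t0 xr) (ler_wpM2l t1' yr)))//; lra.
have dh' t : 0 <= t <= 1 -> derivable h (y + t%:C * (x - y) : C) 1.
  by move=> t01; exact: dh (seg t t01).
have hL' t : 0 <= t <= 1 -> cabs ('D_1 h (y + t%:C * (x - y) : C)) <= L.
  by move=> t01; exact: hL (seg t t01).
by have := mean_value_ineq dh' hL'; rewrite [y + _]addrC subrK.
Qed.

Lemma cauchy_dnbhs (f : C -> C) a :
  (forall e : R, 0 < e -> exists2 r : R, 0 < r & forall x y : C,
    x != a -> y != a -> cabs (x - a) < r -> cabs (y - a) < r ->
      cabs (f x - f y) < e) ->
  exists l : C, f x @[x --> a^'] --> l.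
Proof.
move=> H.
have part (p : C -> R) : (forall z, `|p z| <= cabs z) ->
    (forall x y, p (x - y) = p x - p y) ->
      exists l : R, p (f x) @[x --> a^'] --> l.
  move=> pn pB; have cv : cvg ((fun x => p (f x)) @ a^'); last first.
    by exists (lim ((fun x => p (f x)) @ a^')); exact: cv.
  apply: cauchy_cvg; apply: cauchy_exP => e e0.
  have [r r0 hr] := H e e0.
  have x0r : cabs ((r / 2)%:C : C) < r by rewrite cabs_real ger0_norm; lra.
  have x00 : a + (r / 2)%:C != a.
    by rewrite -subr_eq0 [a + _]addrC addrK -cabs_gt0 cabs_real normr_gt0; lra.
  exists (p (f (a + (r / 2)%:C))); apply/dnbhsCP; exists r => // x xa xr.
  rewrite -ball_normE /= -pB (le_lt_trans (pn _))// hr//.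
  by rewrite [a + _]addrC addrK.
have [l1 h1] := part (@complex.Re R) (@cabs_Re R) (fun x y => raddfB _ _ _).
have [l2 h2] := part (@complex.Im R) (@cabs_Im R) (fun x y => raddfB _ _ _).
exists (l1 +i* l2); apply/cvgCP => e e0.
have e20 : 0 < e / 2 by lra.
move/(cvgrPdist_lt _ l1).1/(_ _ e20) : h1 => h1.
move/(cvgrPdist_lt _ l2).1/(_ _ e20) : h2 => h2.
near=> x; rewrite (le_lt_trans (cabs_ReIm _))// [ltRHS]splitr.
by rewrite !raddfB /= ltrD// distrC; near: x.
Unshelve. all: by end_near. Qed.

End LocalTheory.

Section Holomorphic.
Variable R : realType.
Local Notation C := (R[i]^o).
Implicit Types (h : C -> C) (a z : C).

Lemma holP h a : holomorphic_near h a <->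
  exists2 r : R, 0 < r & forall z, cabs (z - a) < r -> derivable h z 1.
Proof. exact: nbhsCP. Qed.

Lemma hol_der h a : holomorphic_near h a -> derivable h a 1.
Proof. exact: nbhs_singleton. Qed.

Lemma hol_near h a : holomorphic_near h a ->
  \forall z \near a, holomorphic_near h z.
Proof.
move=> /holP[r r0 hr]; apply/nbhsCP; exists r => // z zr.
apply/holP; exists (r - cabs (z - a)); first by rewrite subr_gt0.
move=> y yz; apply: hr.
have -> : y - a = (y - z) + (z - a) by ring.
by rewrite (le_lt_trans (cabsD _ _))//; lra.
Qed.

Lemma hol_near_eq h g a : (\forall z \near a, h z = g z) ->
  holomorphic_near h a -> holomorphic_near g a.
Proof.
move=> /nbhsCP[r r0 hr] /holP[s s0 hs]; apply/holP.
exists (Num.min r s); first by rewrite lt_min r0.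
move=> z; rewrite lt_min => /andP[zr zs].
apply: der_derivable; apply: (der_near_eq _ (der_derive (hs z zs))).
apply/nbhsCP; exists (r - cabs (z - a)); first by rewrite subr_gt0.
move=> y yz; apply: hr.
have -> : y - a = (y - z) + (z - a) by ring.
by rewrite (le_lt_trans (cabsD _ _))//; lra.
Qed.

Lemma cvg_bounded h a : h z @[z --> a] --> h a -> exists2 r : R, 0 < r &
  forall z, cabs (z - a) < r -> cabs (h z) <= cabs (h a) + 1.
Proof.
move=> /cvgCP/(_ 1 ltr01)/nbhsCP[r r0 hr]; exists r => // z /hr hz.
by rewrite (le_trans (cabs_le_sub _ (h a)))// addrC lerD2l ltW.
Qed.

(** Bounds pass from a function to its derivative by [cauchy_estimate]. For h
    itself this makes h Lipschitz; for z -> h(z + eta) - h(z) it makes h'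
    Lipschitz, so that the difference quotients of h converge uniformly; for
    the differences of two such quotients it makes the difference quotients of
    h' at a a Cauchy family. *)
Lemma hol_derive_derivable h a : holomorphic_near h a ->
  derivable (fun z => 'D_1 h z : C) a 1.
Proof.
move=> hh; have [r1 r10 dh] := (holP h a).1 hh.
have [r2 r20 hK] := cvg_bounded (derivable_cvg (hol_der hh)).
set K := cabs (h a) + 1 in hK.
(* Circles of radius r around points within 3 r of a remain where h is
   differentiable and bounded by K. *)
pose r := Num.min r1 r2 / 5.
have m0 : 0 < Num.min r1 r2 by rewrite lt_min r10.
have [m1 m2] : Num.min r1 r2 <= r1 /\ Num.min r1 r2 <= r2.
  by rewrite !ge_min !lexx orbT.
have r0 : 0 < r by rewrite /r; lra.
have {}dh z : cabs (z - a) <= 4 * r -> derivable h z 1.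
  by move=> za; apply: dh; move: za; rewrite /r; lra.
have {}hK z : cabs (z - a) <= 4 * r -> cabs (h z) <= K.
  by move=> za; apply: hK; move: za; rewrite /r; lra.
clearbody r => {m1 m2 m0 r10 r20 r1 r2}.
have tri (x y z : C) (s t : R) : cabs (x - y) <= s -> cabs (y - z) <= t ->
    cabs (x - z) <= s + t.
  move=> xy yz; have -> : x - z = (x - y) + (y - z) by ring.
  by rewrite (le_trans (cabsD _ _))// lerD.
set L1 := K / r.
have dK z : cabs (z - a) <= 3 * r -> cabs ('D_1 h z) <= L1.
  move=> za; have e : r + 3 * r = 4 * r by ring.
  have d1 y : cabs (y - z) <= r -> derivable h y 1.
    by move=> yz; apply: dh; rewrite -e; exact: tri za.
  have d2 y : cabs (y - z) = r -> cabs (h y) <= K.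
    by move=> yz; apply: hK; rewrite -e; apply: tri za; rewrite yz.
  exact: cauchy_estimate r0 d1 d2.
have d3 z : cabs (z - a) <= 3 * r -> derivable h z 1.
  by move=> za; apply: dh; lra.
have lip := mean_value_disc d3 dK.
set L2 := L1 / r.
have sh (eta z : C) : is_derive z 1 (fun z : C => z + eta) 1.
  by have := derD (der_id z) (der_cst eta z); rewrite addr0.
have lip' (z eta : C) : cabs (z - a) <= r -> cabs eta <= r ->
    cabs ('D_1 h (z + eta) - 'D_1 h z) <= L2 * cabs eta.
  move=> za er.
  have E (y : C) : cabs (y - z) <= r -> cabs (y + eta - a) <= 3 * r.
    move=> yz; have -> : y + eta - a = (y - z) + ((z - a) + eta) by ring.
    rewrite (le_trans (cabsD _ _))//.
    have := cabsD (z - a) eta; lra.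
  have E' (y : C) : cabs (y - z) <= r -> cabs (y - a) <= 3 * r.
    by move=> yz; have := tri _ _ _ _ _ yz za; lra.
  have dd (y : C) : cabs (y - z) <= r ->
      is_derive y 1 (fun y : C =>
        h (y + eta) - h y : C) ('D_1 h (y + eta) - 'D_1 h y).
    move=> yz; apply: derB; last exact: der_derive (d3 _ (E' _ yz)).
    by have := der_comp (sh eta y) (der_derive (d3 _ (E _ yz))); rewrite mulr1.
  have dd1 (y : C) : cabs (y - z) <= r ->
      derivable (fun y : C => h (y + eta) - h y : C) y 1.
    by move=> yz; exact: der_derivable (dd y yz).
  have bb y : cabs (y - z) = r -> cabs (h (y + eta) - h y) <= L1 * cabs eta.
    move=> yz; have yz' : cabs (y - z) <= r by rewrite yz.
    by have := lip _ _ (E _ yz') (E' _ yz'); rewrite [y + eta]addrC addrK.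
  have := cauchy_estimate r0 dd1 bb; rewrite (der_val (dd z _)); last first.
    by rewrite subrr cabs0 ltW.
  by rewrite /L2 mulrAC.
have second (z eta : C) : cabs (z - a) <= r -> cabs eta <= r ->
    cabs (h (z + eta) - h z - 'D_1 h z * eta) <= L2 * cabs eta * cabs eta.
  move=> za er.
  have E (x : R) : 0 <= x <= 1 -> cabs (z + x%:C * eta - a) <= 3 * r.
    move=> /andP[x0 x1]; have ->
      : z + x%:C * eta - a = (z - a) + x%:C * eta by ring.
    rewrite (le_trans (cabsD _ _))// cabsM cabs_real ger0_norm//.
    have := ler_pM x0 (cabs_ge0 eta) x1 er; lra.
  have dd (x : R) : 0 <= x <= 1 ->
      is_derive (z + x%:C * eta : C) 1 (fun y : C => h y - 'D_1 h z * y : C)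
        ('D_1 h (z + x%:C * eta : C) - 'D_1 h z).
    move=> x01; apply: derB; first exact: der_derive (d3 _ (E _ x01)).
    by have := derM (der_cst ('D_1 h z) (z + x%:C * eta : C)) (der_id _);
      rewrite mulr1 mulr0 addr0.
  have dd1 (x : R) : 0 <= x <= 1 ->
    derivable (fun y : C => h y - 'D_1 h z * y : C)
      (z + x%:C * eta : C) 1.
    by move=> x01; exact: der_derivable (dd x x01).
  have bb (x : R) : 0 <= x <= 1 ->
    cabs ('D_1 (fun y : C => h y - 'D_1 h z * y : C)
      (z + x%:C * eta : C)) <= L2 * cabs eta.
    move=> x01; rewrite (der_val (dd x x01)).
    have /andP[x0 x1] := x01.
    have xe : cabs (x%:C * eta) <= cabs eta.
      by rewrite cabsM cabs_real ger0_norm// ler_piMl// cabs_ge0.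
    rewrite (le_trans (lip' _ _ za (le_trans xe er)))// ler_wpM2l//.
    have K0 : 0 <= K by rewrite addr_ge0 ?cabs_ge0.
    by rewrite !divr_ge0// ltW.
  have := mean_value_ineq dd1 bb.
  have -> // : h (z + eta) - 'D_1 h z * (z + eta) - (h z - 'D_1 h z * z) =
    h (z + eta) - h z - 'D_1 h z * eta by ring.
have K0 : 0 <= K by rewrite addr_ge0 ?cabs_ge0.
have L20 : 0 <= L2 by rewrite !divr_ge0// ltW.
have [l hl] : exists l : C,
  (('D_1 h z : C) - 'D_1 h a) / (z - a) @[z --> a^'] --> l.
  apply: cauchy_dnbhs => e e0.
  pose d := Num.min r (e * r / (2 * (L2 + 1))).
  have d0 : 0 < d.
    by rewrite lt_min r0 divr_gt0// mulr_gt0//; lra.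
  have dr : d <= r by rewrite ge_min lexx.
  have de : L2 * (d + d) / r < e.
    have : d <= e * r / (2 * (L2 + 1)) by rewrite ge_min lexx orbT.
    rewrite ler_pdivlMr; last by lra.
    rewrite ltr_pdivrMr// => H; nra.
  exists d => // x y xa ya xd yd.
  have [x0 y0] : x - a != 0 /\ y - a != 0 by rewrite !subr_eq0.
  have dd (z : C) : cabs (z - a) <= r -> is_derive z 1
    (fun z : C => (h (z + (x - a)) - h z) / (x - a) -
                  (h (z + (y - a)) - h z) / (y - a) : C)
    (('D_1 h (z + (x - a)) - 'D_1 h z) / (x - a) -
     ('D_1 h (z + (y - a)) - 'D_1 h z) / (y - a)).
    move=> za; have part (u : C) : cabs (u - a) < d -> is_derive z 1
      (fun z : C => (h (z + (u - a)) - h z) / (u - a) : C)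
      (('D_1 h (z + (u - a)) - 'D_1 h z) / (u - a)).
      move=> ud; have := derM (derB
        (der_comp (sh (u - a) z) (der_derive (d3 _ _))) (der_derive (d3 _ _)))
        (der_cst (u - a)^-1 z).
      rewrite mulr0 add0r mulr1 [X in is_derive _ _ _ X]mulrC; apply;
        last by lra.
      have -> : z + (u - a) - a = (z - a) + (u - a) by ring.
      by rewrite (le_trans (cabsD _ _))//; lra.
    by apply: derB; exact: part.
  pose G := (fun z : C => (h (z + (x - a)) - h z) / (x - a) -
                  (h (z + (y - a)) - h z) / (y - a) : C).
  have dd1 (z : C) : cabs (z - a) <= r -> derivable G z 1.
    by move=> za; exact: der_derivable (dd z za).
  have bb (z : C) : cabs (z - a) = r -> cabs (G z) <= L2 * (d + d).
    move=> za.
    have -> : G z = (h (z + (x - a)) - h z - 'D_1 h z * (x - a)) / (x - a) -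
                (h (z + (y - a)) - h z - 'D_1 h z * (y - a)) / (y - a).
      by rewrite /G; field; rewrite x0 y0.
    have part (u : C) : u - a != 0 -> cabs (u - a) < d ->
        cabs ((h (z + (u - a)) - h z - 'D_1 h z * (u - a)) / (u - a)) <= L2 * d.
      move=> u0 ud; rewrite cabsM cabsV ler_pdivrMr ?cabs_gt0//.
      rewrite (le_trans (second _ _ _ _))//; first by rewrite za.
        by rewrite (le_trans (ltW ud)).
      by rewrite ler_wpM2r ?cabs_ge0// ler_wpM2l// ltW.
    by rewrite [leRHS]mulrDr (le_trans (cabsD _ _))// cabsN lerD// part.
  have := cauchy_estimate r0 dd1 bb; rewrite (der_val (dd a _)); last first.
    by rewrite subrr cabs0 ltW.
  have ax (u : C) : a + (u - a) = u by ring.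
  by rewrite !ax => /le_lt_trans; exact.
by apply: (@der_derivable _ _ _ l); apply/der_quot.
Qed.

End Holomorphic.

(** * Zeros, removable singularities and local inverses *)

(* Unification would otherwise unfold this to a statement about filters. *)
Local Opaque derivable.

Section Zeros.
Variable R : realType.
Local Notation C := (R[i]^o).
Implicit Types (h : C -> C) (a z : C).

Lemma near_all a (P : C -> Prop) : (forall z, P z) -> \forall z \near a, P z.
Proof. by move=> H; apply/nbhsCP; exists 1 => // z _; exact: H. Qed.

Lemma near_neq a z : z != a -> \forall y \near z, y != a.
Proof.
move=> za; apply/nbhsCP; exists (cabs (z - a));
  first by rewrite cabs_gt0 subr_eq0.
move=> y yz; apply/negP => /eqP ya; move: yz.
by rewrite ya cabsB ltxx.
Qed.

Lemma hol_punctured h a : (\forall z \near a^', derivable h z 1) ->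
  derivable h a 1 -> holomorphic_near h a.
Proof.
move=> H ha; have [r r0 hr] := (dnbhsCP a (fun z => derivable h z 1)).1 H.
apply/holP.
exists r; first exact: r0.
move=> z zr.
by have [->|za] := eqVneq z a; [exact: ha|exact: hr].
Qed.

Lemma der_shift a z : is_derive z 1 (fun z : C => z - a) 1.
Proof. by have := derB (der_id z) (der_cst a z); rewrite subr0. Qed.

Lemma derivable_div h a z n : z != a -> derivable h z 1 ->
  derivable (fun z => h z / (z - a) ^+ n : C) z 1.
Proof.
move=> za dh; apply: der_derivable; apply: derM; first exact: der_derive.
apply: derV; first by rewrite expf_neq0// subr_eq0.
by apply: derX; exact: der_shift.
Qed.

(** The quotient is differentiable at a because h has a second derivative
    there, which the mean value inequality turns into a second-order expansion
    of h. *)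
Lemma hol_factor h a : holomorphic_near h a -> h a = 0 ->
  exists2 q : C -> C, holomorphic_near q a & forall z, h z = (z - a) * q z.
Proof.
move=> hh ha0; have [r r0 dh] := (holP h a).1 hh.
pose d1 : C := 'D_1 h a; pose d2 : C := 'D_1 (fun z : C => 'D_1 h z : C) a.
exists (fun z => if z == a then d1 else h z / (z - a)); last first.
  move=> z; case: eqVneq => [->|za]; first by rewrite subrr mul0r.
  by rewrite mulrC divfK// subr_eq0.
apply: hol_punctured.
  apply/dnbhsCP; exists r => // z za zr.
  apply: der_derivable;
    apply: (der_near_eq _ (der_derive (@derivable_div h a z 1 za (dh z zr)))).
  apply: filterS (near_neq za) => y /negPf ->.
  by rewrite expr1.
apply: (@der_derivable _ _ _ (d2 / 2)); apply/der_quot/cvgCP => e e0.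
have e20 : 0 < e / 2 by lra.
have [s s0 hs] := derivableCP (hol_derive_derivable hh) e20.
apply/dnbhsCP; exists (Num.min r s); first by rewrite lt_min r0.
move=> z za; rewrite lt_min => /andP[zr zs]; rewrite (negPf za) eqxx.
have za0 : z - a != 0 by rewrite subr_eq0.
have seg (x : R) : 0 <= x <= 1 -> cabs (a + x%:C * (z - a) - a) <= cabs (z - a).
  move=> /andP[x0 x1]; have ->
    : a + x%:C * (z - a) - a = x%:C * (z - a) by ring.
  by rewrite cabsM cabs_real ger0_norm// ler_piMl// cabs_ge0.
(* The remainder of the second-order expansion; its derivative is the remainder
   of the first-order expansion of h'. *)
pose g := (fun z : C => h z - d1 * (z - a) - d2 / 2 * (z - a) ^+ 2 : C).
have dg (y : C) : cabs (y - a) < r ->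
    is_derive y 1 g ('D_1 h y - d1 - d2 * (y - a)).
  move=> yr; have := derB (derB (der_derive (dh y yr))
     (derM (der_cst d1 y) (der_shift a y)))
     (derM (der_cst (d2 / 2) y) (derX 2 (der_shift a y))).
  by rewrite /g; congr is_derive; rewrite /= expr1; field.
have dd1 (x : R) : 0 <= x <= 1 -> derivable g (a + x%:C * (z - a) : C) 1.
  by move=> x01; exact: der_derivable (dg _ (le_lt_trans (seg x x01) zr)).
have bb (x : R) : 0 <= x <= 1 ->
    cabs ('D_1 g (a + x%:C * (z - a) : C)) <= e / 2 * cabs (z - a).
  move=> x01; rewrite (der_val (dg _ (le_lt_trans (seg x x01) zr))).
  rewrite (le_trans (hs _ (le_lt_trans (seg x x01) zs)))//.
  by rewrite ler_pM2l// seg.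
have := mean_value_ineq dd1 bb.
have -> : a + (z - a) = z by ring.
have -> : g z - g a = ((h z / (z - a) - d1) / (z - a) - d2 / 2) * (z - a) * (z
  - a).
  by rewrite /g ha0; field.
rewrite !cabsM !ler_pM2r ?cabs_gt0// => /le_lt_trans; apply; lra.
Qed.

Lemma cvgC_uniq (T : Type) (F : set_system T) (FF : ProperFilter F)
  (f : T -> C) (l1 l2 : C) : f @ F --> l1 -> f @ F --> l2 -> l1 = l2.
Proof. exact: cvg_unique. Qed.

Global Instance dnbhsC_proper a : ProperFilter a^'.
Proof. exact: Proper_dnbhs_numFieldType. Qed.

Lemma cvg_dnbhs h a (l : C) : h z @[z --> a] --> l -> h z @[z --> a^'] --> l.
Proof. by move=> H A /H; exact: nbhs_dnbhs. Qed.

(** The function (z - a) h(z) is differentiable at a, with derivative h(a), and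
    h is recovered from it by [hol_factor]. *)
Lemma removable_singularity h a : (\forall z \near a^', derivable h z 1) ->
  h z @[z --> a^'] --> h a -> holomorphic_near h a.
Proof.
move=> dh hc.
pose v := (fun z : C => (z - a) * h z : C).
have dva : is_derive a 1 v (h a).
  apply/der_quot/cvgCP => e e0; have /cvgCP/(_ e e0) := hc.
  move=> /dnbhsCP[r r0 hr]; apply/dnbhsCP; exists r => // z za zr.
  have za0 : z - a != 0 by rewrite subr_eq0.
  have -> : (v z - v a) / (z - a) = h z by rewrite /v; field.
  exact: hr.
have hv : holomorphic_near v a.
  apply: hol_punctured; last exact: der_derivable dva.
  apply: filterS dh => z dz; apply: der_derivable.
  exact: derM (der_shift a z) (der_derive dz).
have v0 : v a = 0 by rewrite /v subrr mul0r.
have [q hq qE] := hol_factor hv v0.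
have qh z : z != a -> h z = q z.
  move=> za; have za0 : z - a != 0 by rewrite subr_eq0.
  by apply: (mulfI za0); rewrite -qE.
have qa : q a = h a.
  have c1 := cvg_dnbhs (derivable_cvg (hol_der hq)).
  apply: (@cvgC_uniq _ _ (dnbhsC_proper a) q _ _ c1).
  apply/cvgCP => e e0; have /cvgCP/(_ e e0)/dnbhsCP[r r0 hr] := hc.
  apply/dnbhsCP; exists r; first exact: r0.
  by move=> z za zr; rewrite -qh//; exact: hr.
apply: (@hol_near_eq _ q) hq; apply: near_all => z.
by have [->|za] := eqVneq z a; rewrite ?qa// qh.
Qed.

(** Otherwise h is divisible by every power of z - a. The quotient by the n-th
    power is bounded by K / r ^ n where r <= |z - a| <= 3 r, hence also where
    |z - a| < r, by [mean_estimate] on circles of radius 2 r. Letting n grow, h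
    vanishes where |z - a| < r / 2. *)
Lemma hol_order h a : holomorphic_near h a ->
  (\forall z \near a, h z = 0) \/
  exists n (q : C -> C), [/\ holomorphic_near q a, q a != 0 &
    \forall z \near a, h z = (z - a) ^+ n * q z].
Proof.
move=> hh; apply: contrapT => /not_orP[nz nq]; apply: nz.
have div n : exists2 q : C -> C, holomorphic_near q a &
    \forall z \near a, h z = (z - a) ^+ n * q z.
  elim: n => [|n [q hq qE]].
    by exists h => //; apply: near_all => z; rewrite expr0 mul1r.
  have qa : q a = 0.
    by apply: contrapT => /eqP qa; apply: nq; exists n, q.
  have [q' hq' q'E] := hol_factor hq qa.
  exists q' => //; apply: filterS qE => z ->.
  by rewrite q'E exprSr mulrA.
have [r1 r10 dh] := (holP h a).1 hh.
have [r2 r20 hK] := cvg_bounded (derivable_cvg (hol_der hh)).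
set K := cabs (h a) + 1 in hK.
pose r := Num.min r1 r2 / 4.
have m0 : 0 < Num.min r1 r2 by rewrite lt_min r10.
have [m1 m2] : Num.min r1 r2 <= r1 /\ Num.min r1 r2 <= r2.
  by rewrite !ge_min !lexx orbT.
have r0 : 0 < r by rewrite /r; lra.
have {}dh z : cabs (z - a) <= 3 * r -> derivable h z 1.
  by move=> za; apply: dh; move: za; rewrite /r; lra.
have {}hK z : cabs (z - a) <= 3 * r -> cabs (h z) <= K.
  by move=> za; apply: hK; move: za; rewrite /r; lra.
clearbody r => {m1 m2 m0 r10 r20 r1 r2}.
have K0 : 0 <= K by rewrite addr_ge0 ?cabs_ge0.
have r20 : 0 < 2 * r by lra.
have bound n z : z != a -> cabs (z - a) < r ->
  cabs (h z) <= K * (cabs (z - a) / r) ^+ n.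
  move=> za zr; have [q hq qE] := div n.
  have za0 : 0 < cabs (z - a) by rewrite cabs_gt0 subr_eq0.
  (* The factorisation holds on a neighbourhood of a that shrinks with n; this
     quotient is differentiable on the whole disc of radius 3 r. *)
  pose q' := (fun z : C => if z == a then q a else h z / (z - a) ^+ n : C).
  have q'q : \forall z \near a, q z = q' z.
    apply: filterS qE => y yE; rewrite /q'; case: eqVneq => [->//|ya].
    by rewrite yE mulrC mulKf// expf_neq0// subr_eq0.
  have dq' y : cabs (y - a) <= 3 * r -> derivable q' y 1.
    move=> yr; have [->|ya] := eqVneq y a.
      exact: hol_der (hol_near_eq q'q hq).
    apply: der_derivable.
    apply: (der_near_eq _ (der_derive (@derivable_div h a y n ya (dh y yr)))).
    by apply: filterS (near_neq ya) => x /negPf; rewrite /q' => ->.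
  have tri (y : C) (s : R) : cabs (y - z) <= s -> cabs (y - a) <= s + r.
    move=> ys; have -> : y - a = (y - z) + (z - a) by ring.
    by rewrite (le_trans (cabsD _ _))//; lra.
  have dd y : cabs (y - z) <= 2 * r -> derivable q' y 1.
    by move=> /tri yr; apply: dq'; lra.
  have bb y : cabs (y - z) = 2 * r -> cabs (q' y) <= K / r ^+ n.
    move=> yz; have yz' : cabs (y - z) <= 2 * r by rewrite yz.
    have ya : r <= cabs (y - a).
      have := cabsD (y - a) (a - z); rewrite [cabs (a - z)]cabsB.
      have -> : y - a + (a - z) = y - z by ring.
      by rewrite yz; lra.
    have ya0 : y != a.
      by rewrite -subr_eq0 -cabs_gt0; exact: lt_le_trans r0 ya.
    rewrite /q' (negPf ya0) cabsM cabsV cabsX; apply: ler_pM.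
    - exact: cabs_ge0.
    - by rewrite invr_ge0 exprn_ge0 ?cabs_ge0.
    - by apply: hK; have := tri _ _ yz'; lra.
    rewrite lef_pV2 ?posrE ?exprn_gt0 ?(lt_le_trans r0 ya)//.
    by rewrite lerXn2r ?nnegrE ?cabs_ge0// ltW.
  have := mean_estimate r20 dd bb.
  rewrite /q' (negPf za) cabsM cabsV cabsX ler_pdivrMr ?exprn_gt0// => hz.
  by rewrite (le_trans hz)// expr_div_n mulrAC mulrA.
have h0 : h a = 0.
  have [q _ /nbhs_singleton ->] := div 1%N.
  by rewrite subrr expr1 mul0r.
apply/nbhsCP; exists (r / 2) => [|z zr]; first by lra.
have [->//|za] := eqVneq z a.
apply/eqP; rewrite -cabs_eq0 eq_le cabs_ge0 andbT leNgt; apply/negP => hz.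
have [n] := exp_half_small K hz.
apply/negP; rewrite -leNgt (le_trans (bound n z za _))//; first by lra.
rewrite ler_wpM2l// -exprVn lerXn2r ?nnegrE ?divr_ge0 ?cabs_ge0 ?invr_ge0//.
  exact: ltW.
by rewrite ler_pdivrMr//; lra.
Qed.

(** Near a, h differs little from its linear part, so it expands distances at
    least by |d| / 2. A value y close to h(a) is taken: otherwise 1 / (h - y)
    would be larger at a than on a circle around a, contrary to
    [mean_estimate]. *)
Lemma local_inverse h a : holomorphic_near h a -> 'D_1 h a != 0 ->
  exists g : C -> C, [/\ holomorphic_near g (h a), g (h a) = a,
    \forall y \near h a, h (g y) = y & \forall z \near a, g (h z) = z].
Proof.
move=> hh d0; have [r1 r10 dh] := (holP h a).1 hh.
have [d dE] : exists d : C, 'D_1 h a = d by exists ('D_1 h a).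
rewrite dE in d0; have nd0 : 0 < cabs d by rewrite cabs_gt0.
have nd2 : 0 < cabs d / 2 by lra.
have /cvgCP/(_ _ nd2)/nbhsCP[r2 r20 dd] :=
  derivable_cvg (hol_derive_derivable hh).
pose r := Num.min r1 r2 / 2.
have m0 : 0 < Num.min r1 r2 by rewrite lt_min r10.
have [m1 m2] : Num.min r1 r2 <= r1 /\ Num.min r1 r2 <= r2.
  by rewrite !ge_min !lexx orbT.
have r0 : 0 < r by rewrite /r; lra.
have {}dh z : cabs (z - a) <= r -> derivable h z 1.
  by move=> za; apply: dh; move: za; rewrite /r; lra.
have {}dd z : cabs (z - a) <= r -> cabs ('D_1 h z - d) <= cabs d / 2.
  move=> za; have := dd z; rewrite /= dE => dz; apply/ltW/dz.
  by move: za; rewrite /r; lra.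
clearbody r => {m1 m2 m0 r10 r20 r1 r2}.
have dg z : cabs (z - a) <= r ->
    is_derive z 1 (fun z : C => h z - d * z : C) ('D_1 h z - d).
  move=> zr; have := derB (der_derive (dh z zr)) (derM (der_cst d z) (der_id
    z)).
  by rewrite mulr1 mulr0 addr0.
have dg1 z : cabs (z - a) <= r -> derivable (fun z : C => h z - d * z : C) z 1.
  by move=> zr; exact: der_derivable (dg z zr).
have dg2 z : cabs (z - a) <= r ->
  cabs ('D_1 (fun z : C => h z - d * z : C) z) <= cabs d / 2.
  by move=> zr; rewrite (der_val (dg z zr)) dd.
have expand x y : cabs (x - a) <= r -> cabs (y - a) <= r ->
    cabs d / 2 * cabs (x - y) <= cabs (h x - h y).
  move=> xr yr; have := mean_value_disc dg1 dg2 xr yr.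
  have := cabsD (h x - h y) (d * x - d * y - (h x - h y)).
  have -> : h x - h y + (d * x - d * y - (h x - h y)) = d * (x - y) by ring.
  have -> : d * x - d * y - (h x - h y) = - (h x - d * x - (h y - d * y)) by
    ring.
  by rewrite cabsN cabsM; lra.
have inj x y : cabs (x - a) <= r -> cabs (y - a) <= r -> h x = h y -> x = y.
  move=> xr yr xy; have := expand x y xr yr; rewrite xy subrr cabs0.
  rewrite pmulr_rle0// => ?; apply/eqP; rewrite -subr_eq0 -cabs_eq0.
  by rewrite eq_le cabs_ge0 andbT.
have aa : cabs (a - a) <= r by rewrite subrr cabs0 ltW.
(* On the circle of radius r, h is at distance at least 2 rho from h(a). *)
pose rho := cabs d * r / 4.
have rho0 : 0 < rho by rewrite /rho divr_gt0// mulr_gt0.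
have surj y : cabs (y - h a) < rho -> exists2 x, cabs (x - a) <= r & h x = y.
  move=> yr; apply: contrapT => nex.
  have ne z : cabs (z - a) <= r -> h z - y != 0.
    by move=> zr; rewrite subr_eq0; apply/eqP => zy; apply: nex; exists z.
  have d1 z : cabs (z - a) <= r ->
    derivable (fun z : C => (h z - y)^-1 : C) z 1.
    move=> zr; apply: der_derivable; apply: derV; first exact: ne z zr.
    exact: derB (der_derive (dh z zr)) (der_cst y z).
  have bb z : cabs (z - a) = r -> cabs ((h z - y)^-1) <= rho^-1.
    move=> zr; have zr' : cabs (z - a) <= r by rewrite zr.
    rewrite cabsV lef_pV2 ?posrE ?cabs_gt0 ?ne//.
    have := expand z a zr' aa; rewrite zr.
    have := cabsD (h z - y) (y - h a).
    have -> : h z - y + (y - h a) = h z - h a by ring.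
    have -> : cabs d / 2 * r = 2 * rho by rewrite /rho; field.
    lra.
  have := mean_estimate r0 d1 bb.
  rewrite cabsV lef_pV2 ?posrE ?cabs_gt0 ?ne// cabsB; lra.
pose g y := xget a [set x | cabs (x - a) <= r /\ h x = y].
have gP y : cabs (y - h a) < rho -> cabs (g y - a) <= r /\ h (g y) = y.
  move=> yr; rewrite /g; case: xgetP => [x _ //|/(_ _)].
  by have [x xr xy] := surj y yr => /(_ x)[].
have gh z : cabs (z - a) <= r -> cabs (h z - h a) < rho -> g (h z) = z.
  by move=> zr hr; have [g1 g2] := gP _ hr; exact: inj.
have hra : cabs (h a - h a) < rho by rewrite subrr cabs0.
exists g; split.
- apply/holP; exists rho => // y yr.
  have [xr xy] := gP y yr; set x := g y in xr xy.
  set e := 'D_1 h x.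
  have e0 : e != 0.
    apply/eqP => e0; have := dd x xr; rewrite -/e e0 sub0r cabsN; lra.
  have ne0 : 0 < cabs e by rewrite cabs_gt0.
  apply: (@der_derivable _ _ _ e^-1); apply/is_deriveCP => eps eps0.
  have eps'0 : 0 < eps * cabs e * (cabs d / 2) by rewrite !mulr_gt0.
  have [s s0 hs] := derivableCP (dh x xr) eps'0.
  exists (Num.min (rho - cabs (y - h a)) (s * (cabs d / 2))) => [|y'].
    by rewrite lt_min subr_gt0 yr mulr_gt0.
  rewrite lt_min => /andP[y'1 y'2].
  have y'r : cabs (y' - h a) < rho.
    have -> : y' - h a = (y' - y) + (y - h a) by ring.
    by rewrite (le_lt_trans (cabsD _ _))//; lra.
  have [x'r x'y] := gP y' y'r; set x' := g y' in x'r x'y *.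
  have xx : cabs d / 2 * cabs (x' - x) <= cabs (y' - y).
    by have := expand x' x x'r xr; rewrite x'y xy.
  have xs : cabs (x' - x) < s.
    by rewrite -(ltr_pM2r nd2) mulrC (le_lt_trans xx).
  have := hs x' xs; rewrite x'y xy -/e => le1.
  have -> : x' - x - e^-1 * (y' - y) = - (y' - y - e * (x' - x)) / e by field.
  rewrite cabsM cabsN cabsV ler_pdivrMr// (le_trans le1)//.
  have -> : eps * cabs e * (cabs d / 2) * cabs (x' - x) =
    eps * cabs e * (cabs d / 2 * cabs (x' - x)) by ring.
  have -> : eps * cabs (y' - y) * cabs e = eps * cabs e * cabs (y' - y) by ring.
  by rewrite ler_pM2l// mulr_gt0.
- exact: gh.
- by apply/nbhsCP; exists rho => // y /gP[].
- have /cvgCP/(_ _ rho0)/nbhsCP[s s0 hs] := derivable_cvg (hol_der hh).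
  apply/nbhsCP; exists (Num.min r s); first by rewrite lt_min r0.
  move=> z; rewrite lt_min => /andP[zr zs]; apply: gh; first exact: ltW.
  exact: hs.
Qed.

End Zeros.

Section LocalNormalForm.
Variable R : realType.
Local Notation C := (R[i]^o).
Implicit Types (h : C -> C) (a z : C).

Lemma hol_comp (f g : C -> C) a : holomorphic_near g a ->
  holomorphic_near f (g a) -> holomorphic_near (fun z => f (g z) : C) a.
Proof.
move=> hg hf; have [r1 r10 h1] := (holP f (g a)).1 hf.
have [r2 r20 h2] := (holP g a).1 hg.
have /cvgCP/(_ _ r10)/nbhsCP[r3 r30 h3] := derivable_cvg (hol_der hg).
apply/holP; exists (Num.min r2 r3) => [|z]; first by rewrite lt_min r20.
rewrite lt_min => /andP[z2 z3]; apply: der_derivable.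
exact: der_comp (der_derive (h2 z z2)) (der_derive (h1 _ (h3 z z3))).
Qed.

(** A holomorphic branch of the m-th root is a local inverse of the power
    function. *)
Lemma local_root m (c : C) : (0 < m)%N -> c != 0 ->
  exists2 s : C -> C, holomorphic_near s c & \forall y \near c, s y ^+ m = y.
Proof.
move=> m0 c0; pose y0 := (m.-root c : C).
have y0m : y0 ^+ m = c by exact: rootCK.
have y00 : y0 != 0.
  by apply/eqP => y00; move: c0; rewrite -y0m y00 expr0n gtn_eqF// eqxx.
pose h := (fun y : C => y ^+ m : C).
have dh (y : C) : is_derive y 1 h (m%:R * y ^+ m.-1 * 1) by exact: derX
  (der_id y).
have hh : holomorphic_near h y0 by apply: near_all => y;
  exact: der_derivable (dh y).
have [|g []] := local_inverse hh.
  rewrite (der_val (dh y0)) mulr1 mulf_neq0 ?expf_neq0//.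
  by rewrite pnatr_eq0 -lt0n.
by rewrite /h y0m => hg _ gy _; exists g.
Qed.

(** In h = (z - a) ^ m q with q(a) nonzero, take an m-th root of q. *)
Lemma local_power h a : holomorphic_near h a -> h a = 0 ->
  ~ (\forall z \near a, h z = 0) ->
  exists m (f : C -> C), [/\ (0 < m)%N, holomorphic_near f a, f a = 0,
    'D_1 f a != 0 & \forall z \near a, h z = f z ^+ m].
Proof.
move=> hh ha nz; have [//|[m [q [hq qa qE]]]] := hol_order hh.
have m0 : (0 < m)%N.
  rewrite lt0n; apply/eqP => m0; move: qa; rewrite -[q a]mul1r -(expr0 (a - a)).
  by have := nbhs_singleton qE; rewrite m0 ha => <-; rewrite eqxx.
have [s hs sE] := local_root m0 qa.
have hsq := hol_comp hq hs.
have d (z : C) : derivable (fun z => s (q z) : C) z 1 ->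
    is_derive z 1 (fun z => (z - a) * s (q z) : C)
      ((z - a) * 'D_1 (fun z => s (q z) : C) z + s (q z) * 1).
  by move=> ds; exact: derM (der_shift a z) (der_derive ds).
exists m, (fun z => (z - a) * s (q z)); split; first exact: m0.
- by apply: filterS hsq => z /d /der_derivable.
- by rewrite subrr mul0r.
- rewrite (der_val (d a (hol_der hsq))) subrr mul0r add0r mulr1.
  apply/eqP => s0; move: qa; rewrite -(nbhs_singleton sE) s0.
  by rewrite expr0n gtn_eqF// eqxx.
have /nbhsCP[r1 r10 h1] := sE; have /nbhsCP[r2 r20 h2] := qE.
have /cvgCP/(_ _ r10)/nbhsCP[r3 r30 h3] := derivable_cvg (hol_der hq).
apply/nbhsCP; exists (Num.min r2 r3); first by rewrite lt_min r20.
move=> z; rewrite lt_min => /andP[z2 z3].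
by rewrite (h2 z z2) exprMn (h1 _ (h3 z z3)).
Qed.

End LocalNormalForm.

(** * Liouville's theorem *)

Section Liouville.
Variable R : realType.
Local Notation C := (R[i]^o).
Implicit Types (h : C -> C) (a z : C) (q : {poly R[i]}).

Lemma der_horner q z : is_derive z 1 (fun z : C => q.[z] : C) (q^`().[z]).
Proof.
elim/poly_ind: q => [|q c IH].
  rewrite deriv0 horner0;
    have -> : (fun z : C => (0 : {poly R[i]}).[z] : C) = (fun=> 0).
    by apply/funext => y; rewrite horner0.
  exact: der_cst.
have -> : (fun z : C => (q * 'X + c%:P).[z] : C) = (fun z => q.[z] * z + c).
  by apply/funext => y; rewrite hornerMXaddC.
have := derD (derM IH (der_id z)) (der_cst c z).
congr is_derive; rewrite derivD derivC derivM derivX !addr0 !mulr1 hornerD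
  hornerMX.
by rewrite addrC mulrC.
Qed.

Lemma der_eq0_const h : (forall z, is_derive z 1 h 0) -> forall z, h z = h 0.
Proof.
move=> dh z.
have d1 (x : R) : 0 <= x <= 1 -> derivable h (0 + x%:C * z : C) 1.
  by move=> _; exact: der_derivable (dh _).
have d2 (x : R) : 0 <= x <= 1 -> cabs ('D_1 h (0 + x%:C * z : C)) <= 0.
  by move=> _; rewrite (der_val (dh _)) cabs0.
have := mean_value_ineq d1 d2; rewrite mul0r add0r => le0.
by apply/eqP; rewrite -subr_eq0 -cabs_eq0 eq_le le0 cabs_ge0.
Qed.

Lemma poly_antiderivative q n : (size q <= n)%N ->
  exists2 Q : {poly R[i]}, Q^`() = q & (size Q <= n.+1)%N.
Proof.
move=> qn; exists (\poly_(i < n.+1) (if i is j.+1 then q`_j / j.+1%:R else 0)).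
  apply/polyP => i; rewrite coef_deriv coef_poly ltnS.
  case: ltnP => [_|ni]; last by rewrite mul0rn nth_default// (leq_trans qn).
  by rewrite -[LHS]mulr_natr /= divfK// pnatr_eq0.
exact: size_poly.
Qed.

(** Induction on [p]. By [cauchy_estimate] on the circle of radius 2 |a| around
    a, which lies where |a| <= |z| <= 3 |a|, the derivative grows with exponent
    one less, so it is a polynomial, and h differs from a primitive of it by a
    constant. *)
Theorem entire_growth_poly p h : (forall z, derivable h z 1) ->
  (exists K r0 : R, forall z, r0 <= cabs z -> cabs (h z) <= K * cabs z ^+ p) ->
  exists2 q : {poly R[i]}, (size q <= p.+1)%N & forall z, h z = q.[z].
Proof.
elim: p h => [|p IH] h dh [K [r0 hK]].
  have bound a (r : R) : 0 < r -> r0 + cabs a <= r -> cabs ('D_1 h a) <= K / r.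
    move=> rp r0r; have d1 z : cabs (z - a) <= r -> derivable h z 1 by move=> _.
    have b1 z : cabs (z - a) = r -> cabs (h z) <= K.
      move=> za; have := hK z; rewrite expr0 mulr1; apply.
      have := cabsD z (- a); rewrite za cabsN; lra.
    exact: cauchy_estimate rp d1 b1.
  have d0 a : 'D_1 h a = 0.
    apply/eqP; rewrite -cabs_eq0 eq_le cabs_ge0 andbT;
      apply/ler_addgt0Pr => e e0.
    rewrite add0r; pose r := `|r0| + cabs a + `|K| / e + 1.
    have Ke : 0 <= `|K| / e by rewrite divr_ge0// ltW.
    have na := cabs_ge0 a; have nr := normr_ge0 r0; have lr := ler_norm r0.
    have rp : 0 < r by rewrite /r; lra.
    rewrite (le_trans (bound a r rp _))//; first by rewrite /r; lra.
    rewrite ler_pdivrMr// (le_trans (ler_norm K))//.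
    by rewrite mulrC -ler_pdivrMr// /r; lra.
  exists (h 0 : R[i])%:P; first exact: size_polyC_leq1.
  move=> z; rewrite hornerC; apply: der_eq0_const => y.
  by rewrite -(d0 y); exact: der_derive.
have dd z : derivable (fun z => 'D_1 h z : C) z 1.
  by apply: hol_derive_derivable; apply: near_all.
have [|q sq qE] := IH (fun z => 'D_1 h z) dd.
  exists (`|K| * 3 ^+ p.+1 / 2), (`|r0| + 1) => a ra.
  have lr := ler_norm r0; have nr := normr_ge0 r0.
  have na : 0 < cabs a by lra.
  have r20 : 0 < 2 * cabs a by lra.
  have d1 z : cabs (z - a) <= 2 * cabs a -> derivable h z 1 by move=> _.
  have b1 z : cabs (z - a) = 2 * cabs a ->
    cabs (h z) <= `|K| * (3 * cabs a) ^+ p.+1.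
    move=> za.
    have z1 : cabs z <= 3 * cabs a by have := cabs_le_sub z a; rewrite za; lra.
    have z2 : cabs a <= cabs z by have := cabsD z (- a); rewrite za cabsN; lra.
    rewrite (le_trans (hK z _))//; first by lra.
    rewrite (le_trans (ler_wpM2r _ (ler_norm K)))// ?exprn_ge0 ?cabs_ge0//.
    by rewrite ler_wpM2l//; apply: lerXn2r; rewrite ?nnegrE ?cabs_ge0//; lra.
  rewrite (le_trans (cauchy_estimate r20 d1 b1))//.
  rewrite exprMn [cabs a ^+ p.+1]exprS le_eqVlt; apply/orP; left; apply/eqP.
  by field; rewrite gt_eqF.
have [Q dQ sQ] := poly_antiderivative sq.
have cst : forall z, h z - Q.[z] = h 0 - Q.[0].
  apply: (@der_eq0_const (fun z => h z - Q.[z])) => z.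
  have := derB (der_derive (dh z)) (der_horner Q z).
  by rewrite dQ -qE subrr.
exists (Q + (h 0 - Q.[0] : R[i])%:P).
  rewrite (leq_trans (size_polyD _ _))// geq_max sQ /=.
  exact: leq_trans (size_polyC_leq1 _) _.
move=> z; rewrite hornerD hornerC; have := cst z => /eqP.
by rewrite subr_eq addrC => /eqP.
Qed.

(** The singularities of [u] are removable, and filling them in gives [L],
    which is therefore entire. *)
Theorem meromorphic_growth_poly p (u L : C -> C) :
  (forall a, \forall z \near a^', derivable u z 1) ->
  (forall a, u z @[z --> a^'] --> L a) ->
  (exists K r0 : R, forall z, r0 <= cabs z -> cabs (u z) <= K * cabs z ^+ p) ->
  exists2 q : {poly R[i]}, (size q <= p.+1)%N & forall z, L z = q.[z].
Proof.
move=> du uL [K [r0 hK]].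
have LE z : derivable u z 1 -> L z = u z.
  move=> duz; have uz := cvg_dnbhs (derivable_cvg duz).
  exact: (@cvgC_uniq _ _ _ (dnbhsC_proper z) u _ _ (uL z) uz).
have dL a : holomorphic_near L a.
  have [r rp hr] := (dnbhsCP a (fun z => derivable u z 1)).1 (du a).
  apply: removable_singularity.
    apply/dnbhsCP; exists r; first exact: rp.
    move=> z za zr; apply: der_derivable;
      apply: (der_near_eq _ (der_derive (hr z za zr))).
    have s0 : 0 < Num.min (r - cabs (z - a)) (cabs (z - a)).
      by rewrite lt_min subr_gt0 zr cabs_gt0 subr_eq0.
    apply/nbhsCP; exists (Num.min (r - cabs (z - a)) (cabs (z - a)));
      first exact: s0.
    move=> y; rewrite lt_min => /andP[y1 y2]; rewrite LE//; apply: hr.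
      by apply/eqP => ya; move: y2; rewrite ya cabsB ltxx.
    have -> : y - a = (y - z) + (z - a) by ring.
    by rewrite (le_lt_trans (cabsD _ _))//; lra.
  apply/cvgCP => e e0; have /cvgCP/(_ e e0)/dnbhsCP[s s0 hs] := uL a.
  apply/dnbhsCP; exists (Num.min r s); first by rewrite lt_min rp.
  move=> z za; rewrite lt_min => /andP[zr zs].
  by rewrite (LE z (hr z za zr)); exact: hs.
apply: entire_growth_poly => [z|]; first exact: hol_der (dL z).
exists (`|K| * 2 ^+ p + 1), (`|r0| + 2) => z zr.
have lr := ler_norm r0; have nr := normr_ge0 r0.
have /cvgCP/(_ 1 ltr01)/dnbhsCP[s s0 hs] := uL z.
have m0 : 0 < Num.min s 1 by rewrite lt_min s0 ltr01.
have [ms m1] : Num.min s 1 <= s /\ Num.min s 1 <= 1 by rewrite !ge_min !lexx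
  orbT.
pose y : C := z + (Num.min s 1 / 2)%:C.
have yz : cabs (y - z) = Num.min s 1 / 2.
  have -> : y - z = (Num.min s 1 / 2)%:C by rewrite /y; ring.
  by rewrite cabs_real ger0_norm//; lra.
have yz0 : y != z by rewrite -subr_eq0 -cabs_gt0 yz; lra.
have uy : cabs (u y - L z) < 1 by apply: hs; [exact: yz0|rewrite yz; lra].
have y1 := cabs_le_sub y z; have y2 := cabs_le_sub z y; rewrite cabsB in y2.
have hy : cabs (u y) <= `|K| * (2 * cabs z) ^+ p.
  rewrite (le_trans (hK y _))//; first by lra.
  rewrite (le_trans (ler_wpM2r _ (ler_norm K)))// ?exprn_ge0 ?cabs_ge0//.
  by rewrite ler_wpM2l//; apply: lerXn2r; rewrite ?nnegrE ?cabs_ge0//; lra.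
have z1 : 1 <= cabs z ^+ p by rewrite exprn_ege1//; lra.
have := cabs_le_sub (L z) (u y); rewrite cabsB mulrDl mul1r => hL.
rewrite exprMn mulrA in hy; lra.
Qed.

End Liouville.

(** * Local coordinates on a Riemann surface *)

Section Coordinates.
Variables (R : realType) (M : riemannSurface R).
Local Notation C := (R[i]^o).
Implicit Types (x y a : M) (c : chart R M) (phi psi : C -> C).

(** [F] is a chart around [x] with local inverse [G], compatible with the
    atlas. The atlas itself is not rich enough: coordinates in which a given
    function is a power are needed. *)
Record is_coord x (F : M -> C) (G : C -> M) : Prop := IsCoord {
  co_cvg : F y @[y --> x] --> F x;
  co_inv_cvg : G u @[u --> F x] --> x;
  co_K : \forall y \near x, G (F y) = y;
  co_invK : \forall u \near F x, F (G u) = u;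
  co_hol : forall h, holomorphic_at h x ->
    holomorphic_near (fun u => h (G u) : C) (F x);
  co_hol_at : holomorphic_at F x }.

Lemma chart_coord c x : rs_atlas c -> chart_dom c x ->
  is_coord x c (chart_inv c).
Proof.
move=> cA xc.
have cx : c x \in c @` chart_dom c by rewrite inE; exists x.
have co : {in chart_dom c, continuous c}.
  by rewrite -continuous_open_subspace;
    [exact: chart_map_continuous|exact: chart_dom_open].
have ci : {in c @` chart_dom c, continuous (chart_inv c)}.
  by rewrite -continuous_open_subspace;
    [exact: chart_inv_continuous|exact: chart_cod_open].
have od : \forall y \near x, chart_dom c y.
  by apply: open_nbhs_nbhs; split=> //; exact: chart_dom_open.
have oc : \forall u \near c x, (c @` chart_dom c) u.
  by apply: open_nbhs_nbhs; split; [exact: chart_cod_open|exists x].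
split.
- by apply: co; rewrite inE.
- by have := ci _ cx; rewrite /continuous_at chart_mapK.
- by apply: filterS od => y; exact: chart_mapK.
- by apply: filterS oc => _ [y yc <-]; rewrite chart_mapK.
- by move=> h hh; exact: hh.
- by move=> c' c'A xc'; exact: rs_transition.
Qed.

Lemma coordK x F G : is_coord x F G -> G (F x) = x.
Proof. by move=> /co_K/nbhs_singleton. Qed.

Lemma coord_near x F G (P : M -> Prop) : is_coord x F G ->
  (\forall u \near F x, P (G u)) <-> \forall y \near x, P y.
Proof.
move=> co; split=> H; last exact: (co_inv_cvg co).
have H1 := co_cvg co H; have H2 := co_K co.
near=> y; have <- : G (F y) = y by near: y; exact: H2.
by near: y; exact: H1.
Unshelve. all: by end_near. Qed.

Lemma coord_dnbhs x F G : is_coord x F G -> F @ x^' --> (F x)^'.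
Proof.
move=> co A HA.
have H1 : \forall y \near x, F y != F x -> A (F y) := co_cvg co HA.
have H2 := co_K co.
suff: \forall y \near x, y != x -> A (F y) by [].
near=> y => yx; have H : F y != F x -> A (F y) by near: y; exact: H1.
apply: H; apply/eqP => Fyx; move/eqP: yx; apply.
have <- : G (F y) = y by near: y; exact: H2.
by rewrite Fyx (coordK co).
Unshelve. all: by end_near. Qed.

Lemma coord_inv_dnbhs x F G : is_coord x F G -> G @ (F x)^' --> x^'.
Proof.
move=> co A HA.
have H1 : \forall u \near F x, G u != x -> A (G u) := co_inv_cvg co HA.
have H2 := co_invK co.
suff: \forall u \near F x, u != F x -> A (G u) by [].
near=> u => ux; have H : G u != x -> A (G u) by near: u; exact: H1.
apply: H; apply/eqP => Gux; move/eqP: ux; apply.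
have <- : F (G u) = u by near: u; exact: H2.
by rewrite Gux.
Unshelve. all: by end_near. Qed.

Lemma coord_near_dnbhs x F G (P : M -> Prop) : is_coord x F G ->
  (\forall u \near (F x)^', P (G u)) <-> \forall y \near x^', P y.
Proof.
move=> co; split=> H; last exact: (coord_inv_dnbhs co).
have H1 : \forall y \near x, y != x -> P (G (F y)) := coord_dnbhs co H.
have H2 := co_K co.
suff: \forall y \near x, y != x -> P y by [].
near=> y => yx; have H3 : y != x -> P (G (F y)) by near: y; exact: H1.
have <- : G (F y) = y by near: y; exact: H2.
exact: H3.
Unshelve. all: by end_near. Qed.

(** A point of a surface is not isolated, because a point of the plane is not.
 *)
Lemma surface_dnbhs_proper x : ProperFilter x^'.
Proof.
have [c cA xc] := rs_cover x; have co := chart_coord cA xc.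
apply: Build_ProperFilter_ex => P HP.
have H : \forall u \near (c x)^', P (chart_inv c u) := coord_inv_dnbhs co HP.
by have [u Pu] := filter_ex H; exists (chart_inv c u).
Qed.

Lemma hol_at_coord x F G (h : M -> C) : is_coord x F G ->
  holomorphic_near (fun u => h (G u) : C) (F x) -> holomorphic_at h x.
Proof.
move=> co hh c cA xc; have cc := chart_coord cA xc.
have h1 : holomorphic_near (fun u => F (chart_inv c u) : C) (c x).
  exact: (co_hol cc (co_hol_at co)).
have h2 : holomorphic_near (fun u => h (G (F (chart_inv c u))) : C) (c x).
  apply: (@hol_comp _ (fun u => h (G u)) (fun u => F (chart_inv c u)) _ h1).
  by rewrite (coordK cc).
apply: (hol_near_eq _ h2).
have H := (coord_near (fun y => h (G (F y)) = h y) cc).2.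
apply: H; apply: filterS (co_K co) => y.
by move=> ->.
Qed.

Lemma hol_at_cvg x (h : M -> C) : holomorphic_at h x -> h y @[y --> x] --> h x.
Proof.
move=> hh; have [c cA xc] := rs_cover x; have co := chart_coord cA xc.
have hc := derivable_cvg (hol_der (co_hol co hh)).
rewrite (coordK co) in hc.
move=> A /hc HA; have := (coord_near (fun y => A (h y)) co).1.
exact.
Qed.

Definition biholomorphic phi psi (u : C) := [/\ holomorphic_near phi u,
  holomorphic_near psi (phi u), psi (phi u) = u,
  (\forall y \near phi u, phi (psi y) = y) &
  \forall z \near u, psi (phi z) = z].

Lemma near_near (T : topologicalType) (t : T) (P : T -> Prop) :
  (\forall s \near t, P s) -> \forall s \near t, \forall r \near s, P r.
Proof.
move=> H; apply: (filterS _ (nbhs_interior H)) => s.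
exact.
Qed.

Lemma near_comp (T U : topologicalType) (f : T -> U) (t : T) (u : U)
  (P : U -> Prop) : f s @[s --> t] --> u ->
  (\forall y \near u, P y) -> \forall s \near t, P (f s).
Proof. by move=> c H; exact: c. Qed.

Lemma biholomorphic_near phi psi (u : C) : biholomorphic phi psi u ->
  \forall z \near u, biholomorphic phi psi z.
Proof.
move=> [h1 h2 h3 h4 h5].
have c := derivable_cvg (hol_der h1).
have k1 := hol_near h1.
have k2 := near_comp c (hol_near h2).
have k4 := near_comp c (near_near h4).
have k5 := near_near h5.
apply: filterS2 (filterI k1 k2) (filterI h5 (filterI k4 k5)).
by move=> z [z1 z2] [z3 [z4 z5]]; split.
Qed.

Lemma coord_comp x F G phi psi : is_coord x F G ->
  biholomorphic phi psi (F x) ->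
  is_coord x (fun y => phi (F y)) (fun u => G (psi u)).
Proof.
move=> co [h1 h2 h3 h4 h5].
have c1 := derivable_cvg (hol_der h1).
have c2 := derivable_cvg (hol_der h2); rewrite h3 in c2.
split.
- by move=> A /c1/(co_cvg co).
- by move=> A /(co_inv_cvg co)/c2.
- have k1 := co_K co; have k2 := co_cvg co h5.
  near=> y; have -> : psi (phi (F y)) = F y by near: y; exact: k2.
  by near: y; exact: k1.
- have k1 := c2 _ (co_invK co).
  near=> u; have -> : F (G (psi u)) = psi u by near: u; exact: k1.
  by near: u; exact: h4.
- move=> h hh; apply: (@hol_comp _ (fun u => h (G u)) psi _ h2).
  rewrite h3; exact: co_hol co _ hh.
apply: (hol_at_coord co).
apply: (hol_near_eq _ h1).
by apply: filterS (co_invK co) => u ->.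
Unshelve. all: by end_near. Qed.

Lemma chart_coord_near c x : rs_atlas c -> chart_dom c x ->
  \forall y \near x, is_coord y c (chart_inv c).
Proof.
move=> cA xc; have : \forall y \near x, chart_dom c y.
  by apply: open_nbhs_nbhs; split=> //; exact: chart_dom_open.
by apply: filterS => y; exact: chart_coord.
Qed.

End Coordinates.

(** * Orders as exponents of asymptotic expansions *)

(* Same reason as for [derivable]. *)
Local Opaque holomorphic_near.

Section Orders.
Variables (R : realType) (M : riemannSurface R).
Local Notation C := (R[i]^o).
Implicit Types (x y a : M) (c : chart R M) (f g : M -> sphere R).

Lemma near_cvg_eq (T : Type) (F : set_system T) {FF : Filter F} (f g : T -> C)
  (l : C) : (\forall t \near F, f t = g t) -> f @ F --> l -> g @ F --> l.
Proof.
move=> fg /cvgCP fl; apply/cvgCP => e e0.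
by apply: filterS2 fg (fl e e0) => x ->.
Qed.

Lemma cvgC_M (T : Type) (F : set_system T) {FF : Filter F} (f g : T -> C)
  (l k : C) : f @ F --> l -> g @ F --> k ->
  (fun t => f t * g t : C) @ F --> (l * k : C).
Proof. by move=> fl gk; have := cvgM fl gk; apply. Qed.

Lemma cvgC_D (T : Type) (F : set_system T) {FF : Filter F} (f g : T -> C)
  (l k : C) : f @ F --> l -> g @ F --> k ->
  (fun t => f t + g t : C) @ F --> (l + k : C).
Proof. by move=> fl gk; have := cvgD fl gk; apply. Qed.

Lemma cvgC_V (T : Type) (F : set_system T) {FF : Filter F} (f : T ->
  C) (l : C) :
  l != 0 -> f @ F --> l -> (fun t => (f t)^-1 : C) @ F --> (l^-1 : C).
Proof. by move=> l0 fl; have := cvgV l0 fl; apply. Qed.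

Lemma cvg_expn (T : Type) (F : set_system T) {FF : Filter F} (f : T -> C)
  (l : C) (n : nat) : f @ F --> l ->
    (fun t => f t ^+ n : C) @ F --> (l ^+ n : C).
Proof.
move=> fl; elim: n => [|n IH]; first exact: cvg_cst.
have -> : (fun t => f t ^+ n.+1 : C) = (fun t => f t * f t ^+ n).
  by apply/funext => t; rewrite exprS.
have -> : l ^+ n.+1 = l * l ^+ n by rewrite exprS.
exact: (cvgC_M fl IH).
Qed.

Lemma cvg_expz (T : Type) (F : set_system T) {FF : Filter F} (f : T -> C)
  (l : C) (n : int) : l != 0 -> f @ F --> l ->
  (fun t => f t ^ n : C) @ F --> (l ^ n : C).
Proof.
move=> l0 fl; case: n => k; first exact: cvg_expn.
have -> : (fun t => f t ^ (Negz k) : C) = (fun t => (f t ^+ k.+1)^-1) by [].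
have -> : l ^ (Negz k) = (l ^+ k.+1)^-1 by [].
by apply: cvgC_V; [rewrite expf_neq0|exact: cvg_expn].
Qed.

Lemma coord_neq x F G : is_coord x F G -> \forall y \near x^', F y - F x != 0.
Proof.
move=> co; have H : \forall u \near (F x)^', u - F x != 0.
  apply/dnbhsCP; exists 1 => // u ux _; by rewrite subr_eq0.
exact: (coord_dnbhs co H).
Qed.

Lemma coord_cvg0 x F G : is_coord x F G -> F y - F x @[y --> x^'] --> (0 : C).
Proof.
move=> co; apply/cvgCP => e e0.
have H : \forall u \near (F x)^', cabs (u - F x - 0) < e.
  by apply/dnbhsCP; exists e => // u _; rewrite subr0.
exact: (coord_dnbhs co H).
Qed.

(** The two changes of coordinates are inverse to each other, so by the chain
    rule their derivatives multiply to 1. *)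
Lemma coord_ratio x F1 G1 F2 G2 : is_coord x F1 G1 -> is_coord x F2 G2 ->
  exists2 t : C, t != 0 & (F2 y - F2 x) / (F1 y - F1 x) @[y --> x^'] --> t.
Proof.
move=> c1 c2.
have h1 := co_hol c1 (co_hol_at c2); have h2 := co_hol c2 (co_hol_at c1).
have [t d1] : exists t : C,
  is_derive (F1 x : C) 1 (fun u : C => F2 (G1 u) : C) t.
  by exists ('D_1 (fun u : C => F2 (G1 u) : C) (F1 x));
    exact: der_derive (hol_der h1).
have [s d2] : exists s : C,
  is_derive (F2 x : C) 1 (fun u : C => F1 (G2 u) : C) s.
  by exists ('D_1 (fun u : C => F1 (G2 u) : C) (F2 x));
    exact: der_derive (hol_der h2).
have st : s * t = 1.
  have d2' : is_derive ((fun u => F2 (G1 u) : C) (F1 x) : C) 1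
      (fun u : C => F1 (G2 u) : C) s by rewrite /= (coordK c1).
  apply: (der_uniq (der_comp d1 d2')).
  apply: (@der_near_eq _ (fun u => u)).
  have k1 := (coord_near (fun y => G2 (F2 y) = y) c1).2 (co_K c2).
  apply: filterS2 k1 (co_invK c1) => u /= ->.
  by move=> ->.
exists t.
  by apply/eqP => t0; move/eqP: st; rewrite t0 mulr0 eq_sym oner_eq0.
have /der_quot q := d1.
rewrite /= (coordK c1) in q.
have q' : (F2 (G1 (F1 y)) - F2 x) / (F1 y - F1 x) @[y --> x^'] --> t.
  exact: cvg_comp (coord_dnbhs c1) q.
apply: (near_cvg_eq _ q').
have : \forall y \near x^', G1 (F1 y) = y by apply: nbhs_dnbhs (co_K c1).
by apply: filterS => y ->.
Qed.

(** The function f is asymptotic to l (F - F x) ^ n at x. In contrast to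
    [has_ord], which speaks of some chart, this can be checked in any
    coordinate. *)
Definition asymp f x (F : M -> C) (n : int) (l : C) : Prop :=
  [/\ l != 0, \forall y \near x^', f y <> None &
    (odflt 0 (f y) : C) * (F y - F x) ^ (- n) @[y --> x^'] --> l].

Lemma asymp_coord f x F1 G1 F2 G2 n l : is_coord x F1 G1 -> is_coord x F2 G2 ->
  asymp f x F1 n l -> exists l', asymp f x F2 n l'.
Proof.
move=> c1 c2 [l0 fn fl]; have [t t0 tl] := coord_ratio c1 c2.
exists (l * t ^ (- n)); split.
- by rewrite mulf_neq0// expfz_neq0.
- exact: fn.

apply: (near_cvg_eq _ (cvgC_M fl (cvg_expz (n := - n) t0 tl)));
  apply: filterS (coord_neq c1) => y y0.
by rewrite -mulrA -expfzMl [(F1 y - F1 x) * _]mulrC divfK.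
Qed.

(** Otherwise a positive power of the coordinate would have a nonzero limit. *)
Lemma asymp_uniq_le f x F G n m l k : is_coord x F G ->
  asymp f x F n l -> asymp f x F m k -> m <= n.
Proof.
move=> co [l0 _ fl] [k0 _ fk]; rewrite leNgt; apply/negP => ltnm.
have [j jE] : exists j : nat, m - n = j.+1%:Z.
  have : 0 < m - n by rewrite subr_gt0 ltnm.
  by case: (m - n) => // -[|j] // _; exists j.
have PF := surface_dnbhs_proper x.
have c0 := coord_cvg0 co.
have : (fun y => (F y - F x) ^+ j.+1 : C) @ x^' --> (0 : C).
  have -> : (0 : C) = 0 ^+ j.+1 by rewrite expr0n.
  exact: cvg_expn.
have H : (fun y => (F y - F x) ^+ j.+1 : C) @ x^' --> l / k.
  have fk0 : \forall y \near x^',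
    (odflt 0 (f y) : C) * (F y - F x) ^ (- m) != 0.
    move/cvgCP/(_ (cabs k)) : (fk); rewrite cabs_gt0 => /(_ k0).
    apply: filterS => y; apply: contraTneq => ->.
    by rewrite sub0r cabsN ltxx.
  apply: (near_cvg_eq _ (cvgC_M fl (cvgC_V k0 fk)));
    apply: filterS2 (coord_neq co) fk0 => y y0.
  set A : C := odflt 0 (f y); set B := F y - F x in y0 * => AB.
  have A0 : A != 0 by apply: contraNneq AB => ->; rewrite mul0r.
  have -> : B ^+ j.+1 = B ^ (m - n) by rewrite jE.
  rewrite invfM invr_expz opprK mulrACA divff// mul1r -expfzDr//.
  by rewrite addrC.
move/(cvgC_uniq PF H)/eqP; rewrite mulf_eq0 invr_eq0.
by rewrite (negPf l0) (negPf k0).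
Qed.

Lemma has_ord_asymp f x n F G : is_coord x F G -> has_ord f x n ->
  exists l, asymp f x F n l.
Proof.
move=> co [c [cA xc [h [hh h0 fE]]]]; have cc := chart_coord cA xc.
apply: (asymp_coord cc co (l := h (c x))).
split; first by apply/eqP.
  by apply: filterS fE => y ->.
have hc : h (c y) @[y --> x^'] --> h (c x).
  have c1 := cvg_dnbhs (derivable_cvg (hol_der hh)).
  exact: cvg_comp (coord_dnbhs cc) c1.
apply: (near_cvg_eq _ hc); apply: filterS2 fE (coord_neq cc) => y -> y0 /=.
by rewrite mulrAC -expfzDr// subrr expr0z mul1r.
Qed.

Lemma mero_ord_has f x n : has_ord f x n -> has_ord f x (mero_ord f x).
Proof. by move=> H; exact: (@xgetPex _ 0 [set n | has_ord f x n] (ex_intro _ n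
  H)). Qed.

(** Whichever chart [has_ord] refers to, the order is an exponent in the
    coordinate [F], and such an exponent is unique. *)
Lemma mero_ord_asymp f x F G k n l : is_coord x F G -> has_ord f x k ->
  asymp f x F n l -> mero_ord f x = n.
Proof.
move=> co /mero_ord_has H Hn; have [m Hm] := has_ord_asymp co H.
apply/eqP; rewrite eq_le (asymp_uniq_le co Hn Hm).
by rewrite (asymp_uniq_le co Hm Hn).
Qed.

Lemma mero_ordE f x n : has_ord f x n -> mero_ord f x = n.
Proof.
move=> H; have [c cA xc] := rs_cover x; have co := chart_coord cA xc.
have [l Hl] := has_ord_asymp co H; exact: mero_ord_asymp co H Hl.
Qed.

End Orders.

(** * Meromorphic functions *)

Section Meromorphic.
Variables (R : realType) (M : riemannSurface R).
Local Notation C := (R[i]^o).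
Implicit Types (x y a : M) (c : chart R M) (f g : M -> sphere R).

Lemma sphere_invK : involutive (@sphere_inv R).
Proof.
move=> [u|] /=; last by rewrite eqxx.
by case: eqVneq => [->//|u0]; rewrite /= invr_eq0 (negPf u0) invrK.
Qed.

Definition finpart f : M -> C := fun x => odflt 0 (f x).

Definition mero_inv f : M -> sphere R := fun x => sphere_inv (f x).

Lemma finpartE f x : f x <> None -> f x = Some (finpart f x).
Proof. by rewrite /finpart; case: (f x). Qed.

Lemma hol_near_inv (h : C -> C) (u : C) : holomorphic_near h u -> h u != 0 ->
  holomorphic_near (fun z => (h z)^-1 : C) u.
Proof.
move=> hh hu; have [r r0 dh] := (holP h u).1 hh.
have n0 : 0 < cabs (h u) by rewrite cabs_gt0.
have /cvgCP/(_ _ n0)/nbhsCP[s s0 hs] := derivable_cvg (hol_der hh).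
apply/holP; exists (Num.min r s); first by rewrite lt_min r0.
move=> z; rewrite lt_min => /andP[zr zs]; apply: der_derivable.
apply: derV; last exact: der_derive (dh z zr).
apply/eqP => hz; have /= := hs z zs.
by rewrite hz sub0r cabsN ltxx.
Qed.

Lemma cvg_neq (T : Type) (F : set_system T) {FF : Filter F} (h : T -> C)
  (l k : C) : h @ F --> l -> l != k -> \forall t \near F, h t != k.
Proof.
move=> /cvgCP hl lk; have n0 : 0 < cabs (l - k) by rewrite cabs_gt0 subr_eq0.
apply: filterS (hl _ n0) => t; apply: contraTneq => ->.
by rewrite cabsB ltxx.
Qed.

Lemma sph_hol_some f a u : sphere_holomorphic_at f a -> f a = Some u ->
  (\forall x \near a, f x <> None) /\ holomorphic_at (finpart f) a.
Proof. by rewrite /sphere_holomorphic_at => + fa; rewrite fa. Qed.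

Lemma sph_hol_none f a : sphere_holomorphic_at f a -> f a = None ->
  (\forall x \near a, f x <> Some 0) /\ holomorphic_at (finpart (mero_inv f)) a.
Proof. by rewrite /sphere_holomorphic_at => + fa; rewrite fa. Qed.

(** Inversion exchanges the two cases in the definition of holomorphy, so what
    holds at finite values carries over to poles. *)
Lemma sph_hol_inv f a : sphere_holomorphic_at f a ->
  sphere_holomorphic_at (mero_inv f) a.
Proof.
move=> hf; rewrite /sphere_holomorphic_at.
case fa : (f a) => [u|]; last first.
  have [f0 fh] := sph_hol_none hf fa.
  rewrite {1}/mero_inv fa; split; last exact: fh.
  apply: filterS f0 => x; rewrite /mero_inv; case: (f x) => //= v.
  by case: eqVneq => [->|].
have [f0 fh] := sph_hol_some hf fa.
rewrite {1}/mero_inv fa /=; case: eqVneq => [u0|u0].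
  split.
    apply: filterS f0 => x; rewrite /mero_inv; case: (f x) => //= v _.
    by case: eqVneq => // v0 [] /eqP; rewrite invr_eq0 (negPf v0).
  have -> : (fun x : M => odflt 0 (sphere_inv (mero_inv f x)) : C) = finpart f.
    by apply/funext => x; rewrite /mero_inv sphere_invK.
  exact: fh.
have fu : finpart f a = u by rewrite /finpart fa.
have fn0 : \forall x \near a, finpart f x != 0.
  by apply: (cvg_neq (hol_at_cvg fh)); rewrite fu.
split.
  apply: filterS2 f0 fn0 => x; rewrite /finpart /mero_inv;
    case: (f x) => //= v _.
  by move=> /negPf ->.
move=> c cA ac; have co := chart_coord cA ac.
have h1 := hol_near_inv (co_hol co fh).
rewrite (coordK co) fu in h1; apply: (hol_near_eq _ (h1 u0)).
have H := (coord_near (fun x =>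
  (finpart f x)^-1 = odflt 0 (mero_inv f x)) co).2.
apply: H; apply: filterS2 f0 fn0 => x; rewrite /finpart /mero_inv.
by case: (f x) => //= v _ /negPf ->.
Qed.

Lemma sph_hol_neq f a v : sphere_holomorphic_at f a -> f a <> v ->
  \forall x \near a, f x <> v.
Proof.
have key h u w : sphere_holomorphic_at h a -> h a = Some u -> h a <> w ->
    \forall x \near a, h x <> w.
  move=> hh ha hv; have [h0 hhol] := sph_hol_some hh ha.
  case: w hv => [w|] hv; last exact: h0.
  have hu : finpart h a != w.
    by rewrite /finpart ha; apply: contra_not_neq hv => /= <-.
  apply: filterS (cvg_neq (hol_at_cvg hhol) hu) => x.
  by apply: contra_neq_not; rewrite /finpart => ->.
move=> hf fv; case fa : (f a) => [u|]; first exact: key hf fa fv.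
have H : \forall x \near a, mero_inv f x <> sphere_inv v.
  apply: (key _ 0 _ (sph_hol_inv hf)); first by rewrite /mero_inv fa.
  by move=> /(can_inj sphere_invK).
by apply: filterS H => x; apply: contra_not => fx; rewrite /mero_inv fx.
Qed.

Lemma hol_at_order (h : M -> C) a c : rs_atlas c -> chart_dom c a ->
  holomorphic_at h a -> (\forall x \near a, h x = 0) \/
  exists n (q : C -> C), [/\ holomorphic_near q (c a), q (c a) != 0 &
    \forall x \near a, h x = (c x - c a) ^+ n * q (c x)].
Proof.
move=> cA ac hh; have co := chart_coord cA ac.
case: (hol_order (co_hol co hh)) => [H|[n [q [hq q0 H]]]].
  left; have := near_comp (co_cvg co) H.
  by apply: filterS2 (co_K co) => x ->.
right; exists n, q; split; [exact: hq|exact: q0|].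
have := near_comp (co_cvg co) H.
by apply: filterS2 (co_K co) => x ->.
Qed.

Lemma hol_at_sub (h : M -> C) a (z : C) : holomorphic_at h a ->
  holomorphic_at (fun x => h x - z : C) a.
Proof.
move=> hh c cA ac; have [r r0 dh] := (holP _ _).1 (hh c cA ac).
apply/holP; exists r; first exact: r0.
move=> u ur; exact: der_derivable (derB (der_derive (dh u ur)) (der_cst z u)).
Qed.

Lemma near_nonzero a c n (q : C -> C) : rs_atlas c -> chart_dom c a ->
  holomorphic_near q (c a) -> q (c a) != 0 ->
  \forall x \near a^', (c x - c a) ^+ n * q (c x) != 0.
Proof.
move=> cA ac hq q0; have co := chart_coord cA ac.
have qn : \forall u \near c a, q u != 0.
  exact: cvg_neq (derivable_cvg (hol_der hq)) q0.
have H := nbhs_dnbhs (near_comp (co_cvg co) qn).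
apply: filterS2 (coord_neq co) H => x x0 qx.
by rewrite mulf_neq0// expf_neq0.
Qed.

Lemma sph_hol_dichotomy f a : sphere_holomorphic_at f a ->
  (\forall x \near a, f x = f a) \/ (\forall x \near a^', f x <> f a).
Proof.
have key h u : sphere_holomorphic_at h a -> h a = Some u ->
    (\forall x \near a, h x = h a) \/ (\forall x \near a^', h x <> h a).
  move=> hh ha; have [h0 hhol] := sph_hol_some hh ha.
  have [c cA ac] := rs_cover a.
  case: (hol_at_order cA ac (hol_at_sub u hhol)) => [H|[n [q [hq q0 H]]]].
    left; apply: filterS2 h0 H => x hx /eqP; rewrite subr_eq0 => /eqP E.
    by rewrite (finpartE hx) E ha.
  right; apply: filterS2 (nbhs_dnbhs H) (near_nonzero n cA ac hq q0) => x <-.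
  rewrite subr_eq0 => /eqP xu hx; apply: xu.
  by rewrite /finpart hx ha.
move=> hf; case fa : (f a) => [u|]; first by rewrite -fa; exact: key hf fa.
have ia : mero_inv f a = Some 0 by rewrite /mero_inv fa.
case: (key _ 0 (sph_hol_inv hf) ia) => H; [left|right]; apply: filterS H => x.
  by rewrite -fa => /(can_inj sphere_invK).
by apply: contra_not => fx; rewrite /mero_inv fx fa.
Qed.

Section Nonconstant.
Variable f : M -> sphere R.
Hypotheses (fm : meromorphic f) (fn : nonconstant f).

(** The set of points around which f is constant with value f(a) is open, and
    closed by the dichotomy. On a connected surface it is empty or everything,
    and f is not constant. *)
Lemma mero_isolated a : \forall x \near a^', f x <> f a.
Proof.
have [hf _] := fm.
case: (sph_hol_dichotomy (hf a)) => // fa; exfalso.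
pose D : set M := [set x : M | \forall y \near x, f y = f a].
have oD : open D.
  rewrite openE => x Dx; rewrite /interior /D; exact: near_near Dx.
have cD : closed D.
  rewrite -[D]setCK; apply: open_closedC; rewrite openE => x Dx.
  rewrite /interior.
  have [fx|fx] := pselect (f x = f a); last first.
    apply: filterS (sph_hol_neq (hf x) fx) => y fy Dy.
    exact: fy (nbhs_singleton Dy).
  case: (sph_hol_dichotomy (hf x)) => H.
    by exfalso; apply: Dx; rewrite /D /= -fx.
  have H' : \forall y \near x, y != x -> f y <> f x by [].
  apply: filterS H' => y; have [->|yx] := eqVneq y x; first by move=> _.
  by move=> /(_ isT) + Dy; rewrite fx; apply; exact: nbhs_singleton Dy.
have DT : D = setT.
  apply: (@rs_connected _ M).
  - by exists a.
  - by exists D; rewrite ?setTI.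
  - by exists D; rewrite ?setTI.
have [x [y]] := fn; apply.
have Dx z : f z = f a.
  have : D z by rewrite DT.
  by move=> /nbhs_singleton.
by rewrite !Dx.
Qed.

Lemma mero_isolated_all a v : \forall x \near a^', f x <> v.
Proof.
have [<-|fv] := pselect (f a = v); first exact: mero_isolated.
exact: nbhs_dnbhs (sph_hol_neq (fm.1 a) fv).
Qed.

Lemma mero_inv_mero : meromorphic (mero_inv f).
Proof.
split=> [a|]; first exact: sph_hol_inv (fm.1 a).
have [a [b fab]] := fn.
have [fa|fa] := pselect (mero_inv f a = None); last by exists a.
exists b => fb; apply: fab; apply: (can_inj sphere_invK).
by rewrite -/(mero_inv f a) fa -fb.
Qed.

Lemma mero_inv_nonconst : nonconstant (mero_inv f).
Proof.
have [a [b fab]] := fn; exists a, b => E; apply: fab.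
exact: (can_inj sphere_invK).
Qed.

(** What the value [v] of f at a point says about the order [n] of f - z there:
    pole, zero or neither. *)
Definition ord_sign (v : sphere R) (z : C) (n : int) : bool :=
  match v with
  | None => n < 0
  | Some u => if u == z then 0 < n else n == 0
  end.

(** At a pole, write 1 / f = u ^ n q in a chart; then f - z = u ^ (- n) (1 / q
    - z u ^ n), and the second factor does not vanish at the pole since n > 0.
 *)
Lemma mero_sub_ord z a :
  exists2 n, has_ord (mero_sub f z) a n & ord_sign (f a) z n.
Proof.
have hf := fm.1 a; have [c cA ac] := rs_cover a; have co := chart_coord cA ac.
case fa : (f a) => [v|] /=.
  have [f0 fh] := sph_hol_some hf fa.
  have va : finpart f a = v by rewrite /finpart fa.
  have vz := hol_at_sub z fh.
  have fE : \forall x \near a, mero_sub f z x = Some (finpart f x - z).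
    by apply: filterS f0 => x /finpartE; rewrite /mero_sub => {1}->.
  case: eqVneq => [vE|vz0].
    case: (hol_at_order cA ac vz) => [H|[n [q [hq q0 H]]]].
      have := filter_ex (filterI (nbhs_dnbhs (filterI f0 H)) (mero_isolated a)).
      move=> /(_ (surface_dnbhs_proper a)) [x [[fx fzx]]]; case.
      rewrite (finpartE fx) fa; congr Some; apply/eqP.
      by rewrite -subr_eq0 vE fzx.
    exists n%:Z.
      exists c; split=> //; exists q; split=> //; first by apply/eqP.
      by apply: nbhs_dnbhs; apply: filterS2 fE H => x -> ->.
    rewrite ltz_nat lt0n; apply/eqP => n0; move/eqP: q0; apply.
    have := nbhs_singleton H.
    by rewrite n0 expr0 mul1r va vE subrr => <-.
  exists 0 => //; exists c; split=> //.
  exists (fun u => finpart f (chart_inv c u) - z).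
  split; first exact: (co_hol co vz).
    by apply/eqP; rewrite (coordK co) va subr_eq0.
  apply: nbhs_dnbhs; apply: filterS2 fE (co_K co) => x -> ->.
  by rewrite expr0z mul1r.
have [f0 fh] := sph_hol_none hf fa.
have ia : finpart (mero_inv f) a = 0 by rewrite /finpart /mero_inv fa.
have fx x : f x <> None -> f x <> Some 0 ->
    finpart (mero_inv f) x != 0 /\ f x = Some (finpart (mero_inv f) x)^-1.
  rewrite /finpart /mero_inv; case: (f x) => // u _ u0 /=.
  case: (eqVneq u 0) => [u0'|u0']; first by case: u0; rewrite u0'.
  by rewrite /= invr_eq0 u0' invrK.
case: (hol_at_order cA ac fh) => [H|[n [q [hq q0 H]]]].
  have := filter_ex (filterI (nbhs_dnbhs (filterI f0 H)) (mero_isolated_all a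
    None)).
  move=> /(_ (surface_dnbhs_proper a)) [x [[fx0 fzx] fxN]].
  by have [/eqP] := fx x fxN fx0.
have n0 : (0 < n)%N.
  rewrite lt0n; apply/eqP => n0; move/eqP: q0; apply.
  by have := nbhs_singleton H; rewrite n0 expr0 mul1r ia => <-.
exists (- n%:Z); last by rewrite oppr_lt0 ltz_nat.
exists c; split=> //; exists (fun u => (q u)^-1 - z * (u - c a) ^+ n); split.
- have [r r0 dh] := (holP _ _).1 (hol_near_inv hq q0).
  apply/holP; exists r; first exact: r0.
  move=> u ur; apply: der_derivable; apply: derB;
    first exact: der_derive (dh u ur).
  by apply: derM; apply: derX; exact: der_shift.
- by apply/eqP; rewrite subrr expr0n gtn_eqF// mulr0 subr0 invr_eq0.
have qn : \forall u \near c a, q u != 0.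
  exact: cvg_neq (derivable_cvg (hol_der hq)) q0.
have Q := nbhs_dnbhs (near_comp (co_cvg co) qn).
apply: filterS3 (nbhs_dnbhs (filterI f0 H)) (filterI Q (coord_neq co))
  (mero_isolated_all a None) => x [x0 xH] [xq xc] xN.
have [i0 fE] := fx x xN x0.
rewrite /mero_sub fE /= xH; congr Some.
rewrite -invr_expz -exprnP.
have cn : (c x - c a) ^+ n != 0 by rewrite expf_neq0.
set A := (c x - c a) ^+ n in cn *; set B := q (c x) in xq *.
by field; rewrite xq cn.
Qed.

Lemma mero_ord_sign z a : ord_sign (f a) z (mero_ord (mero_sub f z) a).
Proof. by have [n H s] := mero_sub_ord z a; rewrite (mero_ordE H). Qed.

Lemma mero_sub_has_ord z a : exists k, has_ord (mero_sub f z) a k.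
Proof. by have [n H s] := mero_sub_ord z a; exists n. Qed.

End Nonconstant.

End Meromorphic.

(** * Products over the roots of u ^ m = y *)

Section RootProduct.
Variable R : realType.
Local Notation C := (R[i]^o).
Implicit Types (K : C -> C) (y z eta : C) (m e : nat).

Lemma unity_roots_exist m : (0 < m)%N -> exists U : seq C,
  [/\ uniq U, size U = m & forall u, (u \in U) = (u ^+ m == 1)].
Proof.
move=> m0; have [r Dp] := closed_field_poly_normal ('X^m - 1 : {poly C}).
rewrite (monicP _) ?monicXnsubC // scale1r in Dp.
exists r; split.
- by rewrite -separable_prod_XsubC -Dp separable_Xn_sub_1// pnatr_eq0 -lt0n.
- by apply: succn_inj; rewrite -(size_prod_XsubC r id) -Dp size_XnsubC.
- move=> u; rewrite -root_prod_XsubC -Dp rootE !hornerE subr_eq0.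
  by [].
Qed.

Definition unity_roots m : seq C := xget [::] [set U : seq C |
  [/\ uniq U, size U = m & forall u, (u \in U) = (u ^+ m == 1)]].

Lemma unity_rootsP m : (0 < m)%N -> [/\ uniq (unity_roots m),
  size (unity_roots m) = m &
  forall u, (u \in unity_roots m) = (u ^+ m == 1)].
Proof.
move=> /unity_roots_exist[U HU].
by rewrite /unity_roots; case: xgetP => [V _ //|/(_ U)].
Qed.

Lemma cvg_prod (I : eqType) (T : Type) (F : set_system T) {FF : Filter F}
  (r : seq I) (h : I -> T -> C) (l : I -> C) :
  (forall i, i \in r -> h i @ F --> l i) ->
  (fun t => \prod_(i <- r) h i t : C) @ F --> (\prod_(i <- r) l i : C).
Proof.
elim: r => [|i r IH] H.
  have -> : (fun t => \prod_(i <- [::]) h i t : C) = (fun=> 1).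
    by apply/funext => t; rewrite big_nil.
  by rewrite big_nil; exact: cvg_cst.
have -> : (fun t => \prod_(j <- i :: r) h j t : C) =
    (fun t => h i t * \prod_(j <- r) h j t).
  by apply/funext => t; rewrite big_cons.
rewrite big_cons; apply: cvgC_M; first by apply: H; rewrite mem_head.
by apply: IH => j jr; apply: H; rewrite inE jr orbT.
Qed.

Lemma derivable_prod (I : eqType) (r : seq I) (F : I -> C -> C) (u : C) :
  (forall i, i \in r -> derivable (F i) u 1) ->
  derivable (fun z => \prod_(i <- r) F i z : C) u 1.
Proof.
elim: r => [|i r IH] H.
  under eq_fun do rewrite big_nil; exact: (der_derivable (der_cst 1 u)).
under eq_fun do rewrite big_cons.
have d1 := H i (mem_head _ _).
have d2 : derivable (fun z => \prod_(j <- r) F j z : C) u 1.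
  by apply: IH => j jr; apply: H; rewrite inE jr orbT.
exact: (der_derivable (derM (der_derive d1) (der_derive d2))).
Qed.

Definition root_seq m eta : seq C := [seq eta * u | u <- unity_roots m].

Lemma root_seq_uniq m eta : (0 < m)%N -> eta != 0 -> uniq (root_seq m eta).
Proof.
move=> /unity_rootsP[U1 U2 U3] e0; rewrite map_inj_uniq//.
exact: mulfI.
Qed.

Lemma mem_root_seq m eta z : (0 < m)%N -> eta != 0 ->
  (z \in root_seq m eta) = (z ^+ m == eta ^+ m).
Proof.
move=> /unity_rootsP[U1 U2 U3] e0; apply/mapP/eqP => [[u]|zE].
  by rewrite U3 => /eqP um ->; rewrite exprMn um mulr1.
exists (z / eta); last by rewrite mulrC divfK.
by rewrite U3 expr_div_n zE divff// expf_neq0.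
Qed.

(** The m-th root chosen here is not continuous in [y], but the product does
    not depend on the choice ([root_prodE]). *)
Definition root_prod m K y : C := \prod_(z <- root_seq m (m.-root y)) K z.

Lemma root_neq0 m y : (0 < m)%N -> y != 0 -> (m.-root y : C) != 0.
Proof.
move=> m0; apply: contraNneq => r0.
by rewrite -[y](rootCK m0) r0 expr0n gtn_eqF.
Qed.

Lemma root_prodE m K eta : (0 < m)%N -> eta != 0 ->
  root_prod m K (eta ^+ m) = \prod_(z <- root_seq m eta) K z.
Proof.
move=> m0 e0; have r0 := root_neq0 m0 (expf_neq0 m e0).
apply: perm_big; apply: uniq_perm; rewrite ?root_seq_uniq// => z.
by rewrite !mem_root_seq// rootCK.
Qed.

(** Near y the product can be computed from a holomorphic branch of the root. *)
Lemma derivable_root_prod m K y : (0 < m)%N -> y != 0 ->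
  (forall z, z ^+ m = y -> derivable K z 1) -> derivable (root_prod m K) y 1.
Proof.
move=> m0 y0 dK; have [s hs sE] := local_root m0 y0.
have [U1 U2 U3] := unity_rootsP m0.
have sy : s y ^+ m = y := nbhs_singleton sE.
have dF u : u ^+ m = 1 -> derivable (fun y => K (s y * u) : C) y 1.
  move=> um; have dm : is_derive y 1 (fun y => s y * u : C) ('D_1 s y * u).
    have := derM (der_derive (hol_der hs)) (der_cst u y).
    by rewrite mulr0 add0r mulrC.
  have dK' := der_derive (dK (s y * u) _).
  apply: der_derivable; apply: (der_comp dm); apply: dK'.
  by rewrite exprMn sy um mulr1.
have dP : derivable (fun y => \prod_(u <- unity_roots m) K (s y * u) : C) y 1.
  by apply: derivable_prod => u; rewrite U3 => /eqP; exact: dF.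
apply: der_derivable; apply: (der_near_eq _ (der_derive dP)).
have s0 : \forall z \near y, s z != 0.
  apply: (cvg_neq (derivable_cvg (hol_der hs))).
  by apply: contra_neq y0 => s0; rewrite -sy s0 expr0n gtn_eqF.
apply: filterS2 s0 sE => z z0 zE.
by rewrite -[in RHS]zE root_prodE// /root_seq big_map.
Qed.

Lemma cvg_root m (u : C) : (0 < m)%N -> u ^+ m = 1 ->
  (fun y => m.-root y * u : C) @ (0 : C)^' --> (0 : C)^'.
Proof.
move=> m0 um A /dnbhsCP[r r0 hr]; apply/dnbhsCP.
exists (r ^+ m); first exact: exprn_gt0.
move=> y y0; rewrite subr0 => yr.
have u0 : u != 0 by apply/eqP => u0; move/eqP: um;
  rewrite u0 expr0n gtn_eqF// eq_sym oner_eq0.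
apply: hr; first by rewrite mulf_neq0// root_neq0.
rewrite subr0 -(ltr_pXn2r m0) ?nnegrE ?cabs_ge0 ?ltW//.
by rewrite -cabsX exprMn rootCK// um mulr1.
Qed.

(** Multiply K(u) u ^ e over the roots of u ^ m = y: the factors u multiply to
    y times the product c of the m-th roots of unity, so that the total is
    [root_prod m K y] times (c y) ^ e, and it tends to l ^ m. *)
Lemma cvg_root_prod m e K (l : C) : (0 < m)%N ->
  K z * z ^+ e @[z --> (0 : C)^'] --> l ->
  exists2 k : C, k != 0 & (e = 0%N -> k = 1) /\
    root_prod m K y * y ^+ e @[y --> (0 : C)^'] --> l ^+ m * k.
Proof.
move=> m0 Kl; have [U1 U2 U3] := unity_rootsP m0.
pose c : C := \prod_(u <- unity_roots m) u.
have c0 : c != 0.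
  rewrite /c prodf_seq_neq0; apply/allP => u; rewrite U3 => /eqP um /=.
  by apply/eqP => u0; move/eqP: um; rewrite u0 expr0n gtn_eqF// eq_sym oner_eq0.
exists (c ^+ e)^-1; first by rewrite invr_eq0 expf_neq0.
split; first by move=> ->; rewrite expr0 invr1.
have H u : u \in unity_roots m ->
   (fun y => K (m.-root y * u) * (m.-root y * u) ^+ e : C) @ (0 : C)^' --> l.
  rewrite U3 => /eqP um; exact: cvg_comp (cvg_root m0 um) Kl.
have FF : Filter (0 : C)^' by exact: _.
have Hp := cvg_prod (FF := FF) H.
rewrite big_const_seq count_predT U2 iter_mulr_1 in Hp.
have Hc : (fun _ : C => (c ^+ e)^-1 : C) @ (0 : C)^' --> ((c ^+ e)^-1 : C).
  exact: cvg_cst.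
apply: (near_cvg_eq _ (cvgC_M Hp Hc)).
apply/dnbhsCP; exists 1; first exact: ltr01.
move=> y y0 _.
have -> : \prod_(u <- unity_roots m)
      (K (m.-root y * u) * (m.-root y * u) ^+ e) = root_prod m K y * y ^+ e *
        c ^+ e.
  rewrite big_split /= prodrXl big_split /= -/c.
  rewrite big_const_seq count_predT U2 iter_mulr_1 rootCK//.
  by rewrite exprMn mulrA /root_prod /root_seq big_map.
by rewrite mulfK// expf_neq0.
Qed.

End RootProduct.

(** * Fibres of a meromorphic function *)

Section Local.
Variables (R : realType) (M : riemannSurface R).
Local Notation C := (R[i]^o).
Implicit Types (x y a : M) (c : chart R M) (f g : M -> sphere R).

(** Fibres are discrete, by [mero_isolated_all]. Compactness enters as a
    covering property with respect to the filter of large finite sets: near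
    every point of the surface, the points of the fibre belong to all large
    finite sets. *)
Lemma fiber_finite f v : compact [set: M] -> meromorphic f -> nonconstant f ->
  finite_set [set a | f a = v].
Proof.
move=> cM fm fn.
pose FS (P : set (set M)) := exists2 S0 : set M, finite_set S0 &
  forall S, finite_set S -> S0 `<=` S -> P S.
have FF : Filter FS.
  split.
  - by exists set0.
  - move=> P Q [S1 f1 h1] [S2 f2 h2]; exists (S1 `|` S2).
      by rewrite finite_setU.
    move=> S fS sS; split; first by apply: h1 => // x S1x; apply: sS; left.
    by apply: h2 => // x S2x; apply: sS; right.
  - move=> P Q PQ [S1 f1 h1]; exists S1 => // S fS sS.
    exact: PQ (h1 S fS sS).
have := (@compact_near_coveringP _ [set: M]).1 cM (set M) FS
  (fun S x => f x = v -> S x) FF.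
case=> [x _|S0 fS0 /(_ S0 fS0 (fun _ => id)) H]; last first.
  by apply: sub_finite_set fS0 => a fa; exact: H.
have H : \forall y \near x, y != x -> f y <> v := mero_isolated_all fm fn x v.
exists ([set y | y != x -> f y <> v], [set S | S x]).
  split; first exact: H.
  by exists [set x]; [exact: finite_set1|move=> S _; apply].
move=> [y S] /= [Hy Sx] fy.
by have [->//|yx] := eqVneq y x; case: (Hy yx).
Qed.

(** The coordinate is an m-th root of f - z0, given by [local_power]. *)
Lemma normal_coord f a (z0 : C) : meromorphic f -> nonconstant f ->
  f a = Some z0 -> exists F G m, [/\ (0 < m)%N, F a = 0,
    \forall x \near a, is_coord x F G &
    \forall x \near a, f x = Some (z0 + F x ^+ m)].
Proof.
move=> fm fn fa; have [c cA ac] := rs_cover a; have co := chart_coord cA ac.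
have [f0 fh] := sph_hol_some (fm.1 a) fa.
have hz := co_hol co (hol_at_sub z0 fh).
have ha : finpart f (chart_inv c (c a)) - z0 = 0.
  by rewrite (coordK co) /finpart fa subrr.
have nz : ~ \forall u \near c a, finpart f (chart_inv c u) - z0 = 0.
  move=> H; have H1 := near_comp (co_cvg co) H.
  have := filter_ex (filterI (nbhs_dnbhs (filterI f0 (filterI (co_K co) H1)))
    (mero_isolated fm fn a)).
  move=> /(_ (surface_dnbhs_proper a)) [x [[fx [xK fzx]]]]; case.
  rewrite (finpartE fx) fa; congr Some; apply/eqP.
  by rewrite -subr_eq0 -[x in finpart f x]xK fzx.
have [m [phi [m0 hphi phi0 dphi phiE]]] := local_power hz ha nz.
have [psi [hpsi psi0 psiK psiKK]] := local_inverse hphi dphi.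
have bi : biholomorphic phi psi (c a) by split.
exists (fun y => phi (c y)), (fun u => chart_inv c (psi u)), m; split.
- exact: m0.
- exact: phi0.
- have H1 := near_comp (co_cvg co) (biholomorphic_near bi).
  apply: filterS2 (chart_coord_near cA ac) H1 => x cx bx.
  exact: coord_comp cx bx.
have H1 := near_comp (co_cvg co) phiE.
apply: filterS3 f0 (co_K co) H1 => x fx xK E.
rewrite (finpartE fx) -E xK; congr Some.
by rewrite addrC subrK.
Qed.

Lemma normal_ord0 f a (z0 : C) F G m : meromorphic f -> nonconstant f ->
  F a = 0 -> is_coord a F G ->
    (\forall x \near a, f x = Some (z0 + F x ^+ m)) ->
  mero_ord (mero_sub f z0) a = m.
Proof.
move=> fm fn Fa co fE; have [k Hk] := mero_sub_has_ord fm fn z0 a.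
apply: (mero_ord_asymp (l := 1) co Hk); split.
- exact: oner_neq0.
- by apply: nbhs_dnbhs; apply: filterS fE => x; rewrite /mero_sub => ->.
have H : (fun _ : M => 1 : C) @ a^' --> (1 : C) by exact: cvg_cst.
apply: (near_cvg_eq _ H).
apply: filterS2 (nbhs_dnbhs fE) (coord_neq co) => x fx Fx.
rewrite /mero_sub fx /= [z0 + _]addrC addrK Fa subr0.
rewrite Fa subr0 in Fx.
by rewrite exprnP -expfzDr// subrr expr0z.
Qed.

(** In the normal coordinate f - f(x) is u ^ m - v ^ m, which has a simple zero
    at v when v is not 0. *)
Lemma normal_ord1 f a (z0 : C) F G m : meromorphic f -> nonconstant f ->
  (0 < m)%N -> F a = 0 -> (\forall x \near a, is_coord x F G) ->
  (\forall x \near a, f x = Some (z0 + F x ^+ m)) ->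
  \forall x \near a^', mero_ord (mero_sub f (z0 + F x ^+ m)) x = 1.
Proof.
move=> fm fn m0 Fa co fE.
have coa := nbhs_singleton co.
apply: filterS3 (nbhs_dnbhs co) (nbhs_dnbhs (near_near fE)) (coord_neq coa).
move=> x cx fEx Fx; rewrite Fa subr0 in Fx.
have [k Hk] := mero_sub_has_ord fm fn (z0 + F x ^+ m) x.
pose l : C := m%:R * F x ^+ m.-1.
have l0 : l != 0 by rewrite mulf_neq0 ?expf_neq0// pnatr_eq0 -lt0n.
apply: (mero_ord_asymp (l := l) cx Hk); split.
- exact: l0.
- by apply: nbhs_dnbhs; apply: filterS fEx => y; rewrite /mero_sub => ->.
have /der_quot d := derX m (der_id (F x : C)).
rewrite mulr1 in d.
have d' : (F y ^+ m - F x ^+ m) / (F y - F x) @[y --> x^'] --> l.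
  exact: cvg_comp (coord_dnbhs cx) d.
apply: (near_cvg_eq _ d'); apply: nbhs_dnbhs; apply: filterS fEx => y fy.
rewrite -invr_expz expr1z /mero_sub fy /=.
by congr (_ * _); ring.
Qed.

End Local.

(** * The product of g - w over a fibre of f *)

Section FiberProduct.
Variables (R : realType) (M : riemannSurface R).
Local Notation C := (R[i]^o).
Implicit Types (x y a : M) (c : chart R M) (f g : M -> sphere R).

Definition pole_mult g a : nat :=
  if g a is None then `|mero_ord g a|%N else 0%N.

(** A point [a] over z0 with a coordinate u in which f = z0 + u ^ m, together
    with the behaviour of g - w in that coordinate. *)
Record local_data f g (z0 w : C) a (F : M -> C) (G : C -> M) (m : nat)
  (l : C) : Prop := LocalData {
  ld_pos : (0 < m)%N;
  ld_ord : mero_ord (mero_sub f z0) a = m;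
  ld_coord : is_coord a F G;
  ld_F : F a = 0;
  ld_near : \forall u \near (0 : C),
    F (G u) = u /\ f (G u) = Some (z0 + u ^+ m);
  ld_punct : \forall u \near (0 : C)^',
    derivable (fun u => finpart g (G u) - w : C) u 1 /\
    mero_ord (mero_sub f (z0 + u ^+ m)) (G u) = 1;
  ld_lim : (finpart g (G u) - w) * u ^+ pole_mult g a @[u --> (0 : C)^'] --> l;
  ld_neq : g a <> Some w -> l != 0;
  ld_val : g a <> None -> l = finpart g a - w }.

Lemma mero_sub0 g : mero_sub g 0 = g.
Proof.
apply/funext => x; rewrite /mero_sub; case: (g x) => //= u.
by rewrite subr0.
Qed.

Lemma mero_ord_sign0 g a : meromorphic g -> nonconstant g ->
  ord_sign (g a) 0 (mero_ord g a).
Proof. by move=> gm gn; rewrite -{2}(mero_sub0 g) mero_ord_sign. Qed.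

Lemma local_data_exists f g (z0 w : C) a : meromorphic f -> nonconstant f ->
  meromorphic g -> nonconstant g -> f a = Some z0 ->
  exists F G m l, local_data f g z0 w a F G m l.
Proof.
move=> fm fn gm gn fa.
have [F [G [m [m0 Fa co fE]]]] := normal_coord fm fn fa.
have coa := nbhs_singleton co.
have nearG (P : C -> Prop) : (\forall u \near F a, P u) ->
  \forall u \near (0 : C), P u.
  by rewrite Fa.
have nearG' (P : C -> Prop) :
    (\forall u \near (F a)^', P u) -> \forall u \near (0 : C)^', P u.
  by rewrite Fa.
have N1 : \forall u \near (0 : C), F (G u) = u /\ f (G u) = Some (z0 + u ^+ m).
  apply: nearG; have H := (coord_near _ coa).2 fE.
  by apply: filterS2 H (co_invK coa) => u fu uK; rewrite fu uK.
have N2 : \forall u \near (0 : C)^',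
    derivable (fun u => finpart g (G u) - w : C) u 1 /\
    mero_ord (mero_sub f (z0 + u ^+ m)) (G u) = 1.
  apply: nearG'.
  have H1 : \forall x \near a^',
    derivable (fun u => finpart g (G u) - w : C) (F x) 1.
    apply: filterS2 (nbhs_dnbhs co) (mero_isolated_all gm gn a None) => x cx gx.
    have [_ gh] := sph_hol_some (gm.1 x) (finpartE gx).
    have := co_hol cx gh => /hol_der dg.
    exact: der_derivable (derB (der_derive dg) (der_cst w _)).
  have H2 := normal_ord1 fm fn m0 Fa co fE.
  have H3 := (coord_near_dnbhs _ coa).2 H1.
  have H4 := (coord_near_dnbhs _ coa).2 H2.
  apply: filterS3 H3 H4 (nbhs_dnbhs (co_invK coa)) => u d o uK.
  by rewrite uK in d o.
have ord0 := normal_ord0 fm fn Fa coa fE.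
case ga : (g a) => [v|].
  have [_ gh] := sph_hol_some (gm.1 a) ga.
  exists F, G, m, (finpart g a - w); apply: (LocalData m0 ord0 coa Fa N1 N2).
  - rewrite /pole_mult ga.
    have hg := hol_at_sub w gh.
    have := cvg_dnbhs (derivable_cvg (hol_der (co_hol coa hg))).
    rewrite (coordK coa) Fa => H.
    have -> : (fun u => (finpart g (G u) - w) * u ^+ 0 : C) =
      (fun u => finpart g (G u) - w) by apply/funext => u; rewrite expr0 mulr1.
    exact: H.
  - rewrite ga /finpart ga /= subr_eq0 => vw; apply/eqP => E; apply: vw.
    by rewrite E.
  - by [].
have s := mero_ord_sign0 a gm gn; rewrite ga /= in s.
have [k Hk] := mero_sub_has_ord gm gn 0 a; rewrite mero_sub0 in Hk.
have [l [l0 _ gl]] := has_ord_asymp coa (mero_ord_has Hk).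
have [e ee] : exists e, `|mero_ord g a|%N = e by eexists.
have eE : - mero_ord g a = e%:Z by rewrite -ee ltz0_abs.
have e0 : (0 < e)%N by rewrite -ee absz_gt0 lt_eqF.
exists F, G, m, l; apply: (LocalData m0 ord0 coa Fa N1 N2); first last.
- by rewrite ga.
- by move=> _; exact: l0.
rewrite /pole_mult ga ee.
have H1 : (finpart g (G u) : C) * u ^+ e @[u --> (0 : C)^'] --> l.
  have H : (finpart g (G u) : C) * (F (G u) - F a) ^ (- mero_ord g a)
     @[u --> (F a)^'] --> l by exact: cvg_comp (coord_inv_dnbhs coa) gl.
  rewrite eE Fa in H; apply: (near_cvg_eq _ H).
  apply: nbhs_dnbhs; apply: filterS N1 => u [uK _].
  by rewrite uK subr0 -exprnP.
have H2 : (- w * u ^+ e : C) @[u --> (0 : C)^'] --> (- w * 0 ^+ e : C).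
  have Hw : (fun _ : C => - w : C) @ (0 : C)^' --> (- w : C) by exact: cvg_cst.
  have Hu : (fun u : C => u) @ (0 : C)^' --> (0 : C).
    by move=> A HA; exact: nbhs_dnbhs.
  have Hue : (fun u : C => u ^+ e : C) @ (0 : C)^' --> (0 ^+ e : C).
    by apply: cvg_expn; exact: Hu.
  by apply: cvgC_M; [exact: Hw|exact: Hue].
have lE : l + - w * 0 ^+ e = l by rewrite expr0n gtn_eqF// mulr0 addr0.
rewrite -lE; apply: (near_cvg_eq _ (cvgC_D H1 H2)).
apply: nbhs_dnbhs; apply: near_all => u /=.
by rewrite mulrBl mulNr.
Qed.

End FiberProduct.

Section FiberProduct.
Variables (R : realType) (M : riemannSurface R).
Local Notation C := (R[i]^o).
Implicit Types (x y a : M) (c : chart R M) (f g : M -> sphere R).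

Lemma common_radius (T : eqType) (A : seq T) (P : T -> R -> Prop) :
  (forall i r s, P i r -> 0 < s -> s <= r -> P i s) ->
  (forall i, i \in A -> exists2 r, 0 < r & P i r) ->
  exists2 r : R, 0 < r & forall i, i \in A -> P i r.
Proof.
move=> mono; elim: A => [|i A IH] H; first by exists 1.
have [r r0 Pr] := H i (mem_head _ _).
have [|s s0 Ps] := IH.
  by move=> b bA; apply: H; rewrite inE bA orbT.
have m0 : 0 < Num.min r s by rewrite lt_min r0.
exists (Num.min r s) => // b; rewrite inE => /orP[/eqP ->|bA].
  by apply: mono Pr m0 _; rewrite ge_min lexx.
by apply: (mono _ _ _ (Ps b bA) m0); rewrite ge_min lexx orbT.
Qed.

(** The contribution of the zeros of f - z to the resultant of f - z and g - w.
    It is meaningful when g has no pole over z. *)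
Definition fiber_prod f g (w z : C) : C :=
  \big[*%R/1]_(a \in [set a | f a = Some z])
    (finpart g a - w) ^+ `|mero_ord (mero_sub f z) a|%N.

Lemma sphere_apart f x (z0 : C) : meromorphic f -> f x <> Some z0 ->
  \forall y \near x & z \near z0, f y <> Some z.
Proof.
move=> fm fx; case fE : (f x) => [v|].
  have [f0 fh] := sph_hol_some (fm.1 x) fE.
  have vz : v != z0 by apply/eqP => vz; apply: fx; rewrite fE vz.
  have d0 : 0 < cabs (v - z0 : C) / 2 by rewrite divr_gt0// cabs_gt0 subr_eq0.
  have /cvgCP/(_ _ d0) H := hol_at_cvg fh.
  have Hz : \forall z \near z0, cabs (z - z0) < cabs (v - z0 : C) / 2.
    by apply/nbhsCP; exists (cabs (v - z0 : C) / 2).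
  exists ([set y | cabs (finpart f y - finpart f x) < cabs (v - z0 : C) / 2],
          [set z : C | cabs (z - z0) < cabs (v - z0 : C) / 2]).
    by split; [exact: H|exact: Hz].
  move=> [y z] /= [yv zz] fy; move: yv; rewrite /finpart fy fE /=.
  have := cabsD (v - z : C) (z - z0).
  have -> : v - z + (z - z0) = v - z0 :> C by ring.
  rewrite cabsB; move: zz; lra.
have [f0 fh] := sph_hol_none (fm.1 x) fE.
have B0 : 0 < (cabs z0 + 1)^-1 by rewrite invr_gt0 ltr_wpDl// cabs_ge0.
have /cvgCP/(_ _ B0) H := hol_at_cvg fh.
have Hz : \forall z \near z0, cabs (z - z0) < 1.
  by apply/nbhsCP; exists 1; [exact: ltr01|].
exists ([set y | f y <> Some 0 /\ cabs (finpart (mero_inv f) y -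
    finpart (mero_inv f) x) < (cabs z0 + 1)^-1],
      [set z : C | cabs (z - z0) < 1]).
  by split; [exact: filterI f0 H|exact: Hz].
move=> [y z] /= [[y0 yv] zz] fy; move: yv;
  rewrite /finpart /mero_inv fy fE /= subr0.
have z0' : z != 0 by apply/eqP => z0'; apply: y0; rewrite fy z0'.
rewrite (negPf z0') /= cabsV ltf_pV2 ?posrE ?cabs_gt0//; last first.
  by rewrite ltr_wpDl// cabs_ge0.
have := cabs_le_sub z z0; lra.
Qed.

Section AtValue.
Variables (f g : M -> sphere R) (z0 w : C) (A : seq M).
Hypotheses (cM : compact [set: M]) (fm : meromorphic f) (fn : nonconstant f).
Hypotheses (gm : meromorphic g) (gn : nonconstant g).
Hypotheses (uA : uniq A) (AP : forall a, (a \in A) <-> f a = Some z0).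

(** The points over z close to z0 are those with u ^ m = z - z0 in the
    coordinates around the points over z0. By compactness there are no others,
    the coordinate neighbourhoods may be taken disjoint, and all these points
    are simple by [normal_ord1]. *)
Lemma fiber_local_structure :
  exists (G : M -> C -> M) (m : M -> nat) (l : M -> C),
  (forall a, a \in A -> [/\ (0 < m a)%N, mero_ord (mero_sub f z0) a = m a,
    (finpart g (G a u) - w) * u ^+ pole_mult g a @[u --> (0 : C)^'] --> l a,
    g a <> Some w -> l a != 0 &
    g a <> None -> l a = finpart g a - w]) /\
  \forall z \near z0^',
    (forall a u, a \in A -> u ^+ m a = z - z0 ->
      derivable (fun u => finpart g (G a u) - w : C) u 1) /\
    fiber_prod f g w z = \prod_(a <- A)
      root_prod (m a) (fun u => finpart g (G a u) - w) (z - z0).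
Proof.
have [D HD] : {D : M -> (M -> C) * (C ->
  M) * nat * C & forall a, f a = Some z0 ->
    local_data f g z0 w a (D a).1.1.1 (D a).1.1.2 (D a).1.2 (D a).2}.
  apply: (@choice _ _ (fun a D => f a = Some z0 ->
    local_data f g z0 w a D.1.1.1 D.1.1.2 D.1.2 D.2)) => a.
  have [fa|nfa] := pselect (f a = Some z0).
    have [F [G [m [l H]]]] := local_data_exists w fm fn gm gn fa.
    by exists (F, G, m, l).
  by exists (fun=> 0, fun=> a, 0%N, 0).
pose F a := (D a).1.1.1; pose G a := (D a).1.1.2.
pose m a := (D a).1.2; pose l a := (D a).2.
have {}HD a : a \in A -> local_data f g z0 w a (F a) (G a) (m a) (l a).
  by move=> /AP; exact: HD.
exists G, m, l; split.
  move=> a /HD H; split; [exact: ld_pos H|exact: ld_ord H|exact: ld_lim H|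
    exact: ld_neq H|exact: ld_val H].
(* The sizes of the coordinate discs on which [local_data] applies and, in P3,
   the discs of two different points are disjoint. *)
pose P1 a (r : R) := forall u : C, cabs u < r ->
  F a (G a u) = u /\ f (G a u) = Some (z0 + u ^+ m a).
pose P2 a (r : R) := forall u : C, u != 0 -> cabs u < r ->
  derivable (fun u => finpart g (G a u) - w : C) u 1 /\
  mero_ord (mero_sub f (z0 + u ^+ m a)) (G a u) = 1.
pose P3 (p : M * M) (r : R) := p.1 != p.2 ->
  forall u v : C, cabs u < r -> cabs v < r -> G p.1 u != G p.2 v.
have [r1 r10 h1] : exists2 r : R, 0 < r & forall a, a \in A -> P1 a r.
  apply: common_radius => [a r s H s0 sr u us|a aA].
    exact: H (lt_le_trans us sr).
  have /nbhsCP[r r0 hr] := ld_near (HD a aA).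
  exists r; first exact: r0.
  by move=> u ur; apply: hr; rewrite subr0.
have [r2 r20 h2] : exists2 r : R, 0 < r & forall a, a \in A -> P2 a r.
  apply: common_radius => [a r s H s0 sr u u0 us|a aA].
    exact: H u0 (lt_le_trans us sr).
  have /dnbhsCP[r r0 hr] := ld_punct (HD a aA).
  exists r; first exact: r0.
  by move=> u u0 ur; apply: hr; rewrite ?subr0.
have Gcvg a : a \in A -> G a u @[u --> (0 : C)] --> a.
  by move=> aA; have := co_inv_cvg (ld_coord (HD a aA));
    rewrite (ld_F (HD a aA)).
have [r3 r30 h3] : exists2 r : R, 0 < r &
    forall p, p \in [seq (a, b) | a <- A, b <- A] -> P3 p r.
  apply: common_radius => [p r s H s0 sr pp u v us vs|p].
    exact: H pp _ _ (lt_le_trans us sr) (lt_le_trans vs sr).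
  move=> /allpairsP[[a b] /= [aA bA ->]].
  have [->|ab] := eqVneq a b; first by exists 1 => //; rewrite /P3 eqxx.
  have hM := @rs_hausdorff _ M; rewrite open_hausdorff in hM.
  have [[U V] /= [aU bV] [oU oV /eqP UV]] := hM a b ab.
  rewrite !inE in aU bV.
  have HU : nbhs a U by apply: open_nbhs_nbhs.
  have HV : nbhs b V by apply: open_nbhs_nbhs.
  have /nbhsCP[r r0 hr] := near_comp (Gcvg a aA) HU.
  have /nbhsCP[s s0 hs] := near_comp (Gcvg b bA) HV.
  exists (Num.min r s); first by rewrite lt_min r0.
  move=> _ u v; rewrite !lt_min /= => /andP[ur _] /andP[_ vs].
  apply/eqP => E; suff : (U `&` V) (G a u) by rewrite UV.
  by split; [apply: hr; rewrite subr0|rewrite E; apply: hs; rewrite subr0].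
pose r := Num.min (Num.min r1 r2) r3.
have r0 : 0 < r by rewrite !lt_min r10 r20.
have rr (u : C) : cabs u < r -> [/\ cabs u < r1, cabs u < r2 & cabs u < r3].
  by rewrite !lt_min => /andP[/andP[]].
have [r4 r40 h4] : exists2 s : R, 0 < s & forall a, a \in A -> s <= r ^+ m a.
  apply: (@common_radius _ A (fun a s => s <= r ^+ m a)) =>
    [a s t st _ ts|a aA].
    exact: le_trans ts st.
  by exists (r ^+ m a) => //; rewrite exprn_gt0.
(* No point over z is far from all points over z0. *)
have cover : \forall z \near z0, forall x, f x = Some z ->
    exists a u, [/\ a \in A, cabs u < r & x = G a u].
  have := (@compact_near_coveringP _ [set: M]).1 cM _ (nbhs z0)
    (fun z x => f x = Some z ->
      exists a u, [/\ a \in A, cabs u < r & x = G a u]) _.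
  move=> /(_ _) H; have : \forall z \near z0,
    [set: M] `<=` (fun x => f x = Some z ->
      exists a u, [/\ a \in A, cabs u < r & x = G a u]).
    apply: H => x _.
    have [fx|fx] := pselect (f x = Some z0); last first.
      by apply: filterS (sphere_apart fm fx) => -[y z] /= yz /yz.
    have xA : x \in A by apply/AP.
    have co := ld_coord (HD x xA).
    have H1 : \forall y \near x, cabs (F x y) < r.
      have /cvgCP/(_ r r0) := co_cvg co; rewrite (ld_F (HD x xA)).
      by apply: filterS => y; rewrite subr0.
    exists ([set y | G x (F x y) = y /\ cabs (F x y) < r], setT).
      by split; [exact: filterI (co_K co) H1|exact: filterT].
    move=> [y z] /= [[yK yr] _] _.
    by exists x, (F x y).
  by apply: filterS => z Hz x; exact: Hz.
have /nbhsCP[d d0 hd] := cover.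
apply/dnbhsCP; exists (Num.min d r4); first by rewrite lt_min d0.
move=> z zz0; rewrite lt_min => /andP[zd z4]; have cz := hd z zd.
have y0 : z - z0 != 0 by rewrite subr_eq0.
have small a u : a \in A -> u ^+ m a = z - z0 -> cabs u < r /\ u != 0.
  move=> aA uE; have m0 := ld_pos (HD a aA); split.
    rewrite -(ltr_pXn2r m0) ?nnegrE ?cabs_ge0 ?(ltW r0)//.
    by rewrite -cabsX uE (lt_le_trans z4)// h4.
  by apply: contraNneq y0 => u0; rewrite -uE u0 expr0n gtn_eqF.
split.
  move=> a u aA uE; have [ur u0] := small a u aA uE; have [_ u2 _] := rr u ur.
  by have [] := h2 a aA u u0 u2.
pose rt a : C := (m a).-root (z - z0).
have rt0 a : a \in A -> rt a != 0.
  by move=> aA; apply: root_neq0 => //; exact: ld_pos (HD a aA).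
have rtE a : a \in A -> rt a ^+ m a = z - z0.
  by move=> aA; apply: rootCK; exact: ld_pos (HD a aA).
(* The fibre over z, without repetition. *)
pose L := [seq G a u | a <- A, u <- root_seq (m a) (rt a)].
have memL a u : a \in A -> (u \in root_seq (m a) (rt a)) = (u ^+ m a == z - z0).
  move=> aA; rewrite mem_root_seq ?rt0 ?rtE//.
  exact: ld_pos (HD a aA).
have uL : uniq L.
  apply: allpairs_uniq_dep => //.
    by move=> a aA; apply: root_seq_uniq; [exact: ld_pos (HD a aA)|exact: rt0].
  move=> p q /allpairsPdep[a [u [aA uR ->]]] /allpairsPdep[b [v [bA vR ->]]]
    /= E.
  move: uR vR; rewrite !memL// => /eqP uE /eqP vE.
  have [ur _] := small a u aA uE; have [vr _] := small b v bA vE.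
  have [u1 _ u3] := rr u ur; have [v1 _ v3] := rr v vr.
  have ab : a = b.
    apply/eqP; apply: contraT => ab.
    have pA : (a, b) \in [seq (a, b) | a <- A, b <- A] by apply/allpairsP;
      exists (a, b).
    by have /eqP := h3 _ pA ab u v u3 v3.
  rewrite -ab in E v1 *.
  by have [<- _] := h1 a aA u u1; have [<- _] := h1 a aA v v1; rewrite E.
have LP x : (x \in L) <-> f x = Some z.
  split=> [/allpairsPdep[a [u [aA]]]|fx].
    rewrite memL// => /eqP uE ->.
    have [ur _] := small a u aA uE; have [u1 _ _] := rr u ur.
    by have [_ ->] := h1 a aA u u1; rewrite uE addrC subrK.
  have [a [u [aA ur xE]]] := cz x fx; have [u1 _ _] := rr u ur.
  apply/allpairsPdep; exists a, u; split=> //.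
  rewrite memL//; have [_] := h1 a aA u u1.
  by rewrite -xE fx => -[->]; rewrite [z0 + _]addrC addrK.
have -> : fiber_prod f g w z =
    \prod_(x <- L) (finpart g x - w) ^+ `|mero_ord (mero_sub f z) x|%N.
  rewrite /fiber_prod [RHS]fsbig_seq//.
  have -> // : [set x | f x = Some z] = [set` L].
  by apply/seteqP; split => x /=; rewrite LP.
rewrite /L big_allpairs_dep; apply: eq_big_seq => a aA.
rewrite /root_prod -/(rt a); apply: eq_big_seq => u; rewrite memL// => /eqP uE.
have [ur u0] := small a u aA uE; have [_ u2 _] := rr u ur.
have [_] := h2 a aA u u0 u2.
by rewrite uE addrC subrK => ->; rewrite expr1.
Qed.

End AtValue.
End FiberProduct.

Section Numerator.
Variables (R : realType) (M : riemannSurface R).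
Local Notation C := (R[i]^o).
Implicit Types (x y a : M) (c : chart R M) (f g : M -> sphere R).

Definition fiber_seq f (v : sphere R) : seq M :=
  finmap.enum_fset (fset_set [set a | f a = v]).

Lemma fiber_seq_uniq f v : uniq (fiber_seq f v).
Proof. exact: finmap.fset_uniq. Qed.

Lemma cvg_shift0 (z0 : C) : (fun z : C => z - z0 : C) @ z0^' --> (0 : C)^'.
Proof.
move=> A /dnbhsCP[r r0 hr]; apply/dnbhsCP; exists r; first exact: r0.
move=> z zz0 zr; apply: hr; first by rewrite subr_eq0.
by rewrite subr0.
Qed.

Section TwoFunctions.
Variables (f g : M -> sphere R).
Hypotheses (cM : compact [set: M]) (fm : meromorphic f) (fn : nonconstant f).
Hypotheses (gm : meromorphic g) (gn : nonconstant g).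

Lemma mem_fiber_seq v a : (a \in fiber_seq f v) <-> f a = v.
Proof.
rewrite /fiber_seq in_fset_set; last exact: fiber_finite.
by rewrite inE.
Qed.

Let A z0 := fiber_seq f (Some z0).
Let AP (z0 : C) a : (a \in A z0) <-> f a = Some z0.
Proof. exact: mem_fiber_seq. Qed.

Lemma fiber_prodE (w z : C) : fiber_prod f g w z =
  \prod_(a <- A z) (finpart g a - w) ^+ `|mero_ord (mero_sub f z) a|%N.
Proof. by rewrite /fiber_prod fsbig_finite//; exact: fiber_finite. Qed.

Lemma fiber_prod_derivable (w z0 : C) :
  \forall z \near z0^', derivable (fiber_prod f g w) z 1.
Proof.
have [G [m [l [HA H]]]] := fiber_local_structure w cM fm fn gm gn
  (fiber_seq_uniq f (Some z0)) (AP z0).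
have /dnbhsCP[r r0 hr] := H.
apply/dnbhsCP; exists r; first exact: r0.
move=> z zz0 zr; have [dK _] := hr z zz0 zr.
have y0 : z - z0 != 0 by rewrite subr_eq0.
have dP : derivable (fun z => \prod_(a <- A z0)
    root_prod (m a) (fun u => finpart g (G a u) - w) (z - z0) : C) z 1.
  apply: derivable_prod => a aA; have [m0 _ _ _ _] := HA a aA.
  have dR : derivable (root_prod (m a) (fun u =>
    finpart g (G a u) - w)) (z - z0) 1.
    by apply: derivable_root_prod => // u uE; exact: dK.
  exact: der_derivable (der_comp (der_shift z0 z) (der_derive dR)).
apply: der_derivable; apply: (der_near_eq _ (der_derive dP)).
have s0 : 0 < Num.min (r - cabs (z - z0)) (cabs (z - z0)).
  by rewrite lt_min subr_gt0 zr cabs_gt0.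
apply/nbhsCP; exists (Num.min (r - cabs (z - z0)) (cabs (z - z0)));
  first exact: s0.
move=> y; rewrite lt_min => /andP[y1 y2].
have yz0 : y != z0 by apply/eqP => yz; move: y2; rewrite yz cabsB ltxx.
have yr : cabs (y - z0) < r.
  have -> : y - z0 = (y - z) + (z - z0) by ring.
  by rewrite (le_lt_trans (cabsD _ _))//; lra.
by have [_ ->] := hr y yz0 yr.
Qed.

(** At a pole of g of order e, where f has multiplicity m, the m points over z
    near it contribute one factor u ^ (- e) each. Since u ^ m = z - z0, this
    amounts to (z - z0) ^ (- e), independently of m. *)
Lemma fiber_prod_lim (w z0 : C) : exists l : C,
  [/\ fiber_prod f g w z * (z - z0) ^+ (\sum_(a <- A z0) pole_mult g a)
        @[z --> z0^'] --> l,
    (forall a, f a = Some z0 -> g a <> Some w) -> l != 0 &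
    (forall a, f a = Some z0 -> g a <> None) -> l = fiber_prod f g w z0].
Proof.
have [G [m [l [HA H]]]] := fiber_local_structure w cM fm fn gm gn
  (fiber_seq_uniq f (Some z0)) (AP z0).
have [k Hk] : {k : M -> C & forall a, a \in A z0 -> [/\ k a != 0,
    pole_mult g a = 0%N -> k a = 1 &
    root_prod (m a) (fun u => finpart g (G a u) - w) y * y ^+ pole_mult g a
      @[y --> (0 : C)^'] --> l a ^+ m a * k a]}.
  apply: (@choice _ _ (fun a k => a \in A z0 -> [/\ k != 0,
    pole_mult g a = 0%N -> k = 1 &
    root_prod (m a) (fun u => finpart g (G a u) - w) y * y ^+ pole_mult g a
      @[y --> (0 : C)^'] --> l a ^+ m a * k])) => a.
  case aA : (a \in A z0); last by exists 0.
  have [m0 _ al _ _] := HA a aA.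
  by have [k k0 [ke kl]] := cvg_root_prod m0 al; exists k.
exists (\prod_(a <- A z0) (l a ^+ m a * k a)); split.
- have Hp : (fun z => \prod_(a <- A z0)
      (root_prod (m a) (fun u => finpart g (G a u) - w) (z - z0) *
       (z - z0) ^+ pole_mult g a) : C) @ z0^' -->
      (\prod_(a <- A z0) (l a ^+ m a * k a) : C).
    apply: cvg_prod => a aA; have [_ _ ka] := Hk a aA.
    exact: cvg_comp (@cvg_shift0 z0) ka.
  apply: (near_cvg_eq _ Hp); apply: filterS H => z [_ ->].
  by rewrite big_split /= prodrXr.
- move=> gw; rewrite prodf_seq_neq0; apply/allP => a aA /=.
  have [m0 _ _ l0 _] := HA a aA; have [k0 _ _] := Hk a aA.
  by rewrite mulf_neq0// expf_neq0// l0//; apply: gw; apply/AP.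
- move=> gN; rewrite fiber_prodE; apply: eq_big_seq => a aA.
  have [m0 mE _ _ lE] := HA a aA; have [_ k1 _] := Hk a aA.
  have ga : g a <> None by apply: gN; apply/AP.
  rewrite lE// k1; last by rewrite /pole_mult; case: (g a) ga.
  by rewrite mulr1 mE.
Qed.

(** This brings the behaviour of the product for z near infinity to that near
    0, with 1 / f in place of f. *)
Lemma fiber_prod_inv (w z : C) : z != 0 ->
  fiber_prod f g w z = fiber_prod (mero_inv f) g w z^-1.
Proof.
move=> z0; rewrite /fiber_prod.
have -> : [set a | mero_inv f a = Some z^-1] = [set a | f a = Some z].
  apply/seteqP; split => a /=; rewrite /mero_inv; last by move=> ->;
    rewrite /= (negPf z0).
  move=> E; apply: (can_inj (@sphere_invK R)); rewrite E /=.
  by rewrite (negPf z0).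
apply: eq_fsbigr => a; rewrite inE /= => fa; congr (_ ^+ `|_|%N).
have [c cA ac] := rs_cover a; have co := chart_coord cA ac.
have [n Hn] := mero_sub_has_ord fm fn z a.
have [k Hk] := mero_sub_has_ord (mero_inv_mero fm fn) (mero_inv_nonconst fn)
  z^-1 a.
have [l [l0 _ fl]] := has_ord_asymp co Hn.
rewrite (mero_ordE Hn); apply/esym.
have [f0 fh] := sph_hol_some (fm.1 a) fa.
have cf := hol_at_cvg fh; rewrite {2}/finpart fa /= in cf.
have fne : \forall x \near a, finpart f x != 0 by exact: cvg_neq cf z0.
have iE : \forall x \near a, mero_inv f x = Some (finpart f x)^-1.
  apply: filterS2 f0 fne => x; rewrite /mero_inv /finpart.
  by case: (f x) => //= u _ /negPf ->.
have li : - (z * z)^-1 != 0 by rewrite oppr_eq0 invr_eq0 mulf_neq0.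
apply: (mero_ord_asymp (l := l * - (z * z)^-1) co Hk); split.
- by rewrite mulf_neq0.
- by apply: nbhs_dnbhs; apply: filterS iE => x; rewrite /mero_sub => ->.
have c1 : (fun x => - (z * finpart f x)^-1 : C) @ a^' --> (- (z * z)^-1 : C).
  have cz : (fun _ : M => z) @ a^' --> z by exact: cvg_cst.
  have cf' : (fun x => finpart f x) @ a^' --> z.
    by move=> B /cf; exact: nbhs_dnbhs.
  have cm := cvgC_V (mulf_neq0 z0 z0) (cvgC_M cz cf').
  have -> : - (z * z)^-1 = -1 * (z * z)^-1 by rewrite mulN1r.
  have -> : (fun x => - (z * finpart f x)^-1 : C) =
    (fun x => -1 * (z * finpart f x)^-1) by apply/funext => x; rewrite mulN1r.
  have c1 : (fun _ : M => -1 : C) @ a^' --> (-1 : C) by exact: cvg_cst.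
  by apply: cvgC_M; [exact: c1|exact: cm].
apply: (near_cvg_eq _ (cvgC_M fl c1)).
apply: nbhs_dnbhs; apply: filterS3 f0 fne iE => x fx fx0 ix.
rewrite /mero_sub ix (finpartE fx) /=.
rewrite mulrAC; congr (_ * _).
by field; rewrite fx0 z0.
Qed.

End TwoFunctions.
End Numerator.

(** * The numerator of the elimination function *)

Section PolyAux.
Variable R : realType.
Local Notation C := (R[i]^o).

Lemma poly_growth (q : {poly R[i]}) : exists K : R, forall z : C, 1 <= cabs z ->
  cabs (q.[z] : C) <= K * cabs z ^+ size q.
Proof.
exists (\sum_(i < size q) cabs (q`_i : C)) => z z1.
rewrite horner_coef (le_trans (cabs_sum _ _ _))// mulr_suml ler_sum// => i _.
rewrite cabsM cabsX ler_wpM2l ?cabs_ge0// ler_weXn2l// ltnW//.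
Qed.

Lemma poly_cvg (q : {poly R[i]}) (z0 : C) :
  (fun z : C => q.[z] : C) @ z0^' --> (q.[z0] : C).
Proof. exact: cvg_dnbhs (derivable_cvg (der_derivable (der_horner q z0))). Qed.

Definition lagrange_poly (F : fieldType) (s : seq F) (x : F) : {poly F} :=
  \prod_(y <- s | y != x) ((x - y)^-1 *: ('X - y%:P)).

Lemma lagrange_interpolation (F : fieldType) (s : seq F) (q : {poly F}) :
  uniq s -> (size q <= size s)%N ->
  q = \sum_(x <- s) q.[x] *: lagrange_poly s x.
Proof.
move=> us qs.
have lagE x y : x \in s -> y \in s -> (lagrange_poly s x).[y] = (x == y)%:R.
  move=> xs ys; rewrite horner_prod; case: (eqVneq x y) => [<-|xy].
    rewrite big1_seq// => t /andP[tx _].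
    by rewrite hornerZ hornerXsubC mulVf// subr_eq0 eq_sym.
  apply/eqP; rewrite prodf_seq_eq0; apply/hasP; exists y => //.
  by rewrite hornerZ hornerXsubC subrr mulr0 eqxx andbT eq_sym.
have sz x : x \in s -> (size (lagrange_poly s x) <= size s)%N.
  move=> xs; rewrite /lagrange_poly scaler_prod (leq_trans (size_scale_leq _
    _))//.
  rewrite -big_filter size_prod_XsubC size_filter.
  rewrite -(count_predC (pred1 x)) count_uniq_mem// xs add1n.
  by rewrite ltnS; apply: eq_leq; apply: eq_count.
apply/eqP; rewrite -subr_eq0; apply/eqP.
apply: (@roots_geq_poly_eq0 _ _ s) => //; last first.
  rewrite (leq_trans (size_polyD _ _))// geq_max qs size_polyN.
  rewrite (leq_trans (size_sum _ _ _))//; apply/bigmax_leqP_seq => x xs _.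
  by rewrite (leq_trans (size_scale_leq _ _))// sz.
apply/allP => y ys; rewrite rootE hornerD hornerN horner_sum subr_eq0.
rewrite (bigD1_seq y)//= hornerZ lagE// eqxx mulr1 big1_seq ?addr0//.
by move=> x /andP[xy xs]; rewrite hornerZ lagE// (negPf xy) mulr0.
Qed.

Lemma many_nonroots (P : {poly R[i]}) n : P != 0 -> exists s : seq R[i],
  [/\ uniq s, (n <= size s)%N & forall x, x \in s -> P.[x] != 0].
Proof.
move=> P0; pose t := [seq i%:R : R[i] | i <- iota 0 (size P + n)].
have ut : uniq t.
  rewrite map_inj_uniq ?iota_uniq// => i j /eqP.
  by rewrite eqr_nat => /eqP.
exists [seq x <- t | P.[x] != 0]; split; first exact: filter_uniq.
  have : (size [seq x <- t | root P x] < size P)%N.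
    apply: max_poly_roots => //; last exact: filter_uniq.
    by apply/allP => x; rewrite mem_filter => /andP[].
  have := count_predC (root P) t.
  rewrite !size_filter size_map size_iota => E lt1.
  have -> : count (fun x => P.[x] != 0) t = count (predC (root P)) t by [].
  by rewrite -(leq_add2l (size P)) -E leq_add2r ltnW.
by move=> x; rewrite mem_filter => /andP[].
Qed.

End PolyAux.

Section Numerator.
Variables (R : realType) (M : riemannSurface R).
Local Notation C := (R[i]^o).
Variables (f g : M -> sphere R).
Hypotheses (cM : compact [set: M]) (fm : meromorphic f) (fn : nonconstant f).
Hypotheses (gm : meromorphic g) (gn : nonconstant g).
Hypothesis fg : forall a, f a = None -> g a <> None.

Let D := fiber_seq g None.
Let DP d : (d \in D) <-> g d = None.
Proof. exact: mem_fiber_seq. Qed.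

Lemma pole_polyE : pole_poly f g =
  \prod_(d <- D) ('X - (finpart f d)%:P) ^+ `|mero_ord g d|%N.
Proof. by rewrite /pole_poly fsbig_finite//; exact: fiber_finite. Qed.

Lemma horner_pole_poly (z : C) : (pole_poly f g).[z] =
  \prod_(d <- D) (z - finpart f d) ^+ `|mero_ord g d|%N.
Proof.
rewrite pole_polyE horner_prod; apply: eq_bigr => d _.
by rewrite horner_exp hornerXsubC.
Qed.

Lemma pole_poly_neq0 : pole_poly f g != 0.
Proof.
rewrite pole_polyE prodf_seq_neq0; apply/allP => d _ /=.
by rewrite expf_neq0// polyXsubC_eq0.
Qed.

Lemma pole_ord_gt0 d : g d = None -> (0 < `|mero_ord g d|)%N.
Proof.
by move=> gd; have := mero_ord_sign0 d gm gn;
  rewrite gd /= absz_gt0 => /lt_eqF ->.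
Qed.

Lemma pole_poly_rootP (z : C) :
  (pole_poly f g).[z] = 0 <-> exists2 d, g d = None & f d = Some z.
Proof.
rewrite horner_pole_poly; split=> [/eqP|[d gd fd]].
  rewrite prodf_seq_eq0 => /hasP[d /DP gd].
  rewrite expf_eq0 /= pole_ord_gt0//= subr_eq0 => /eqP zd; exists d => //.
  by rewrite zd; apply: finpartE => fd; exact: fg fd gd.
apply/eqP; rewrite prodf_seq_eq0; apply/hasP; exists d; first exact/DP.
by rewrite expf_eq0 /= pole_ord_gt0//= /finpart fd subrr.
Qed.

(** The exponent is the one of [fiber_prod_lim]: the roots of the polynomial
    that equal z0 come from the poles of g over z0. *)
Lemma pole_poly_split (z0 : C) : exists2 P1 : {poly R[i]}, P1.[z0] != 0 &
  forall z : C, (pole_poly f g).[z] =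
    (z - z0) ^+ (\sum_(a <- fiber_seq f (Some z0)) pole_mult g a) * P1.[z].
Proof.
exists (\prod_(d <- D | f d != Some z0) ('X - (finpart f d)%:P) ^+ `|mero_ord
  g d|%N).
  rewrite horner_prod prodf_seq_neq0; apply/allP => d /DP gd;
    apply/implyP => fd.
  rewrite horner_exp hornerXsubC expf_neq0// subr_eq0.
  apply: contraNneq fd => ->; apply/eqP/esym/esym/finpartE => fd.
  exact: fg fd gd.
move=> z; rewrite horner_pole_poly (bigID (fun d => f d == Some z0)) /=;
  congr (_ * _).
  rewrite -prodrXr; pose F a : C := (z - z0) ^+ pole_mult g a.
  rewrite [RHS](bigID (fun a => g a == None)) /= [X in _ * X]big1 ?mulr1;
    last first.
    by move=> a; rewrite /pole_mult; case: (g a).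
  rewrite -big_filter -[RHS]big_filter.
  rewrite (perm_big [seq a <- fiber_seq f (Some z0) | g a == None]).
    apply: eq_big_seq => a; rewrite mem_filter => /andP[/eqP ga /mem_fiber_seq].
    by move=> /(_ cM fm fn) fa; rewrite /pole_mult ga /finpart fa.
  apply: uniq_perm; rewrite ?filter_uniq ?fiber_seq_uniq// => a.
  rewrite !mem_filter; apply/andP/andP => -[/eqP h1].
    by move=> /DP h2; rewrite h2 eqxx; split=> //; apply/mem_fiber_seq.
  by move=> /mem_fiber_seq => /(_ cM fm fn) h2; rewrite h2 eqxx; split=> //;
    apply/DP.
by rewrite horner_prod; apply: eq_bigr => d _; rewrite horner_exp hornerXsubC.
Qed.

Lemma numerator_lim (w z0 : C) : exists l : C,
  [/\ fiber_prod f g w z * (pole_poly f g).[z] @[z --> z0^'] --> l,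
    (forall a, f a = Some z0 -> g a <> Some w) -> l != 0 &
    (pole_poly f g).[z0] <> 0 ->
      l = fiber_prod f g w z0 * (pole_poly f g).[z0]].
Proof.
have [l [fl l0 lE]] := fiber_prod_lim cM fm fn gm gn w z0.
have [P1 P10 PE] := pole_poly_split z0.
exists (l * P1.[z0]); split.
- have fP := cvgC_M (FF := dnbhs_filter z0) fl (@poly_cvg R P1 z0).
  apply: (near_cvg_eq _ fP).
  by apply: nbhs_dnbhs; apply: near_all => z; rewrite PE mulrA.
- by move=> /l0 ln0; rewrite mulf_neq0.
move=> Pz0; have gN a : f a = Some z0 -> g a <> None.
  by move=> fa ga; apply: Pz0; apply/pole_poly_rootP; exists a.
rewrite lE// PE big1_seq ?expr0 ?mul1r// => a /andP[_ /mem_fiber_seq].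
by move=> /(_ cM fm fn) /gN; rewrite /pole_mult; case: (g a).
Qed.

(** By [fiber_prod_inv] the product is bounded near infinity: the fibre of 1 /
    f over 0 consists of the poles of f, none of which is a pole of g. *)
Lemma numerator_growth (w : C) : exists K r0 : R, forall z : C, r0 <= cabs z ->
  cabs (fiber_prod f g w z * (pole_poly f g).[z] : C) <=
  K * cabs z ^+ size (pole_poly f g).
Proof.
have im := mero_inv_mero fm fn; have ic := mero_inv_nonconst fn.
have [l [fl _ _]] := fiber_prod_lim cM im ic gm gn w 0.
rewrite big1_seq in fl; last first.
  move=> a /andP[_ /mem_fiber_seq] => /(_ cM im ic) fa; rewrite /pole_mult.
  have : g a <> None.
    apply: fg; apply: (can_inj (@sphere_invK R)).
    by rewrite -/(mero_inv f a) fa /= ?eqxx.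
  by case: (g a).
have /cvgCP/(_ 1 ltr01)/dnbhsCP[r r0 hr] := fl.
have [K hK] := poly_growth (pole_poly f g).
exists ((cabs l + 1) * K), (Num.max 1 (2 / r)) => z;
  rewrite ge_max => /andP[z1 zr].
have nz0 : 0 < cabs z by lra.
have z0 : z != 0 by rewrite -cabs_gt0.
have rz : cabs (z^-1 - 0) < r.
  rewrite subr0 cabsV -(ltr_pM2r nz0) mulVf ?gt_eqF//.
  have := zr; rewrite ler_pdivrMr//; lra.
have := hr z^-1 (invr_neq0 z0) rz; rewrite expr0 mulr1 -fiber_prod_inv// => lt1.
have le1 : cabs (fiber_prod f g w z) <= cabs l + 1.
  rewrite (le_trans (cabs_le_sub _ l))// addrC lerD2l ltW//.
rewrite cabsM -mulrA; apply: ler_pM; rewrite ?cabs_ge0//.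
exact: hK.
Qed.

(** By [numerator_lim] all singularities are removable, and the growth is
    polynomial. The bound on the degree must not depend on [w], for the sake of
    the interpolation that follows. *)
Lemma numerator_poly (w : C) : exists q : {poly R[i]},
  [/\ (size q <= (size (pole_poly f g)).+1)%N,
    forall z : C, (pole_poly f g).[z] <> 0 ->
      fiber_prod f g w z * (pole_poly f g).[z] = q.[z] &
    forall z : C, (forall a, f a = Some z -> g a <> Some w) -> q.[z] != 0].
Proof.
pose u := (fun z : C => fiber_prod f g w z * (pole_poly f g).[z] : C).
have [L HL] : {L : C -> C & forall z0, [/\ u z @[z --> z0^'] --> L z0,
    (forall a, f a = Some z0 -> g a <> Some w) -> L z0 != 0 &
    (pole_poly f g).[z0] <> 0 -> L z0 = u z0]}.
  apply: (@choice _ _ (fun z0 l => [/\ u z @[z --> z0^'] --> l,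
    (forall a, f a = Some z0 -> g a <> Some w) -> l != 0 &
    (pole_poly f g).[z0] <> 0 -> l = u z0])) => z0.
  exact: numerator_lim.
have du (a : C) : \forall z \near a^', derivable u z 1.
  apply: filterS (fiber_prod_derivable cM fm fn gm gn w a) => z dz.
  exact: der_derivable (derM (der_derive dz) (der_horner (pole_poly f g) z)).
have uL (a : C) : u z @[z --> a^'] --> L a by have [] := HL a.
have [q sq qE] := meromorphic_growth_poly du uL (numerator_growth w).
exists q; split.
- exact: sq.
- by move=> z Pz; have [_ _ /(_ Pz) E] := HL z; rewrite -qE E.
- by move=> z gz; have [_ /(_ gz) L0 _] := HL z; rewrite -qE.
Qed.

(** Interpolate in z, at sufficiently many points where the denominator does
    not vanish. There the values of the numerator are polynomials in w, because
    the fibre does not vary with w. *)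
Lemma bivariate_numerator : exists Q : {poly {poly R[i]}},
  forall z w : C,
  [/\ (pole_poly f g).[z] <> 0 ->
      Q.[z%:P].[w] = fiber_prod f g w z * (pole_poly f g).[z] &
    (forall a, f a = Some z -> g a <> Some w) -> Q.[z%:P].[w] != 0].
Proof.
set P := pole_poly f g.
have [s [us ss Ps]] := many_nonroots (size P).+1 pole_poly_neq0.
pose H (x : C) : {poly R[i]} := \prod_(a <- fiber_seq f (Some (x : R[i])))
  ((finpart g a)%:P - 'X) ^+ `|mero_ord (mero_sub f x) a|%N.
have HE (x w : C) : (H x).[w] = fiber_prod f g w x.
  rewrite /H horner_prod fiber_prodE//; apply: eq_bigr => a _.
  by rewrite horner_exp hornerD hornerN hornerX hornerC.
exists (\sum_(x <- s) map_poly polyC (lagrange_poly s x) * (P.[x] *: H x)%:P).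
move=> z w; have [q [sq q1 q2]] := numerator_poly w.
have -> : (\sum_(x <- s) map_poly polyC (lagrange_poly s x) *
    (P.[x] *: H x)%:P).[z%:P].[w] = q.[z].
  rewrite [in RHS](lagrange_interpolation us (leq_trans sq ss)).
  rewrite !horner_sum; apply: eq_big_seq => x xs.
  rewrite hornerM hornerC horner_map hornerM hornerC !hornerZ mulrC.
  by rewrite -q1 -?HE; [rewrite [P.[x] * _]mulrC|apply/eqP; exact: Ps].
by split; [move=> Pz; rewrite q1|exact: q2].
Qed.

End Numerator.

(** * The elimination function *)

Section Final.
Variables (R : realType) (M : riemannSurface R).
Local Notation C := (R[i]^o).
Implicit Types (x y a : M) (f g : M -> sphere R).

Lemma mero_ord_pole f a (z : C) : meromorphic f -> nonconstant f ->
  f a = None -> mero_ord (mero_sub f z) a = mero_ord f a.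
Proof.
move=> fm fn fa; have [c cA ac] := rs_cover a; have co := chart_coord cA ac.
have [k Hk] := mero_sub_has_ord fm fn z a.
have [n Hn] := mero_sub_has_ord fm fn 0 a; rewrite mero_sub0 in Hn.
have [l [l0 _ fl]] := has_ord_asymp co Hn.
have n0 : n < 0 by have := mero_ord_sign0 a fm fn; rewrite (mero_ordE Hn) fa.
rewrite (mero_ordE Hn).
have fN := mero_isolated_all fm fn a None.
apply: (mero_ord_asymp (l := l) co Hk); split.
- exact: l0.
- by apply: filterS fN => x; rewrite /mero_sub; case: (f x).
have [e eE e0] : exists2 e : nat, - n = e%:Z & (0 < e)%N.
  by exists `|n|%N; [rewrite ltz0_abs|rewrite absz_gt0 lt_eqF].
rewrite eE in fl *.
have H2 : (fun x => - z * (c x - c a) ^+ e : C) @ a^' --> (- z * 0 ^+ e : C).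
  have Hz : (fun _ : M => - z : C) @ a^' --> (- z : C) by exact: cvg_cst.
  have Hc : (fun x => (c x - c a) ^+ e : C) @ a^' --> (0 ^+ e : C).
    by apply: cvg_expn; exact: coord_cvg0 co.
  by apply: cvgC_M; [exact: Hz|exact: Hc].
have lE : l + - z * 0 ^+ e = l by rewrite expr0n gtn_eqF// mulr0 addr0.
rewrite -lE; apply: (near_cvg_eq _ (cvgC_D fl H2)).
apply: filterS fN => x /finpartE fx.
by rewrite /mero_sub fx /= -exprnP mulrBl mulNr.
Qed.

Lemma sphere_prod_Some (I : Type) (r : seq I) (h : I -> R[i]) :
  \big[@sphere_mul R/Some 1]_(a <- r) Some (h a) = Some (\prod_(a <- r) h a).
Proof. by elim/big_rec2: _ => // i y1 y2 _ ->. Qed.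

Lemma sphere_prod_None (I : eqType) (r : seq I) (h : I -> sphere R) j :
  (forall i, i \in r -> h i <> Some 0) -> j \in r -> h j = None ->
  \big[@sphere_mul R/Some 1]_(i <- r) h i = None.
Proof.
have mulN0 (u v : sphere R) : u <> Some 0 -> v <> Some 0 ->
    sphere_mul u v <> Some 0.
  case: u v => [u|] [v|] //= u0 v0.
  + case=> /eqP; rewrite mulf_eq0 => /orP[] /eqP E;
      [by apply: u0; rewrite E|by apply: v0; rewrite E].
  + by case: eqP => [E|//]; case: u0; rewrite E.
  + by case: eqP => [E|//]; case: v0; rewrite E.
have mulNone (u : sphere R) : u <> Some 0 -> sphere_mul u None = None.
  by case: u => [u|] //= u0; case: eqP => [E|//]; case: u0; rewrite E.
have prodN0 (s : seq I) : (forall i, i \in s -> h i <> Some 0) ->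
    \big[@sphere_mul R/Some 1]_(i <- s) h i <> Some 0.
  elim: s => [_|i s IH H].
    by rewrite big_nil => -[] /eqP; rewrite oner_eq0.
  rewrite big_cons; apply: mulN0; first by apply: H; rewrite mem_head.
  by apply: IH => k ks; apply: H; rewrite inE ks orbT.
elim: r => [//|i r IH] H; rewrite inE => /orP[/eqP <-|jr] hj.
  rewrite big_cons hj sphere_mulC; apply: mulNone; apply: prodN0 => k kr.
  by apply: H; rewrite inE kr orbT.
rewrite big_cons IH//; first by apply: mulNone; apply: H; rewrite mem_head.
by move=> k kr; apply: H; rewrite inE kr orbT.
Qed.

Section TwoFunctions.
Variables (f g : M -> sphere R).
Hypotheses (cM : compact [set: M]) (fm : meromorphic f) (fn : nonconstant f).
Hypotheses (gm : meromorphic g) (gn : nonconstant g).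
Hypothesis fg : forall a, f a = None -> g a <> None.

Let ordf z a := mero_ord (mero_sub f z) a.
Let ordg w a := mero_ord (mero_sub g w) a.
Let fsign z a := mero_ord_sign fm fn z a.
Let gsign w a := mero_ord_sign gm gn w a.

Lemma ord_prod_lt0 (z w : C) a : ordf z a * ordg w a < 0 ->
  (f a = Some z /\ g a = None) \/ (f a = None /\ g a = Some w).
Proof.
have := fsign z a; have := gsign w a; rewrite -/(ordf z a) -/(ordg w a).
have := @fg a; case: (f a) => [u|]; case: (g a) => [v|] //= gf.
- case: (eqVneq v w) => _; case: (eqVneq u z) => _.
  + by move=> v0 u0; rewrite ltNge mulr_ge0// ltW.
  + by move=> _ /eqP ->; rewrite mul0r ltxx.
  + by move=> /eqP -> _; rewrite mulr0 ltxx.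
  + by move=> _ /eqP ->; rewrite mul0r ltxx.
- by move=> _; case: (eqVneq u z) => [->|_ /eqP ->]; [left|rewrite mul0r ltxx].
- by case: (eqVneq v w) => [->|_ /eqP -> _]; [right|rewrite mulr0 ltxx].
- by have := gf erefl.
Qed.

Lemma ord_prod_gt0 (z w : C) a : 0 < ordf z a * ordg w a ->
  f a = Some z /\ g a = Some w.
Proof.
have := fsign z a; have := gsign w a; rewrite -/(ordf z a) -/(ordg w a).
have := @fg a; case: (f a) => [u|]; case: (g a) => [v|] //= gf.
- case: (eqVneq v w) => [->|_]; case: (eqVneq u z) => [->|_] //.
  + by move=> _ /eqP ->; rewrite mul0r ltxx.
  + by move=> /eqP -> _; rewrite mulr0 ltxx.
  + by move=> _ /eqP ->; rewrite mul0r ltxx.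
- move=> v0; case: (eqVneq u z) => [_ u0|_ /eqP ->]; last by rewrite mul0r ltxx.
  by rewrite pmulr_rgt0// => /lt_gtF; rewrite v0.
- case: (eqVneq v w) => [_ v0 u0|_ /eqP -> _]; last by rewrite mulr0 ltxx.
  by rewrite pmulr_lgt0// => /lt_gtF; rewrite u0.
- by have := gf erefl.
Qed.

(** If (z, w) is exceptional, then f - z and g - w have a common zero, and a
    zero of one of them is a pole of the other. The latter leaves finitely many
    choices for one of z and w, and the former then finitely many for the
    other. *)
Lemma nonadmissible_finite :
  finite_set [set zw : R[i] * R[i] | ~ elimination_defined f g zw.1 zw.2].
Proof.
have sub : [set zw : R[i] * R[i] | ~ elimination_defined f g zw.1 zw.2] `<=`
  (\bigcup_(d in [set d | g d = None])
     (fun b => (finpart f d : R[i], finpart g b : R[i])) @`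
       [set b | f b = f d]) `|`
  (\bigcup_(b in [set b | f b = None])
     (fun a => (finpart f a : R[i], finpart g b : R[i])) @`
       [set a | g a = g b]).
  move=> [z w] /= /not_orP[/existsNP[a /negP] + /existsNP[b /negP]].
  rewrite -!ltNge => /ord_prod_lt0 ha /ord_prod_gt0[fb gb].
  case: ha => -[fa ga]; [left|right]; exists a => //; exists b.
  - by rewrite /= fb fa.
  - by rewrite /finpart fa gb.
  - by rewrite /= gb ga.
  - by rewrite /finpart fb ga.
apply: sub_finite_set sub _; rewrite finite_setU; split.
  apply: bigcup_finite; first exact: fiber_finite.
  by move=> d _; apply: finite_image; exact: fiber_finite.
apply: bigcup_finite; first exact: fiber_finite.
by move=> d _; apply: finite_image; exact: fiber_finite.
Qed.

Lemma elimination_seq (z w : C) : elimination f g z w =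
  \big[@sphere_mul R/Some 1]_(a <- fiber_seq f (Some (z : R[i])) ++ fiber_seq
    f None)
    sphere_exp (mero_sub g w a) (ordf z a).
Proof.
rewrite /elimination /mero_resultant.
rewrite (fsbigE (fiber_seq f (Some (z : R[i])) ++ fiber_seq f None))//.
- by apply: eq_bigl => a; rewrite in_setT.
- rewrite cat_uniq !fiber_seq_uniq /= andbT; apply/hasPn => a.
  move=> /mem_fiber_seq => /(_ cM fm fn) fa; apply/negP.
  by move=> /mem_fiber_seq => /(_ cM fm fn); rewrite fa.
move=> a _; rewrite mem_cat negb_or => /andP[/negP a1 /negP a2].
suff -> : mero_ord (mero_sub f z) a = 0.
  by case: (mero_sub g w a) => [u|] //=; rewrite ltxx andbF expr0z.
have := fsign z a; case fa : (f a) => [u|] /=.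
  case: eqP => [uz|_ /eqP //]; case: a1; apply/mem_fiber_seq => //.
  by rewrite fa uz.
by case: a2; apply/mem_fiber_seq.
Qed.

Lemma elimination_regular (z w : C) :
  (pole_poly f g).[z] <> 0 -> (pole_poly g f).[w] <> 0 ->
  elimination f g z w = Some (fiber_prod f g w z *
    ((-1) ^+ (\sum_(b <- fiber_seq f None) `|mero_ord f b|%N) /
      (pole_poly g f).[w])).
Proof.
move=> Pz Rw; rewrite elimination_seq.
have gf a : g a = None -> f a <> None by move=> ga fa; exact: fg fa ga.
pose h a : R[i] := (finpart g a - w) ^ (ordf z a).
have E : forall a, a \in fiber_seq f (Some (z : R[i])) ++ fiber_seq f None ->
    sphere_exp (mero_sub g w a) (ordf z a) = Some (h a).
  move=> a; rewrite mem_cat => /orP[] /mem_fiber_seq => /(_ cM fm fn) fa.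
    have ga : g a <> None.
      by move=> ga; apply: Pz; apply/pole_poly_rootP => //; exists a.
    have := fsign z a; rewrite fa /= eqxx -/(ordf z a) => oz.
    by rewrite /mero_sub (finpartE ga) /= ltNge (ltW oz) andbF.
  have ga : g a <> None by exact: fg.
  rewrite /mero_sub (finpartE ga) /= subr_eq0; case: eqP => [gw|//].
  case: Rw; apply/pole_poly_rootP => //; exists a => //.
  by rewrite (finpartE ga) gw.
rewrite (eq_big_seq _ E) sphere_prod_Some big_cat /=; congr (Some (_ * _)).
  rewrite fiber_prodE//; apply: eq_big_seq => a /mem_fiber_seq.
  move=> /(_ cM fm fn) fa; rewrite /h.
  have := fsign z a; rewrite fa /= eqxx -/(ordf z a) => oz.
  by rewrite -{1}(gez0_abs (ltW oz)).
rewrite horner_pole_poly// -prodrXr -prodfV -big_split /=.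
apply: eq_big_seq => b /mem_fiber_seq => /(_ cM fm fn) fb.
rewrite /h /ordf mero_ord_pole//.
have := mero_ord_sign0 b fm fn; rewrite fb /= => o0.
have kE : mero_ord f b = - `|mero_ord f b|%N%:Z by rewrite ltz0_abs// opprK.
rewrite {1}kE -invr_expz -exprnP -[finpart g b - w]opprB.
rewrite (exprNn (w - finpart g b)) invfM; congr (_ * _).
by rewrite -exprVn invrN invr1.
Qed.

(** At a root of either denominator a zero of one function is a pole of the
    other, so that admissibility requires all products of orders to be at most
    0. *)
Lemma no_common_zero (z w : C) : elimination_defined f g z w ->
  (pole_poly f g).[z] = 0 \/ (pole_poly g f).[w] = 0 ->
  forall a, f a = Some z -> g a <> Some w.
Proof.
move=> adm PR a fa ga.
have gf b : g b = None -> f b <> None by move=> gb fb; exact: fg fb gb.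
have pos : 0 < ordf z a * ordg w a.
  have := fsign z a; have := gsign w a; rewrite fa ga /= !eqxx => ? ?.
  exact: mulr_gt0.
have [b neg] : exists b, ordf z b * ordg w b < 0.
  case: PR => /pole_poly_rootP.
    move=> /(_ cM gm gn fg) [b gb fb]; exists b.
    have := fsign z b; have := gsign w b; rewrite fb gb /= eqxx => ? ?.
    by rewrite pmulr_rlt0.
  move=> /(_ cM fm fn gf) [b fb gb]; exists b.
  have := fsign z b; have := gsign w b; rewrite fb gb /= eqxx => ? ?.
  by rewrite pmulr_llt0.
case: adm => adm; first by have := adm b; rewrite leNgt neg.
by have := adm a; rewrite leNgt pos.
Qed.

Lemma elimination_infinite (z w : C) : elimination_defined f g z w ->
  (pole_poly f g).[z] = 0 \/ (pole_poly g f).[w] = 0 ->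
  elimination f g z w = None.
Proof.
move=> adm PR; have ncz := no_common_zero adm PR.
have gf a : g a = None -> f a <> None by move=> ga fa; exact: fg fa ga.
have [b [bL bN]] : exists b,
    b \in fiber_seq f (Some (z : R[i])) ++ fiber_seq f None /\
    sphere_exp (mero_sub g w b) (ordf z b) = None.
  case: PR => /pole_poly_rootP.
    move=> /(_ cM gm gn fg) [b gb fb]; exists b; split.
      by rewrite mem_cat; apply/orP; left; apply/mem_fiber_seq.
    have := fsign z b; rewrite fb /= eqxx /mero_sub gb /= -/(ordf z b) => o0.
    by rewrite gt_eqF// ltNge ltW.
  move=> /(_ cM fm fn gf) [b fb gb]; exists b; split.
    by rewrite mem_cat; apply/orP; right; apply/mem_fiber_seq.
  have := fsign z b; rewrite fb /= /mero_sub gb /= -/(ordf z b) => o0.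
  by rewrite subrr eqxx o0.
rewrite elimination_seq; apply: (sphere_prod_None _ bL bN) => a.
rewrite mem_cat => /orP[] /mem_fiber_seq => /(_ cM fm fn) fa.
  have := fsign z a; rewrite fa /= eqxx -/(ordf z a) => o0.
  have := ncz a fa; rewrite /mero_sub; case: (g a) => [v|] /= vw.
    rewrite ltNge (ltW o0) andbF => -[] /eqP; rewrite expfz_eq0 subr_eq0.
    by move=> /andP[_ /eqP vE]; apply: vw; rewrite vE.
  by rewrite gt_eqF// ltNge (ltW o0).
have := fsign z a; rewrite fa /= -/(ordf z a) => o0.
have := fg fa; rewrite /mero_sub; case: (g a) => [v|] //= _.
rewrite o0 andbT; case: eqP => [//|/eqP v0] [] /eqP.
by rewrite expfz_eq0 (negPf v0) andbF.
Qed.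

End TwoFunctions.
End Final.

Theorem theorem1 (R : realType) (M : riemannSurface R) (f g : M -> sphere R) :
  compact [set: M] ->
  meromorphic f -> meromorphic g ->
  nonconstant f -> nonconstant g ->
  poles f `&` poles g = set0 ->
  finite_set [set zw : R[i] * R[i] | ~ elimination_defined f g zw.1 zw.2] /\
  exists Q : {poly {poly R[i]}},
    forall z w : R[i], elimination_defined f g z w ->
      elimination f g z w =
        sphere_quot Q.[z%:P].[w] ((pole_poly f g).[z] * (pole_poly g f).[w]).
Proof.
move=> cM fm gm fn gn disj.
have fg a : f a = None -> g a <> None.
  by move=> fa ga; have : (poles f `&` poles g) a by []; rewrite disj.
split; first exact: nonadmissible_finite.
have [Q0 HQ] := bivariate_numerator cM fm fn gm gn fg.
pose sg : R[i] := (-1) ^+ (\sum_(b <- fiber_seq f None) `|mero_ord f b|%N).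
have sg0 : sg != 0 by rewrite expf_neq0// oppr_eq0 oner_eq0.
exists (sg%:P%:P * Q0) => z w adm; have [Q1 Q2] := HQ z w.
have QE : (sg%:P%:P * Q0).[z%:P].[w] = sg * Q0.[z%:P].[w].
  by rewrite hornerM hornerC hornerM hornerC.
have [PR|nPR] := pselect ((pole_poly f g).[z] = 0 \/ (pole_poly g f).[w] = 0).
  have ncz := no_common_zero cM fm fn gm gn fg adm PR.
  rewrite elimination_infinite// QE /sphere_quot /=.
  have -> : (pole_poly f g).[z] * (pole_poly g f).[w] = 0.
    by case: PR => ->; rewrite ?mulr0 ?mul0r.
  by rewrite eqxx mulf_eq0 (negPf sg0) (negPf (Q2 ncz)).
have [Pz Rw] : (pole_poly f g).[z] <> 0 /\ (pole_poly g f).[w] <> 0.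
  by split=> E; apply: nPR; [left|right].
rewrite elimination_regular// QE Q1// /sphere_quot /= mulf_eq0.
move/eqP/negPf: (Pz) => P0; move/eqP/negPf: (Rw) => R0; rewrite P0 R0 /=.
congr Some; rewrite -/sg; field.
by rewrite P0 R0.
Qed.
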